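(* Let $\mu\in\mathcal{U}$ be concentrated on infinite trees. If $\mu$ is extremal and $\overline{\deg}(\mu)<\infty$, then the speed of simple random walk is $\widehat\mu$-a.s. $$1-\frac{2}{\overline{\deg}(\mu)}.$$
   Context: A network is a (multi-)graph with marks in a complete separable metric space on its vertices and, at each endpoint, on its edges. $\mathcal{G}_*$ is the set of rooted-isomorphism classes of rooted connected locally finite networks $(G,o)$ with the topology of local convergence; $\mathcal{G}_{**}$ is the analogous space of networks $(G,x,y)$ with an ordered pair of distinguished vertices. $\mathcal{U}$ is the convex set of unimodular probability measures on $\mathcal{G}_*$, i.e. Borel probability measures $\mu$ with $\int\sum_{x\in V(G)} f(G,o,x)\,d\mu=\int\sum_{x\in V(G)} f(G,x,o)\,d\mu$ for all Borel $f:\mathcal{G}_{**}\to[0,\infty]$. $\mu\in\mathcal{U}$ is extremal if it is not a nontrivial convex combination of other elements of $\mathcal{U}$. $\overline{\deg}(\mu)$ is the $\mu$-expectation of the degree of the root. Here $\widehat\mu$ is the law of the trajectory $((G,w_0),\langle w_n: n\ge 0\rangle)$ obtained by choosing $(G,w_0)$ from $\mu$ biased by the degree of the root (density $\deg_G(o)/\overline{\deg}(\mu)$ with respect to $\mu$) and then running simple random walk $\langle w_n\rangle$ on $G$ from $w_0$. The speed of a path $\langle w_n\rangle$ in $G$ is $\lim_{n\to\infty}\mathrm{dist}_G(w_0,w_n)/n$ when this limit exists. *)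

(* Defs.v *)
From HB Require Import structures.
From mathcomp Require Import all_boot all_order all_algebra.
From mathcomp Require Import generic_quotient finmap.
From mathcomp Require Import all_classical all_reals all_analysis.
From mathcomp Require Import measurable_realfun.

Set Implicit Arguments.
Unset Strict Implicit.
Unset Printing Implicit Defensive.

Import Order.TTheory GRing.Theory Num.Theory.
Import numFieldNormedType.Exports.

Local Open Scope classical_set_scope.
Local Open Scope quotient_scope.
Local Open Scope ring_scope.

(* Complete metric spaces. Nonemptiness is harmless (there is no network with *)
(* marks in an empty space) and is needed for the measurable types below.     *)
#[short(type="completeMetricType")]
HB.structure Definition CompleteMetric (R : realType) :=
  {M of Pointed M & Complete M & Metric R M}.

Definition separable_space (T : topologicalType) :=
  exists2 D : set T, countable D & dense D.

(* Multigraphs are given by darts (oriented edges): an edge is a pair         *)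
(* {d, rev d}, and a dart d also stands for the end of its edge at src d, so  *)
(* that dmark d is the mark of the edge at that endpoint. A loop consists of  *)
(* two darts, hence contributes 2 to the degree.                              *)
Record network (M : Type) := Network {
  vert : Type;
  dart : Type;
  src : dart -> vert;
  rev : dart -> dart;
  revK : involutive rev;
  rev_neq : forall d, rev d <> d;
  vmark : vert -> M;
  dmark : dart -> M }.

Arguments src {M n}.
Arguments rev {M n}.
Arguments vmark {M n}.
Arguments dmark {M n}.

HB.instance Definition _ M (N : network M) := gen_eqMixin (vert N).
HB.instance Definition _ M (N : network M) := gen_choiceMixin (vert N).
HB.instance Definition _ M (N : network M) := gen_eqMixin (dart N).
HB.instance Definition _ M (N : network M) := gen_choiceMixin (dart N).

Section graph.
Variables (M : Type) (N : network M).
Implicit Types (x y : vert N) (d : dart N).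

Definition tgt d := src (rev d).

Fixpoint walk (n : nat) x y : Prop :=
  if n is m.+1 then exists2 d, src d = x & walk m (tgt d) y else x = y.

Definition connected_net := forall x y, exists n, walk n x y.

Definition locally_finite := forall x, finite_set [set d | src d = x].

(* A cycle visits no vertex twice and never traverses an edge in both         *)
(* directions; loops and pairs of parallel edges are cycles.                  *)
Definition is_cycle (c : seq (dart N)) :=
  [/\ c != [::], path.cycle (fun d e => tgt d == src e) c,
      uniq [seq src d | d <- c] & {in c, forall d, rev d \notin c}].

Definition is_tree := connected_net /\ forall c, ~ is_cycle c.

Definition dist x y : nat :=
  xget 0%N [set n | walk n x y /\ forall m, walk m x y -> (n <= m)%N].

Definition deg x : nat := #|` fset_set [set d | src d = x]|%fset.

(* The union of the balls of radius r around the roots.                       *)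
Definition nball (I : Type) (o : I -> vert N) (r : nat) : set (vert N) :=
  [set x | exists i n, (n <= r)%N /\ walk n (o i) x].

Lemma nball_root (I : Type) (o : I -> vert N) r i : nball o r (o i).
Proof. by exists i, 0%N. Qed.

End graph.

Section induced.
Variables (M : Type) (N : network M) (A : set (vert N)).

Let V := {x | A x}.
Let D := {d | A (src d) /\ A (tgt d)}.

Lemma induced_revP (d : D) :
  A (src (rev (sval d))) /\ A (tgt (rev (sval d))).
Proof. by case: d => d /= [Ad Ad']; split => //; rewrite /tgt revK. Qed.

Definition induced_src (d : D) : V := exist _ (src (sval d)) (svalP d).1.

Definition induced_rev (d : D) : D := exist _ (rev (sval d)) (induced_revP d).

Lemma induced_revK : involutive induced_rev.
Proof. by case=> d Ad; apply: eq_exist; rewrite /= revK. Qed.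

Lemma induced_rev_neq d : induced_rev d <> d.
Proof. by move=> /(congr1 sval)/= /rev_neq. Qed.

Definition induced : network M :=
  @Network M V D induced_src induced_rev induced_revK induced_rev_neq
    (fun x => vmark (sval x)) (fun d => dmark (sval d)).

End induced.

(* Isomorphisms of rooted networks, where corresponding marks are related by  *)
(* rel. The roots are a family indexed by I.                                  *)
Definition rooted_iso (M : Type) (rel : M -> M -> Prop) (I : Type)
    (N N' : network M) (o : I -> vert N) (o' : I -> vert N') :=
  exists (f : vert N -> vert N') (g : dart N -> dart N'),
    [/\ bijective f, bijective g,
        (forall d, src (g d) = f (src d)) /\ (forall d, rev (g d) = g (rev d)),
        (forall x, rel (vmark x) (vmark (f x))) /\
          (forall d, rel (dmark d) (dmark (g d)))
      & forall i, f (o i) = o' i].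

Record rnet (M I : Type) := RNet {
  net :> network M;
  root : I -> vert net;
  net_connected : connected_net net;
  net_locfin : locally_finite net }.

Arguments root {M I} r i.
Arguments net_connected {M I} r.
Arguments net_locfin {M I} r.

Definition reroot (M I J : Type) (N : rnet M I) (o : J -> vert N) : rnet M J :=
  RNet o (net_connected N) (net_locfin N).

HB.instance Definition _ M I := gen_eqMixin (rnet M I).
HB.instance Definition _ M I := gen_choiceMixin (rnet M I).

Section classes.
Variables (M I : Type).

Definition iso : rel (rnet M I) :=
  fun N N' => `[< rooted_iso eq (root N) (root N') >].

Lemma iso_refl : reflexive iso.
Proof.
by move=> N; apply/asboolP; exists id, id; split => //; exists id.
Qed.

Lemma iso_sym : symmetric iso.
Proof.
suff imp N N' : iso N N' -> iso N' N by move=> N N'; apply/idP/idP; exact: imp.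
move=> /asboolP[f [g [[f' fK f'K] [g' gK g'K] [sg rg] [vf dg] ro]]].
apply/asboolP; exists f', g'; split; [by exists f|by exists g|split|split|].
- by move=> d; rewrite -{2}(g'K d) sg fK.
- by move=> d; apply: (can_inj gK); rewrite g'K -rg g'K.
- by move=> x; rewrite vf f'K.
- by move=> d; rewrite dg g'K.
- by move=> i; rewrite -ro fK.
Qed.

Lemma iso_trans : transitive iso.
Proof.
move=> N2 N1 N3 /asboolP[f [g [bf bg [sg rg] [vf dg] ro]]].
move=> /asboolP[f2 [g2 [bf2 bg2 [sg2 rg2] [vf2 dg2] ro2]]].
apply/asboolP; exists (f2 \o f), (g2 \o g); split; [exact: bij_comp..|split|split|].
- by move=> d /=; rewrite sg2 sg.
- by move=> d /=; rewrite rg2 rg.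
- by move=> x /=; rewrite vf vf2.
- by move=> d /=; rewrite dg dg2.
- by move=> i /=; rewrite ro ro2.
Qed.

Canonical iso_equiv := EquivRel iso iso_refl iso_sym iso_trans.

End classes.

(* netclass M 'I_1 is G_* and netclass M 'I_2 is G_**; netclass M nat is the  *)
(* set of trajectories ((G, w_0), <w_n>), up to isomorphism. Functions on     *)
(* classes are written with representatives: all of those used below are      *)
(* invariant under isomorphism.                                               *)
Definition netclass (M I : Type) := {eq_quot @iso M I}.

HB.instance Definition _ M I := Choice.on (netclass M I).

Definition cls (M I : Type) (N : rnet M I) : netclass M I :=
  \pi_({eq_quot @iso M I}) N.

Definition rep (M I : Type) (g : netclass M I) : rnet M I := repr g.

Section point.
Variables (M : pointedType) (I : Type).

Definition point_net : network M :=
  @Network M unit void (of_void _) id (fun d => match d with end)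
    (fun d => match d with end) (fun=> point) (fun=> point).

Lemma point_net_connected : connected_net point_net.
Proof. by move=> [] []; exists 0%N. Qed.

Lemma point_net_locfin : locally_finite point_net.
Proof. by move=> x; apply: sub_finite_set (@finite_set0 void) => -[]. Qed.

HB.instance Definition _ := isPointed.Build (netclass M I)
  (cls (RNet (fun _ : I => (tt : vert point_net))
    point_net_connected point_net_locfin)).

End point.

Section local_topology.
Variables (R : realType) (M : metricType R) (k : nat).

Definition locally_close (r : nat) (N N' : rnet M 'I_k) :=
  @rooted_iso M (fun a b => mdist a b < r.+1%:R^-1) 'I_k
    (induced (nball (root N) r)) (induced (nball (root N') r))
    (fun i => exist _ (root N i) (nball_root (root N) r i))
    (fun i => exist _ (root N' i) (nball_root (root N') r i)).

(* The topology of the distance 1 / (1 + alpha), with alpha the supremum of   *)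
(* the r such that the two networks are locally close at scale r.             *)
Definition local_open (U : set (netclass M 'I_k)) :=
  forall g, U g -> exists a : nat, forall (r : nat) h,
    (a <= r)%N -> locally_close r (rep g) (rep h) -> U h.

Lemma local_openT : local_open setT.
Proof. by move=> g _; exists 0%N. Qed.

Lemma local_openI : setI_closed local_open.
Proof.
move=> U U' oU oU' g [/oU[a Ua] /oU'[a' Ua']]; exists (maxn a a') => r h.
by rewrite geq_max => /andP[ar a'r] cgh; split; [exact: Ua cgh|exact: Ua' cgh].
Qed.

Lemma local_open_bigU (J : Type) (F : J -> set (netclass M 'I_k)) :
  (forall j, local_open (F j)) -> local_open (\bigcup_j F j).
Proof.
move=> oF g [j _ /oF[a Fa]]; exists a => r h ar cgh.
by exists j => //; exact: Fa cgh.
Qed.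

HB.instance Definition _ := isOpenTopological.Build (netclass M 'I_k)
  local_openT local_openI local_open_bigU.

End local_topology.

Definition Gspace (R : realType) (M : completeMetricType R) (k : nat) : Type :=
  g_sigma_algebraType (@open (netclass M 'I_k)).
HB.instance Definition _ R (M : completeMetricType R) k :=
  Measurable.on (Gspace M k).

Notation Gstar M := (Gspace M 1).
Notation Gstar2 M := (Gspace M 2).

Section unimodular.
Context {R : realType} {M : completeMetricType R}.
Implicit Types (mu : probability (Gstar M) R).
Local Open Scope ereal_scope.

Definition rt (g : Gstar M) : vert (rep g) := root (rep g) ord0.

(* The class [G, x, y], where G underlies the class g. *)
Definition cls2 (g : Gstar M) (x y : vert (rep g)) : Gstar2 M :=
  cls (reroot (tnth [tuple x; y])).

Definition unimodular mu :=
  forall f : Gstar2 M -> \bar R, measurable_fun setT f -> (forall h, 0 <= f h) ->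
  \int[mu]_g (\esum_(x in [set: vert (rep g)]) f (cls2 (rt g) x)) =
  \int[mu]_g (\esum_(x in [set: vert (rep g)]) f (cls2 x (rt g))).

Definition differ mu mu' := exists2 A, measurable A & mu A <> mu' A.

Definition extremal mu := unimodular mu /\
  ~ exists (mu1 mu2 : probability (Gstar M) R) (t : R),
    [/\ unimodular mu1 /\ differ mu1 mu, unimodular mu2 /\ differ mu2 mu,
        (0 < t < 1)%R
      & forall A, measurable A ->
          mu A = t%:E * mu1 A + (1 - t)%:E * mu2 A].

Definition infinite_tree (g : Gstar M) :=
  is_tree (rep g) /\ infinite_set [set: vert (rep g)].

Definition mean_degree mu : \bar R := (\int[mu]_g ((deg (rt g))%:R%:E))%E.

End unimodular.

(* The class [G, w_0, ..., w_n] of an initial segment of a trajectory. *)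
Definition segment (R : realType) (M : completeMetricType R) (n : nat)
    (t : netclass M nat) : Gspace M n.+1 :=
  cls (reroot (fun i : 'I_n.+1 => root (rep t) i)).

Definition Trajectory (R : realType) (M : completeMetricType R) : Type :=
  g_sigma_algebraType [set B : set (netclass M nat) |
    exists n (A : set (Gspace M n.+1)),
      measurable A /\ B = @segment R M n @^-1` A].
HB.instance Definition _ R (M : completeMetricType R) :=
  Measurable.on (Trajectory M).

Section walk.
Context {R : realType} {M : completeMetricType R}.

Definition step_prob (N : network M) (x y : vert N) : R :=
  #|` fset_set [set d | src d = x /\ tgt d = y]|%fset%:R / (deg x)%:R.

Fixpoint walk_prob (N : network M) (x : vert N) (s : seq (vert N)) : R :=
  if s is y :: s' then step_prob x y * walk_prob y s' else 1.

(* P is the law of simple random walk started from mu biased by the degree of *)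
(* the root. The events (G, w_0, ..., w_n) \in A are stable under finite      *)
(* intersections and generate the sigma-algebra, so they determine P.         *)
Definition walk_law (mu : probability (Gstar M) R)
    (P : probability (Trajectory M) R) :=
  forall n (A : set (Gspace M n.+1)), measurable A ->
    P (@segment R M n @^-1` A) =
    (\int[mu]_g (((deg (rt g))%:R / fine (mean_degree mu))%:E *
       \esum_(s in [set s : n.-tuple (vert (rep g)) |
                     A (cls (reroot (tnth [tuple of rt g :: s])))])
         (walk_prob (rt g) s)%:E))%E.

Definition has_speed (t : Trajectory M) (v : R) :=
  (fun n => (dist (root (rep t) 0%N) (root (rep t) n))%:R / n%:R : R) @ \oo
    --> v.

End walk.

(* Main.v *)
(* Let D_n be the distance from w_0 to w_n. On a tree, D increases by 1 along *)
(* every dart out of w_n except, when w_n <> w_0, the one towards w_0. Hence  *)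
(* D_n - sum_{k<n} (1 - 2/deg w_k) - (2/deg w_0) #{k < n : w_k = w_0} has     *)
(* bounded centered increments Y_k, and is o(n) almost surely because, for    *)
(* small lambda of either sign, the products of the 1 + lambda Y_k have       *)
(* expectation 1, so they cannot grow exponentially.                          *)
(*                                                                            *)
(* Unimodularity makes the law of the walk invariant under the shift, so the  *)
(* averages of f(w_k) converge to some f*. The averages u_n of the iterates   *)
(* P^k f have energy O(1/n), so they are almost constant along darts; thus by *)
(* mass transport f* can be moved from the root to any other vertex, and mu   *)
(* reweighted by f* is again unimodular. When mu is extremal this forces f*   *)
(* to be constant, and f = 1/deg gives the limit c = 1 - 2/deg(mu) for X_n/n, *)
(* where X_n = D_n - (2/deg w_0) #{k < n : w_k = w_0}.                        *)
(*                                                                            *)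
(* If c >= 0, then D_n >= X_n, and comparing n with the last visit to w_0     *)
(* before n bounds D_n from above by c n + o(n). If c < 0, then, since        *)
(* D_n >= 0 and by shift invariance, each of w_0, ..., w_K is visited with    *)
(* frequency at least |c|/2; this bounds the number of distinct vertices seen *)
(* by the walk, whereas it reaches distance K with positive probability for   *)
(* every K.                                                                   *)

From HB Require Import structures.
From mathcomp Require Import all_boot all_order all_algebra.
From mathcomp Require Import generic_quotient finmap.
From mathcomp Require Import all_classical all_reals all_analysis.
From mathcomp Require Import measurable_realfun ring lra zify.
Require Import Defs.

Set Implicit Arguments.
Unset Strict Implicit.
Unset Printing Implicit Defensive.

Import Order.TTheory GRing.Theory Num.Theory.
Import numFieldNormedType.Exports.

Local Open Scope classical_set_scope.
Local Open Scope quotient_scope.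
Local Open Scope ring_scope.

(** * Isomorphic networks and local closeness *)

(** On a tree, all darts out of a vertex [w_n] other than the start [w_0] lead away from [w_0],
    except for exactly one. So the distance [D_n] to [w_0] has conditional drift [1 - 2 / deg w_n]
    away from [w_0], and drift 1 at [w_0]. Three facts turn this into the speed.

    The fluctuations are negligible. The centred increments are bounded, and by [step_op_mart] the
    products of the factors [1 + lam * incr] have mean 1 for small [lam] of either sign. They grow
    at most subexponentially ([mart_growth]), so the centred sum is [o(n)] almost surely
    ([compensated_cvg]).

    Averages along the walk converge to constants. Every dart has a reverse, so unimodularity makes
    the degree-biased walk stationary ([unimodular_step], [shift_invariant]), and Birkhoff's theorem
    ([birkhoff]) gives a limit for the time averages of a function [f] of the current rooted
    network. This limit is constant for the following reason. Tested against functions of the root,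
    the time averages agree with the Cesaro means [uavg f n] of the iterates of the transition
    kernel. These have energy at most [2 / n] ([uavg_energy]), hence become constant along walks of
    bounded length, and mass transport survives a reweighting by the limit ([transport_core],
    [transport]). The reweighted measures are again unimodular, and extremality identifies them with
    [mu] ([extremal_weight]). So the limit is uncorrelated with [f] at each time, therefore with
    itself, and is constant ([ergodic_average]). For [f = 1 / deg] the constant is the inverse of
    the mean degree ([expect_inv_deg]), because the bias by the degree cancels [f].

    The returns to the start do no harm. By [walk_distE], [D_n] is a process [potential] with linear
    rate [c = 1 - 2 / a], where [a] is the mean degree, plus [2 / deg w_0] for every visit to [w_0]
    before time [n]. If [c >= 0], then [D_n] lies above this process and, after the last visit,
    moves with its increments up to a bounded error, so it has the same rate ([reflected_cvg]). A
    negative [c] is excluded by [speed_ge0]: it would force visits of positive frequency to each of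
    [w_0, ..., w_K], more than [n + K] time steps can hold when [K] is large and these vertices are
    distinct, which happens with positive probability ([escape_not_null]). *)

Section net_iso.
Variables (M : Type) (rel : M -> M -> Prop).

(** The roots of [rooted_iso] are left out, so that one isomorphism can be used for every choice of
    distinguished vertices. *)
Definition net_iso (N N' : network M) (f : vert N -> vert N')
    (g : dart N -> dart N') :=
  [/\ bijective f, bijective g,
      (forall d, src (g d) = f (src d)) /\ (forall d, rev (g d) = g (rev d))
    & (forall x, rel (vmark x) (vmark (f x))) /\
      (forall d, rel (dmark d) (dmark (g d)))].

Variables (N N' : network M) (f : vert N -> vert N') (g : dart N -> dart N').
Hypothesis fg : net_iso f g.

Let bf : bijective f. Proof. by case: fg. Qed.
Let bg : bijective g. Proof. by case: fg. Qed.

Lemma net_iso_src d : src (g d) = f (src d).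
Proof. by case: fg => _ _ []. Qed.

Lemma net_iso_rev d : rev (g d) = g (rev d).
Proof. by case: fg => _ _ []. Qed.

Lemma net_iso_tgt d : tgt (g d) = f (tgt d).
Proof. by rewrite /tgt net_iso_rev net_iso_src. Qed.

Lemma net_iso_walk n x y : walk n (f x) (f y) <-> walk n x y.
Proof.
elim: n x => [|n IH] x /=.
  by split=> [/(bij_inj bf)|->].
split=> [[d' d'x wd']|[d dx wd]].
  have [g' gK g'K] := bg.
  exists (g' d'); first by apply: (bij_inj bf); rewrite -net_iso_src g'K.
  by apply/IH; rewrite -net_iso_tgt g'K.
by exists (g d); rewrite ?net_iso_src ?dx// net_iso_tgt; apply/IH.
Qed.

Lemma net_iso_dist x y : dist (f x) (f y) = dist x y.
Proof.
rewrite /dist; congr (xget _ _); apply/seteqP; split => n /= [wn min]; split.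
- by apply/net_iso_walk.
- by move=> m wm; apply: min; apply/net_iso_walk.
- by apply/net_iso_walk.
- by move=> m /net_iso_walk; exact: min.
Qed.

Lemma card_fset_image_inj (T U : choiceType) (h : T -> U) (A : set T) :
  injective h -> #|` fset_set (h @` A)|%fset = #|` fset_set A|%fset.
Proof.
move=> hinj; have [fA|iA] := pselect (finite_set A).
  rewrite fset_set_image// card_imfset//.
(* On an infinite set [fset_set] takes its default value, the empty set; by injectivity the image is
   infinite as well. *)
rewrite /fset_set; case: pselect => [fhA|_]; case: pselect => // _.
case: iA; rewrite (_ : A = h @^-1` (h @` A)).
  by apply: finite_preimage => // x y _ _; exact: hinj.
by apply/seteqP; split => [x Ax|x [y Ay /hinj <-]//]; exists x.
Qed.

Lemma net_iso_card (P : set (dart N)) (P' : set (dart N')) :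
  (forall d, P' (g d) <-> P d) ->
  #|` fset_set P'|%fset = #|` fset_set P|%fset.
Proof.
move=> PP'; rewrite -(@card_fset_image_inj _ _ g P (bij_inj bg)).
congr (#|` fset_set _|%fset); apply/seteqP; split => [d' Pd'|_ [d Pd <-]].
  by have [g' gK g'K] := bg; exists (g' d') => //; apply/PP'; rewrite g'K.
exact/PP'.
Qed.

End net_iso.

Section classes.
Variables (M I : Type).

Lemma clsP (N N' : rnet M I) :
  cls N = cls N' <-> rooted_iso eq (root N) (root N').
Proof.
split=> [/eqmodP/= /asboolP//|?]; apply/eqmodP => /=; exact/asboolP.
Qed.

Lemma rep_cls (N : rnet M I) : cls (rep (cls N)) = cls N.
Proof. exact: reprK. Qed.

Lemma cls_rep (g : netclass M I) : cls (rep g) = g.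
Proof. exact: reprK. Qed.

Lemma cls_iso (N N' : rnet M I) : cls N = cls N' ->
  exists f g, @net_iso M eq N N' f g /\ forall i, f (root N i) = root N' i.
Proof. by move=> /clsP[f [g [bf bg h1 h2 h3]]]; exists f, g. Qed.

End classes.

Lemma iso_cls_reroot (M I J : Type) (N N' : rnet M I) f g (o : J -> vert N) :
  @net_iso M eq N N' f g -> cls (reroot o) = cls (@reroot M I J N' (f \o o)).
Proof. by move=> [bf bg h1 h2]; apply/clsP; exists f, g. Qed.

Section reindex.
Variables (M : Type).

(** Forgetting, repeating or permuting distinguished vertices. The shift, the segments and the
    positions of a trajectory and the exchange of two vertices are all of this form, so they share
    one proof of measurability. *)
Definition pull (I J : Type) (s : J -> I) (g : netclass M I) : netclass M J :=
  cls (reroot (root (rep g) \o s)).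

Lemma pullE (I J : Type) (s : J -> I) (N : rnet M I) :
  pull s (cls N) = cls (reroot (root N \o s)).
Proof.
have [f [g [fg ro]]] := cls_iso (rep_cls N).
rewrite /pull (iso_cls_reroot _ fg); congr (cls (reroot _)).
by apply/funext => i /=; rewrite ro.
Qed.

(** The new root comes last: [unlift ord_max] is [None] exactly at the last index. *)
Definition addr (k : nat) (N : rnet M 'I_k) (x : vert N) : rnet M 'I_k.+1 :=
  reroot (fun i => oapp (root N) x (unlift ord_max i)).

End reindex.

Lemma sval_inj (T : Type) (P : T -> Prop) : injective (@sval T P).
Proof. by move=> [x Px] [y Py] /= xy; exact: eq_exist. Qed.

(** * Isomorphisms between pieces of networks, and closeness of balls *)

Section local_iso.
Variables (M : Type).

(* Isomorphisms between induced networks, encoded as relations so that they *)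
(* can be restricted without transporting dependent types. *)
Record local_iso (rel : M -> M -> Prop) (N N' : network M)
    (A : set (vert N)) (A' : set (vert N'))
    (Rv : vert N -> vert N' -> Prop) (Rd : dart N -> dart N' -> Prop) : Prop :=
  LocalIso {
    li_v : forall x x', Rv x x' -> A x /\ A' x';
    li_vl : forall x, A x -> exists x', Rv x x';
    li_vr : forall x', A' x' -> exists x, Rv x x';
    li_vu : forall x y x' y', Rv x x' -> Rv y y' -> x = y <-> x' = y';
    li_d : forall d d', Rd d d' ->
      (A (src d) /\ A (tgt d)) /\ (A' (src d') /\ A' (tgt d'));
    li_dl : forall d, A (src d) -> A (tgt d) -> exists d', Rd d d';
    li_dr : forall d', A' (src d') -> A' (tgt d') -> exists d, Rd d d';
    li_du : forall d e d' e', Rd d d' -> Rd e e' -> d = e <-> d' = e';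
    li_src : forall d d', Rd d d' -> Rv (src d) (src d');
    li_rev : forall d d', Rd d d' -> Rd (rev d) (rev d');
    li_vm : forall x x', Rv x x' -> rel (vmark x) (vmark x');
    li_dm : forall d d', Rd d d' -> rel (dmark d) (dmark d') }.

Lemma li_tgt rel N N' A A' Rv Rd : @local_iso rel N N' A A' Rv Rd ->
  forall d d', Rd d d' -> Rv (tgt d) (tgt d').
Proof. by move=> h d d' /(li_rev h)/(li_src h). Qed.

Lemma local_iso_sym (rel : M -> M -> Prop) N N' A A' Rv Rd :
  (forall a b, rel a b -> rel b a) ->
  @local_iso rel N N' A A' Rv Rd ->
  @local_iso rel N' N A' A (fun x' x => Rv x x') (fun d' d => Rd d d').
Proof.
move=> rels []; move=> h1 h2 h3 h4 h5 h6 h7 h8 h9 h10 h11 h12; split => //.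
- by move=> x x' /h1[].
- by move=> x y x' y' h h'; have := h4 _ _ _ _ h h'; tauto.
- by move=> d d' /h5[].
- by move=> x y x' y' h h'; have := h8 _ _ _ _ h h'; tauto.
- by move=> d d'; exact: h9.
- by move=> d d'; exact: h10.
- by move=> x x' r; apply: rels; exact: h11 r.
- by move=> d d' r; apply: rels; exact: h12 r.
Qed.

(** Cutting the relations on the left side also cuts them on the right side, because matched
    vertices lie in [B] and [B'] together. *)
Lemma local_iso_sub (rel rel' : M -> M -> Prop) N N' A A' B B' Rv Rd :
  (forall a b, rel a b -> rel' a b) ->
  @local_iso rel N N' A A' Rv Rd ->
  B `<=` A -> B' `<=` A' -> (forall x x', Rv x x' -> B x <-> B' x') ->
  @local_iso rel' N N' B B' (fun x x' => Rv x x' /\ B x)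
    (fun d d' => Rd d d' /\ (B (src d) /\ B (tgt d))).
Proof.
move=> rels h BA BA' BB'.
split.
- by move=> x x' [r Bx]; split=> //; apply/BB'; first exact: r.
- by move=> x Bx; have [x' r] := li_vl h (BA _ Bx); exists x'.
- move=> x' Bx; have [x r] := li_vr h (BA' _ Bx); exists x; split => //.
  by apply/BB'; first exact: r.
- by move=> x y x' y' [r _] [r' _]; exact: li_vu h _ _ _ _ r r'.
- move=> d d' [r [Bs Bt]]; split => //; split.
    by apply/BB'; first exact: (li_src h r).
  by apply/BB'; first exact: (li_tgt h r).
- by move=> d Bs Bt; have [d' r] := li_dl h (BA _ Bs) (BA _ Bt); exists d'.
- move=> d' Bs Bt; have [d r] := li_dr h (BA' _ Bs) (BA' _ Bt); exists d.
  split=> //; split.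
    by apply/BB'; first exact: (li_src h r).
  by apply/BB'; first exact: (li_tgt h r).
- by move=> d e d' e' [r _] [r' _]; exact: li_du h _ _ _ _ r r'.
- by move=> d d' [r []]; split=> //; exact: li_src h _ _ r.
- move=> d d' [r [? ?]]; split; first exact: li_rev h _ _ r.
  by split => //; rewrite /tgt revK.
- by move=> x x' [r _]; apply/rels/(li_vm h).
- by move=> d d' [r _]; apply/rels/(li_dm h).
Qed.

(** One direction takes graphs of bijections; in the other, choice extracts functions from the
    relations and [li_vu], [li_du] make them bijective. *)
Lemma local_isoP (rel : M -> M -> Prop) (I : Type) (N N' : network M)
    (A : set (vert N)) (A' : set (vert N')) (o : I -> {x | A x})
    (o' : I -> {x | A' x}) :
  @rooted_iso M rel I (induced A) (induced A') o o' <->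
  exists Rv Rd, @local_iso rel N N' A A' Rv Rd /\
    forall i, Rv (sval (o i)) (sval (o' i)).
Proof.
split.
  move=> [f [g [[f' fK f'K] [g' gK g'K] [sg rg] [vm dm] ro]]].
  exists (fun x x' => exists Ax, sval (f (exist _ x Ax)) = x').
  exists (fun d d' => exists Ad, sval (g (exist _ d Ad)) = d').
  split; last first.
    move=> i; exists (svalP (o i)); rewrite -(ro i); congr (sval (f _)).
    exact: sval_inj.
  split.
  - by move=> x x' [Ax <-]; split => //; exact: svalP.
  - by move=> x Ax; exists (sval (f (exist _ x Ax))), Ax.
  - move=> x' Ax'; exists (sval (f' (exist _ x' Ax'))), (svalP (f' (exist _ x' Ax'))).
    rewrite (_ : exist _ _ _ = f' (exist _ x' Ax')) ?f'K//.
    exact: sval_inj.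
  - move=> x y x' y' [Ax <-] [Ay <-]; split=> [xy|H].
      by congr (sval (f _)); apply: eq_exist.
    have /(can_inj fK)/(congr1 sval) : f (exist _ x Ax) = f (exist _ y Ay).
      exact: sval_inj.
    by [].
  - by move=> d d' [Ad <-]; split => //; exact: (svalP (g (exist _ d Ad))).
  - by move=> d As At; exists (sval (g (exist _ d (conj As At)))), (conj As At).
  - move=> d' As At; pose d := g' (exist _ d' (conj As At)).
    exists (sval d), (svalP d).
    rewrite (_ : exist _ _ _ = d) ?/d ?g'K//.
    exact: sval_inj.
  - move=> x y x' y' [Ax <-] [Ay <-]; split=> [xy|H].
      by congr (sval (g _)); apply: eq_exist.
    have /(can_inj gK)/(congr1 sval) : g (exist _ x Ax) = g (exist _ y Ay).
      exact: sval_inj.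
    by [].
  - move=> d d' [Ad <-]; exists (svalP (exist _ d Ad : dart (induced A))).1.
    exact: esym (congr1 sval (sg (exist _ d Ad))).
  - move=> d d' [Ad <-]; exists (induced_revP (exist _ d Ad)).
    exact: esym (congr1 sval (rg (exist _ d Ad))).
  - by move=> x x' [Ax <-]; exact: vm (exist _ x Ax).
  - by move=> x x' [Ax <-]; exact: dm (exist _ x Ax).
move=> [Rv [Rd [h ro]]].
have fP (x : {x | A x}) : {y : {y | A' y} | Rv (sval x) (sval y)}.
  apply: cid; have [x' r] := li_vl h (svalP x).
  by exists (exist _ x' (li_v h r).2).
have f'P (x : {x | A' x}) : {y : {y | A y} | Rv (sval y) (sval x)}.
  apply: cid; have [x' r] := li_vr h (svalP x).
  by exists (exist _ x' (li_v h r).1).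
have gP (d : dart (induced A)) : {e : dart (induced A') | Rd (sval d) (sval e)}.
  apply: cid; have [d' r] := li_dl h (svalP d).1 (svalP d).2.
  by exists (exist _ d' (li_d h r).2).
have g'P (d : dart (induced A')) : {e : dart (induced A) | Rd (sval e) (sval d)}.
  apply: cid; have [d' r] := li_dr h (svalP d).1 (svalP d).2.
  by exists (exist _ d' (li_d h r).1).
exists (fun x => sval (fP x)), (fun d => sval (gP d)); split.
- exists (fun x => sval (f'P x)) => x.
    apply: sval_inj.
    by apply/(li_vu h (svalP (f'P _)) (svalP (fP _))).
  apply: sval_inj.
  by apply/esym/(li_vu h (svalP (f'P _)) (svalP (fP _))).
- exists (fun x => sval (g'P x)) => x.
    apply: sval_inj.
    by apply/(li_du h (svalP (g'P _)) (svalP (gP _))).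
  apply: sval_inj.
  by apply/esym/(li_du h (svalP (g'P _)) (svalP (gP _))).
- split=> d.
    apply: sval_inj.
    apply/(li_vu h (li_src h (svalP (gP d))) (svalP (fP (src d)))).
    by case: d => ? [].
  apply: sval_inj.
  by apply/(li_du h (li_rev h (svalP (gP d))) (svalP (gP (rev d)))).
- split=> x; first by exact: (li_vm h (svalP (fP x))).
  exact: (li_dm h (svalP (gP x))).
- move=> i; apply: sval_inj.
  by apply/(li_vu h (svalP (fP (o i))) (ro i)).
Qed.

(** The walk is copied dart by dart; this works because everything within reach of its length stays
    in [A]. *)
Lemma local_iso_walk rel N N' A A' Rv Rd : @local_iso rel N N' A A' Rv Rd ->
  forall n x x' y, Rv x x' -> walk n x y ->
    (forall m z, (m <= n)%N -> walk m x z -> A z) ->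
    exists2 y', Rv y y' & walk n x' y'.
Proof.
move=> h; elim=> [|n IH] x x' y xx' /=.
  by move=> <- _; exists x'.
move=> [d dx wd] HA.
have Ax : A x := HA 0%N x isT erefl.
have At : A (tgt d) by apply: (HA 1%N) => //; exists d.
have [d' dd'] : exists d', Rd d d' by apply: (li_dl h) => //; rewrite dx.
have [m z mn wz|y' yy' wy'] := IH (tgt d) (tgt d') y (li_tgt h dd') wd.
  by apply: (HA m.+1) => //; exists d.
exists y' => //=; exists d' => //.
by apply/(li_vu h (li_src h dd') xx').
Qed.

End local_iso.

Lemma net_iso_nball (M I : Type) rel (N N' : rnet M I) f g r x :
  @net_iso M rel N N' f g -> (forall i, f (root N i) = root N' i) ->
  nball (root N') r (f x) <-> nball (root N) r x.
Proof.
move=> fg fr; split=> -[i [n [nr]]].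
  by rewrite -fr => /(net_iso_walk fg) w; exists i, n.
by move=> w; exists i, n; split=> //; rewrite -fr; apply/(net_iso_walk fg).
Qed.

Section local_closeness.
Variables (R : realType) (M : metricType R).

Definition close_rel (r : nat) (a b : M) := mdist a b < r.+1%:R^-1.

Definition rclose (k : nat) (N N' : rnet M 'I_k) r Rv Rd :=
  @local_iso M (close_rel r) N N' (nball (root N) r) (nball (root N') r) Rv Rd
  /\ forall i, Rv (root N i) (root N' i).

Lemma locally_closeP k (N N' : rnet M 'I_k) r :
  locally_close r N N' <-> exists Rv Rd, @rclose k N N' r Rv Rd.
Proof. by split=> [/local_isoP//|h]; apply/local_isoP. Qed.

Lemma locally_close_iso k (N N' N1 N1' : rnet M 'I_k) r :
  cls N = cls N1 -> cls N' = cls N1' -> locally_close r N N' ->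
  locally_close r N1 N1'.
Proof.
move=> /esym/cls_iso[f [g [fg fr]]] /esym/cls_iso[f' [g' [fg' fr']]].
move=> /locally_closeP[Rv [Rd [h ro]]]; apply/locally_closeP.
exists (fun x y => Rv (f x) (f' y)), (fun d e => Rd (g d) (g' e)).
have [bf bg [sg rg] [vm dm]] := fg; have [bf' bg' [sg' rg'] [vm' dm']] := fg'.
have nb x := @net_iso_nball _ _ _ _ _ _ _ r x fg fr.
have nb' x := @net_iso_nball _ _ _ _ _ _ _ r x fg' fr'.
have tg d := net_iso_tgt fg d; have tg' d := net_iso_tgt fg' d.
split; last by move=> i; rewrite fr fr'.
have [fi fK fiK] := bf; have [fi' fK' fiK'] := bf'.
have [gi gK giK] := bg; have [gi' gK' giK'] := bg'.
split.
- by move=> x x' /(li_v h)[/nb ? /nb' ?].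
- by move=> x /nb/(li_vl h)[x' r']; exists (fi' x'); rewrite fiK'.
- by move=> x /nb'/(li_vr h)[x' r']; exists (fi x'); rewrite fiK.
- move=> x y x' y' rx ry; have H := li_vu h rx ry; split.
    by move=> xy; apply: (bij_inj bf'); apply/H; rewrite xy.
  by move=> xy; apply: (bij_inj bf); apply/H; rewrite xy.
- move=> d d' /(li_d h); rewrite (sg d) (tg d) (sg' d') (tg' d').
  by move=> [[/nb ? /nb ?] [/nb' ? /nb' ?]].
- move=> d /nb + /nb; rewrite -(sg d) -(tg d) => ns nt.
  have [d' r'] := li_dl h ns nt.
  by exists (gi' d'); rewrite giK'.
- move=> d /nb' + /nb'; rewrite -(sg' d) -(tg' d) => ns nt.
  have [d' r'] := li_dr h ns nt.
  by exists (gi d'); rewrite giK.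
- move=> x y x' y' rx ry; have H := li_du h rx ry; split.
    by move=> xy; apply: (bij_inj bg'); apply/H; rewrite xy.
  by move=> xy; apply: (bij_inj bg); apply/H; rewrite xy.
- by move=> d d' /(li_src h); rewrite sg sg'.
- by move=> d d' /(li_rev h); rewrite rg rg'.
- by move=> x x' /(li_vm h); rewrite -vm -vm'.
- by move=> d d' /(li_dm h); rewrite -dm -dm'.
Qed.

Section with_close.
Variables (k : nat) (N N' : rnet M 'I_k) (s : nat).
Variables (Rv : vert N -> vert N' -> Prop) (Rd : dart N -> dart N' -> Prop).
Hypothesis h : @rclose k N N' s Rv Rd.

(** Walks do not see marks. The trivial relation on marks is symmetric, so walks can be copied in
    both directions. *)
Let hT : local_iso (fun _ _ => True) (nball (root N) s) (nball (root N') s) Rv Rd.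
Proof. by case: h => -[]; split. Qed.

Let hTs : local_iso (fun _ _ => True) (nball (root N') s) (nball (root N) s)
  (fun x y => Rv y x) (fun d e => Rd e d).
Proof. exact: local_iso_sym hT. Qed.

Lemma close_walk n x x' y : Rv x x' -> walk n x y ->
  (forall m z, (m <= n)%N -> walk m x z -> nball (root N) s z) ->
  exists2 y', Rv y y' & walk n x' y'.
Proof. exact: local_iso_walk hT _ _ _ _. Qed.

Lemma close_walk_rev n x x' y' : Rv x x' -> walk n x' y' ->
  (forall m z, (m <= n)%N -> walk m x' z -> nball (root N') s z) ->
  exists2 y, Rv y y' & walk n x y.
Proof. exact: (local_iso_walk hTs). Qed.

(** The given isomorphism restricts to the smaller balls: membership in a ball is the existence of a
    short walk, and these walks stay inside the large balls, where they can be copied. *)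
Lemma close_reroot (j r : nat) (o : 'I_j -> vert N) (o' : 'I_j -> vert N') :
  (r <= s)%N -> (forall i, Rv (o i) (o' i)) ->
  nball o r `<=` nball (root N) s -> nball o' r `<=` nball (root N') s ->
  locally_close r (reroot o) (reroot o').
Proof.
move=> rs oo' B B'; have [hl hr] := h; apply/locally_closeP.
exists (fun x x' => Rv x x' /\ nball o r x).
exists (fun d d' => Rd d d' /\ (nball o r (src d) /\ nball o r (tgt d))).
split; last by move=> i; split; [exact: oo'|exact: nball_root].
apply: (local_iso_sub _ hl) => //.
  move=> a b; rewrite /close_rel => /lt_le_trans; apply.
  by rewrite lef_pV2 ?posrE ?ltr0n// ler_nat.
move=> x x' xx'; split=> -[i [n [nr w]]].
  have [m z mn wz|y' yy' wy] := close_walk (oo' i) w.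
    by apply: B; exists i, m; split=> //; exact: leq_trans nr.
  exists i, n; split=> //; suff -> : x' = y' by [].
  exact/(li_vu hl xx' yy').
have [m z mn wz|y yy' wy] := close_walk_rev (oo' i) w.
  by apply: B'; exists i, m; split=> //; exact: leq_trans nr.
exists i, n; split=> //; suff -> : x = y by [].
exact/(li_vu hl xx' yy').
Qed.

Lemma close_pull (j r : nat) (t : 'I_j -> 'I_k) : (r <= s)%N ->
  locally_close r (reroot (root N \o t)) (reroot (root N' \o t)).
Proof.
move=> rs; apply: close_reroot => //.
- by move=> i; case: h => _; exact.
- by move=> x [i [n [nr w]]]; exists (t i), n; split=> //; exact: leq_trans rs.
- by move=> x [i [n [nr w]]]; exists (t i), n; split=> //; exact: leq_trans rs.
Qed.

Lemma walk_cat (L : network M) n m (x y z : vert L) :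
  walk n x y -> walk m y z -> walk (n + m) x z.
Proof.
elim: n x => [x ->//|n IH] x [d dx wd] wm.
by exists d => //; exact: IH wm.
Qed.

Lemma close_nball n x x' : (n <= s)%N -> Rv x x' ->
  nball (root N) n x <-> nball (root N') n x'.
Proof.
move=> ns xx'; have [hl hr] := h; split=> -[i [m [mn w]]].
  have [p z pm wz|y' yy' wy] := close_walk (hr i) w.
    by exists i, p; split=> //; exact: leq_trans (leq_trans mn ns).
  exists i, m; split=> //; suff -> : x' = y' by [].
  exact/(li_vu hl xx' yy').
have [p z pm wz|y yy' wy] := close_walk_rev (hr i) w.
  by exists i, p; split=> //; exact: leq_trans (leq_trans mn ns).
exists i, m; split=> //; suff -> : x = y by [].
exact/(li_vu hl xx' yy').
Qed.

Lemma nball_addr (L : rnet M 'I_k) n r x : nball (root L) n x ->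
  nball (root (addr x)) r `<=` nball (root L) (r + n).
Proof.
move=> [i [m [mn w]]] y [j [p [pr]]] /=.
case: unliftP => [j' _|_] /= wy.
  by exists j', p; split=> //; exact: leq_trans (leq_addr _ _).
exists i, (m + p)%N; split; first by rewrite addnC leq_add.
exact: walk_cat wy.
Qed.

(** A new root at distance at most [n] from the old ones costs [n] in the scale. *)
Lemma close_addr n r x x' : (r + n <= s)%N -> nball (root N) n x -> Rv x x' ->
  locally_close r (addr x) (addr x').
Proof.
move=> rns nx xx'; have [hl hr] := h.
have nx' : nball (root N') n x'.
  by apply/(close_nball _ xx') => //; exact: leq_trans (leq_addl _ _) rns.
have up (L : rnet M 'I_k) : nball (root L) (r + n) `<=` nball (root L) s.
  by move=> y [i [m [mr w]]]; exists i, m; split=> //; exact: leq_trans rns.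
apply: close_reroot => //.
- exact: leq_trans (leq_addr _ _) rns.
- by move=> i; case: (unlift ord_max i) => [j|] /=; [exact: hr|exact: xx'].
- by move=> y /(nball_addr nx)/up.
- by move=> y /(nball_addr nx')/up.
Qed.

Lemma close_card (P : set (dart N)) (P' : set (dart N')) :
  P `<=` [set d | nball (root N) s (src d) /\ nball (root N) s (tgt d)] ->
  P' `<=` [set d | nball (root N') s (src d) /\ nball (root N') s (tgt d)] ->
  finite_set P -> finite_set P' ->
  (forall d d', Rd d d' -> P d <-> P' d') ->
  #|` fset_set P|%fset = #|` fset_set P'|%fset.
Proof.
move=> PB PB' fP fP' PP'; have [hl hr] := h.
(* Outside [P] the matching function takes an arbitrary dart of [N'] as value; if [N'] has no dart,
   both sets are empty. *)
have gP (d : dart N) : {d' | P d -> Rd d d'} + {~ exists d' : dart N', True}.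
  have [Pd|nP] := pselect (P d).
    have [] := PB _ Pd => ns nt.
    by left; have /cid[d' r] := li_dl hl ns nt; exists d'.
  have [/cid[d' _]|?] := pselect (exists d' : dart N', True); last by right.
  by left; exists d'.
have [[d0' _]|nd'] := pselect (exists d' : dart N', True); last first.
  have P'0 : P' = set0 by apply/seteqP; split=> d' // _; case: nd'; exists d'.
  have P0 : P = set0.
    apply/seteqP; split=> // d Pd.
    have [] := PB _ Pd => ns nt.
    by have [d' _] := li_dl hl ns nt; case: nd'; exists d'.
  by rewrite P'0 P0 !fset_set0.
have gP1 d : exists d', P d -> Rd d d'.
  by have [[d' r]|[]] := gP d; [exists d'|exists d0'].
have [G GP] := choice gP1.
have -> : P' = G @` P.
  apply/seteqP; split=> [d' Pd'|_ [d Pd <-]]; last exact/(PP' _ _ (GP _ Pd)).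
  have [ns nt] := PB' _ Pd'.
  have [d r] := li_dr hl ns nt.
  have Pd : P d by apply/(PP' _ _ r).
  by exists d => //; apply/(li_du hl (GP _ Pd) r).
rewrite fset_set_image// card_in_imfset//= => d e.
rewrite !in_fset_set// !inE => Pd Pe GG.
by apply/(li_du hl (GP _ Pd) (GP _ Pe)).
Qed.

End with_close.
End local_closeness.

(** * Measurable functions of networks *)

Section network_functions.
Variable M : Type.

Definition cnt (N : network M) (x y : vert N) : nat :=
  #|` fset_set [set d | src d = x /\ tgt d = y]|%fset.

Lemma net_iso_cnt (N N' : network M) f g x y : @net_iso M eq N N' f g ->
  cnt (f x) (f y) = cnt x y.
Proof.
move=> fg; apply: (net_iso_card fg) => d /=.
have fi : injective f by case: fg => /bij_inj.
rewrite (net_iso_src fg) (net_iso_tgt fg).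
by split=> [[/fi-> /fi->]|[-> ->]].
Qed.

Lemma distP (N : network M) (x y : vert N) : connected_net N ->
  walk (dist x y) x y /\ forall m, walk m x y -> (dist x y <= m)%N.
Proof.
move=> cN; rewrite /dist; case: xgetP => [n _ //|none].
exfalso; have [n wn] := cN x y; have ex : exists n, `[< walk n x y >].
  by exists n; apply/asboolP.
apply: (none (ex_minn ex)); case: ex_minnP => m /asboolP wm min; split=> //.
by move=> p wp; apply: min; apply/asboolP.
Qed.

Lemma dist_eq (N : network M) (x y : vert N) n : connected_net N ->
  walk n x y -> (forall m, walk m x y -> (n <= m)%N) -> dist x y = n.
Proof.
move=> cN wn min; have [wd mind] := distP x y cN.
by apply/eqP; rewrite eqn_leq mind//= min.
Qed.

End network_functions.

Section Gspace_measurable.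
Variables (R : realType) (M : completeMetricType R).
Implicit Types k r : nat.

Lemma local_open_measurable k (U : set (netclass M 'I_k)) :
  local_open U -> measurable (U : set (Gspace M k)).
Proof. by move=> oU; apply: sub_sigma_algebra. Qed.

Lemma measurable_pull k (j : nat) (t : 'I_j -> 'I_k) :
  measurable_fun setT (pull t : Gspace M k -> Gspace M j).
Proof.
apply: (@measurability _ _ (Gspace M k) (Gspace M j) setT (pull t) (@open (netclass M 'I_j))) => //.
move=> _ [U oU <-]; rewrite setTI; apply: local_open_measurable.
move=> g /oU[a Ua]; exists a => r h ar /locally_closeP[Rv [Rd c]].
apply: (Ua r) => //; have := close_pull c t (leqnn r).
by apply: locally_close_iso; rewrite rep_cls.
Qed.

(** Local constancy for the topology of local convergence. All preimages are then open, so every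
    function of the value of [p] is measurable. *)
Definition locally_determined (T : Type) k (p : netclass M 'I_k -> T) :=
  forall N : rnet M 'I_k, exists a : nat, forall r (N' : rnet M 'I_k) Rv Rd,
    (a <= r)%N -> @rclose R M k N N' r Rv Rd -> p (cls N') = p (cls N).

Lemma locally_determined_measurable (T : Type) k (p : netclass M 'I_k -> T)
    (B : set T) :
  locally_determined p -> measurable (p @^-1` B : set (Gspace M k)).
Proof.
move=> lp; apply: local_open_measurable => g /= Bg.
have [a pa] := lp (rep g); exists a => r h ar /locally_closeP[Rv [Rd c]].
by have := pa _ _ _ _ ar c; rewrite !cls_rep => ->.
Qed.

Lemma measurable_locally_determined (T : Type) k (p : netclass M 'I_k -> T)
    d (S : measurableType d) (h : T -> S) : locally_determined p ->
  measurable_fun setT (h \o p : Gspace M k -> S).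
Proof.
move=> lp _ B mB; rewrite setTI.
exact: (@locally_determined_measurable _ _ p (h @^-1` B)).
Qed.

Definition degc k (i : 'I_k) (g : netclass M 'I_k) := deg (root (rep g) i).
Definition cntc k (i j : 'I_k) (g : netclass M 'I_k) :=
  cnt (root (rep g) i) (root (rep g) j).
Definition distc k (i j : 'I_k) (g : netclass M 'I_k) :=
  dist (root (rep g) i) (root (rep g) j).

Lemma degcE k (i : 'I_k) (N : rnet M 'I_k) : degc i (cls N) = deg (root N i).
Proof.
have [f [g [fg fr]]] := cls_iso (rep_cls N).
rewrite /degc /deg -fr; apply/esym/(net_iso_card fg) => d /=.
by rewrite (net_iso_src fg); split=> [/(bij_inj (let: And4 a _ _ _ := fg in a))|->].
Qed.

Lemma cntcE k (i j : 'I_k) (N : rnet M 'I_k) : cntc i j (cls N) = cnt (root N i) (root N j).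
Proof.
have [f [g [fg fr]]] := cls_iso (rep_cls N).
by rewrite /cntc -!fr (net_iso_cnt _ _ fg).
Qed.

Lemma distcE k (i j : 'I_k) (N : rnet M 'I_k) : distc i j (cls N) = dist (root N i) (root N j).
Proof.
have [f [g [fg fr]]] := cls_iso (rep_cls N).
by rewrite /distc -!fr (net_iso_dist fg).
Qed.

(** Radius 1 suffices: the ball contains both ends of every dart at the root. *)
Lemma degc_determined k (i : 'I_k) : locally_determined (@degc k i).
Proof.
move=> N; exists 1%N => r N' Rv Rd r1 c; rewrite !degcE; apply/esym.
have nb (L : rnet M 'I_k) (d : dart L) : src d = root L i ->
    nball (root L) r (src d) /\ nball (root L) r (tgt d).
  by move=> ds; split; [exists i, 0%N|exists i, 1%N; split => //=; exists d].
apply: (close_card c).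
- by move=> d /nb.
- by move=> d /nb.
- exact: net_locfin.
- exact: net_locfin.
- move=> d d' dd' /=; exact: (li_vu c.1 (li_src c.1 dd') (c.2 i)).
Qed.

(** Radius 0 suffices, since both ends of the counted darts are roots. *)
Lemma cntc_determined k (i j : 'I_k) : locally_determined (@cntc k i j).
Proof.
move=> N; exists 0%N => r N' Rv Rd r1 c; rewrite !cntcE; apply/esym.
have nb (L : rnet M 'I_k) (d : dart L) :
    src d = root L i /\ tgt d = root L j ->
    nball (root L) r (src d) /\ nball (root L) r (tgt d).
  by move=> [-> ->]; split; [exists i, 0%N|exists j, 0%N].
apply: (close_card c).
- by move=> d /nb.
- by move=> d /nb.
- by apply: sub_finite_set (net_locfin N (root N i)) => d [].
- by apply: sub_finite_set (net_locfin N' (root N' i)) => d [].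
- move=> d d' dd' /=.
  have := li_vu c.1 (li_src c.1 dd') (c.2 i).
  have := li_vu c.1 (li_tgt c.1 dd') (c.2 j).
  tauto.
Qed.

(** The distance itself serves as radius: a shortest walk stays in the ball and is copied to [N'],
    and a shorter walk in [N'] would be copied back. *)
Lemma distc_determined k (i j : 'I_k) : locally_determined (@distc k i j).
Proof.
move=> N; exists (distc i j (cls N)) => r N' Rv Rd; rewrite !distcE => rd c.
have [wd mind] := distP (root N i) (root N j) (net_connected N).
apply: dist_eq; first exact: net_connected.
  have [m z mn wz|y' yy' wy] := close_walk c (c.2 i) wd.
    by exists i, m; split=> //; exact: leq_trans rd.
  suff -> : root N' j = y' by [].
  exact/(li_vu c.1 (c.2 j) yy').
move=> m wm; rewrite leqNgt; apply/negP => md.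
have [p z pm wz|y yy' wy] := close_walk_rev c (c.2 i) wm.
  exists i, p; split=> //; apply: leq_trans rd; apply: ltnW.
  exact: leq_ltn_trans md.
have : walk m (root N i) (root N j).
  suff -> : root N j = y by [].
  exact/(li_vu c.1 (c.2 j) yy').
by move=> /mind; rewrite leqNgt md.
Qed.

End Gspace_measurable.

(** * Unordered sums, induction on nonnegative functions, sums over vertices *)

Section esum_extra.
Local Open Scope ereal_scope.
Variable R : realType.

Lemma esum_swap (S T : choiceType) (A : set S) (B : set T)
    (a : S -> T -> \bar R) : (forall i j, 0 <= a i j) ->
  \esum_(i in A) \esum_(j in B) a i j = \esum_(j in B) \esum_(i in A) a i j.
Proof.
move=> a0; rewrite !esum_esum//.
rewrite (@reindex_esum _ _ _ (B `*`` (fun=> A)) (A `*`` (fun=> B))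
  (fun p => (p.2, p.1))) //.
split=> [[x y] []//|[x y] [x' y'] _ _ [-> ->]//|[x y] []//= Ax By].
by exists (y, x).
Qed.

Lemma esum_nneseries (S : choiceType) (A : set S) (a : nat -> S -> \bar R) :
  (forall n i, 0 <= a n i) ->
  \esum_(i in A) \sum_(n <oo) a n i = \sum_(n <oo) \esum_(i in A) a n i.
Proof.
move=> a0; rewrite nneseries_esumT; last by move=> n; exact: esum_ge0.
by under eq_esum do rewrite nneseries_esumT//; rewrite esum_swap.
Qed.

Lemma esumZl (S : choiceType) (A : set S) (a : S -> \bar R) (c : R) :
  (0 <= c)%R -> (forall i, 0 <= a i) ->
  \esum_(i in A) (c%:E * a i) = c%:E * \esum_(i in A) a i.
Proof.
move=> + a0; rewrite le_eqVlt => /predU1P[<-|c0].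
  by rewrite mul0e esum1// => i _; rewrite mul0e.
have le (b : R) f : (0 < b)%R -> (forall i, 0 <= f i) ->
    \esum_(i in A) (b%:E * f i) <= b%:E * \esum_(i in A) f i.
  move=> b0 f0; apply: ge_ereal_sup => _ /= [X [finX XA] <-].
  rewrite -ge0_mule_fsumr//; apply: lee_wpmul2l; first by rewrite lee_fin ltW.
  by apply: esum_ge; exists X.
apply/eqP; rewrite eq_le le//=.
rewrite -lee_pdivlMl// (le_trans _ (le c^-1%R _ _ _))//; last first.
- by move=> i; rewrite mule_ge0// lee_fin ltW.
- by rewrite invr_gt0.
- by apply: le_esum => i _; rewrite muleA -EFinM mulVf ?mul1e// gt_eqF.
Qed.

(** For an infinite factor both sides are 0 or infinite, according to whether all terms vanish. *)
Lemma ge0_esumZl (S : choiceType) (A : set S) (a : S -> \bar R) (c : \bar R) :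
  0 <= c -> (forall i, 0 <= a i) ->
  \esum_(i in A) (c * a i) = c * \esum_(i in A) a i.
Proof.
case: c => [c|_ a0|//]; first by rewrite lee_fin => c0 a0; rewrite esumZl.
have [[i Ai ai]|none] := pselect (exists2 i, A i & a i != 0); last first.
  have az i : A i -> a i = 0.
    by move=> Ai; apply: contrapT => /eqP ai; apply: none; exists i.
  rewrite [in RHS]esum1// mule0 esum1// => i Ai.
  by rewrite az// mule0.
have ai0 : 0 < a i by rewrite lt0e ai a0.
have le (f : S -> \bar R) : (forall j, 0 <= f j) -> f i <= \esum_(j in A) f j.
  move=> f0; apply: esum_ge; exists [set i]; last by rewrite fsbig_set1.
  by split=> // j ->.
rewrite gt0_mulye; last exact: lt_le_trans (le _ a0).
apply/eqP; rewrite -leye_eq; apply: le_trans (le (fun j => +oo * a j) _).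
  by rewrite gt0_mulye.
by move=> j; rewrite mule_ge0.
Qed.

End esum_extra.

Import HBSimple HBNNSimple.

Section nonneg_induction.
Local Open Scope ereal_scope.
Context d (T : measurableType d) (R : realType).
Variable P : (T -> \bar R) -> Prop.
Hypothesis P_indic : forall A, measurable A -> P (fun x => (\1_A x)%:E).
Hypothesis PZ : forall (c : R) f, (0 <= c)%R -> measurable_fun setT f ->
  (forall x, 0 <= f x) -> P f -> P (fun x => c%:E * f x).
Hypothesis P_series : forall f : (T -> \bar R)^nat,
  (forall n, measurable_fun setT (f n)) -> (forall n x, 0 <= f n x) ->
  (forall n, P (f n)) -> P (fun x => \sum_(n <oo) f n x).

Let P0 : P (cst 0).
Proof.
rewrite (_ : cst 0 = fun x => 0%R%:E * (\1_setT x)%:E); last first.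
  by apply/funext => x; rewrite mul0e.
by apply: PZ => //; [exact/measurable_EFinP|exact: P_indic].
Qed.

Lemma nonneg_ind_sum n (f : (T -> \bar R)^nat) :
  (forall n, measurable_fun setT (f n)) -> (forall n x, 0 <= f n x) ->
  (forall n, P (f n)) -> P (fun x => \sum_(i < n) f i x).
Proof.
move=> mf f0 Pf.
pose g i := if (i < n)%N then f i else cst 0.
rewrite (_ : (fun x => _) = fun x => \sum_(i <oo) g i x).
  apply: P_series => i; rewrite /g; case: ifP => //.
apply/funext => x; rewrite (nneseries_split 0 n)//; last first.
  by move=> k _; rewrite /g; case: ifP.
rewrite add0n eseries0 ?adde0.
  by rewrite big_mkord; apply: eq_bigr => i _; rewrite /g ltn_ord.
by move=> i ni _; rewrite /g ltnNge ni.
Qed.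

Lemma nonneg_ind_sfun (h : {sfun T >-> R}) : (forall x, 0 <= h x)%R ->
  P (fun x => (h x)%:E).
Proof.
move=> h0.
(* The values of [h] are nonnegative; writing [Num.max 0] makes the coefficients nonnegative at
   every natural index, as [nonneg_ind_sum] asks. *)
have -> : (fun x => (h x)%:E) = (fun x => \sum_(i < #|` fset_set (range h)|%fset)
    ((Num.max 0 (fset_set (range h))`_i)%R%:E *
     (\1_(h @^-1` [set (fset_set (range h))`_i]) x)%:E)).
  apply/funext => x; rewrite {1}fimfunEord -sumEFin; apply: eq_bigr => i _.
  rewrite -EFinM; congr (_ * _)%:E.
  apply/esym/max_idPr; set y := _`_i.
  have : y \in fset_set (range h) by rewrite mem_nth.
  by rewrite in_fset_set// inE => -[z _ <-].
apply: (@nonneg_ind_sum _ (fun i x => (Num.max 0 (fset_set (range h))`_i)%R%:E *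
     (\1_(h @^-1` [set (fset_set (range h))`_i]) x)%:E)).
- move=> n; apply: emeasurable_funM => //.
  by apply/measurable_EFinP; apply: measurable_indic.
- by move=> n x; rewrite mule_ge0// lee_fin le_max lexx.
- move=> n; apply: PZ => //; first by rewrite le_max lexx.
    by apply/measurable_EFinP; apply: measurable_indic.
  exact: P_indic.
Qed.

(** [f] is the series of the increments of its increasing simple approximations, so closure under
    series takes the place of monotone limits. *)
Lemma nonneg_ind (f : T -> \bar R) : measurable_fun setT f ->
  (forall x, 0 <= f x) -> P f.
Proof.
move=> mf f0.
pose a := nnsfun_approx measurableT mf.
have nda : nondecreasing_seq (a : (T -> R)^nat) by exact: nd_nnsfun_approx.
have ca x : EFin \o a^~ x @ \oo --> f x by exact: cvg_nnsfun_approx.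
pose g n : {sfun T >-> R} := 
  if n is m.+1 then ((a n : {sfun T >-> R}) - (a m : {sfun T >-> R}))%R
  else (a 0%N : {sfun T >-> R}).
have g0 n x : (0 <= g n x)%R.
  by case: n => [|n] /=; [exact: fun_ge0|rewrite subr_ge0; apply/lefP/nda].
have -> : f = fun x => \sum_(n <oo) (g n x)%:E.
  apply/funext => x; apply/esym/cvg_lim => //.
  rewrite -(cvg_shiftS _).
  rewrite (_ : (fun _ => _) = EFin \o a^~ x); first exact: ca.
  apply/funext => n /=; elim: n => [|n IH]; first by rewrite big_nat1.
  by rewrite big_nat_recr//= IH -EFinD addrC subrK.
apply: P_series => //; last by move=> n; exact: nonneg_ind_sfun.
by move=> n; apply/measurable_EFinP.
Qed.

End nonneg_induction.

Lemma finite_walk (M : Type) (N : network M) n (x : vert N) :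
  locally_finite N -> finite_set [set y | walk n x y].
Proof.
move=> lf; elim: n x => [|n IH] x /=.
  by apply: (sub_finite_set _ (finite_set1 x)) => y /= ->.
rewrite (_ : [set y | _] = \bigcup_(d in [set d | src d = x]) [set y | walk n (tgt d) y]).
  exact: bigcup_finite.
by apply/seteqP; split=> y /= [d]; exists d.
Qed.

Lemma finite_nball (M : Type) (N : network M) k (o : 'I_k -> vert N) r :
  locally_finite N -> finite_set (nball o r).
Proof.
move=> lf.
rewrite (_ : nball o r = \bigcup_(i in [set: 'I_k]) \bigcup_(n in `I_r.+1) [set y | walk n (o i) y]).
  apply: bigcup_finite => // i _; apply: bigcup_finite => // n _.
  exact: finite_walk.
apply/seteqP; split=> y /=.
  by move=> [i [n [nr w]]]; exists i => //; exists n.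
by move=> [i _ [n /= nr w]]; exists i, n.
Qed.

Section vertex_sum.
Variables (R : realType) (M : completeMetricType R).
Implicit Types k r : nat.
Local Open Scope ereal_scope.

Definition vsum k (F : netclass M 'I_k.+1 -> \bar R) (g : netclass M 'I_k) :=
  \esum_(x in [set: vert (rep g)]) F (cls (addr x)).

Lemma cls_addr_iso k (N N' : rnet M 'I_k) f g (x : vert N) :
  @net_iso M eq N N' f g -> (forall i, f (root N i) = root N' i) ->
  cls (addr x) = cls (addr (f x)).
Proof.
move=> fg fr; rewrite (iso_cls_reroot _ fg); congr (cls (reroot _)).
by apply/funext => i /=; case: unlift => [j|] //=.
Qed.

Lemma vsumE k F (N : rnet M 'I_k) :
  vsum F (cls N) = \esum_(x in [set: vert N]) F (cls (addr x)).
Proof.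
have [f [g [fg fr]]] := cls_iso (esym (rep_cls N)).
have [f' fK f'K] : bijective f by case: fg.
rewrite /vsum (@reindex_esum _ _ _ [set: vert N] _ f); last first.
  split=> // [x y _ _ /(can_inj fK)//|y _].
  by exists (f' y).
by apply: eq_esum => x _; rewrite (cls_addr_iso x fg fr).
Qed.

Lemma vsum_ge0 k (F : netclass M 'I_k.+1 -> \bar R) g :
  (forall h, 0 <= F h) -> 0 <= vsum F g.
Proof. by move=> F0; apply: esum_ge0. Qed.

(** The spheres around the set of roots are finite and disjoint; they cut a sum over all vertices
    into a series of finite sums. *)
Definition sphere k n (N : rnet M 'I_k) : set (vert N) :=
  [set x | nball (root N) n x /\ forall m, (m < n)%N -> ~ nball (root N) m x].
Arguments sphere {k} n N _.

Lemma finite_sphere k n (N : rnet M 'I_k) : finite_set (sphere n N).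
Proof.
apply: sub_finite_set (finite_nball (root N) n (net_locfin N)) => x.
by case.
Qed.

Lemma bigcup_sphere k (N : rnet M 'I_k.+1) :
  [set: vert N] = \bigcup_(n in [set: nat]) sphere n N.
Proof.
apply/seteqP; split=> // x _.
have ex : exists n, `[< nball (root N) n x >].
  have [n w] := net_connected N (root N ord0) x.
  by exists n; apply/asboolP; exists ord0, n.
exists (ex_minn ex) => //; case: ex_minnP => m /asboolP nm min; split=> //.
by move=> p pm /asboolP/min; rewrite leqNgt pm.
Qed.

Lemma trivIset_sphere k (N : rnet M 'I_k) : trivIset setT (fun n => sphere n N).
Proof.
apply/trivIsetP => i j _ _ ij; apply/seteqP; split=> // x [[ni mi] [nj mj]].
have [ltij|ltji|eij] := ltngtP i j.
- exact: (mj i).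
- exact: (mi j).
- by rewrite eij eqxx in ij.
Qed.

Definition ssum k n (F : netclass M 'I_k.+1 -> \bar R) (g : netclass M 'I_k) :=
  \esum_(x in sphere n (rep g)) F (cls (addr x)).

Lemma vsum_ssum k (F : netclass M 'I_k.+2 -> \bar R) (g : netclass M 'I_k.+1) :
  (forall h, 0 <= F h) -> vsum F g = \sum_(n <oo) ssum n F g.
Proof.
move=> F0; rewrite /vsum bigcup_sphere esum_bigcupT//; last first.
  exact: trivIset_sphere.
by rewrite nneseries_esumT// => n; exact: esum_ge0.
Qed.

Definition scount k n (A : set (netclass M 'I_k.+1)) (g : netclass M 'I_k) :=
  #|` fset_set (sphere n (rep g) `&` [set x | A (cls (addr x))])|%fset.

Lemma ssum_indic k n (A : set (netclass M 'I_k.+1)) g :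
  ssum n (fun h => (\1_A h)%:E) g = (scount n A g)%:R%:E.
Proof.
have fin := @finite_sphere k n (rep g).
rewrite /ssum (eq_esum (b := fun x => if x \in [set x | A (cls (addr x))] then 1 else 0)).
  rewrite -esum_mkcondr esum_fset//; last exact: finite_setIl.
  rewrite fsbig_finite//=; last exact: finite_setIl.
  rewrite sumEFin /scount; congr (_%:E).
  by rewrite big_const_seq count_predT iter_addr_0.
move=> x _; rewrite indicE; have [/set_mem Ax|nAx] := boolP (x \in _).
  by rewrite mem_set.
by rewrite memNset// => Ax; move/negP: nAx; apply; rewrite inE.
Qed.

(** Lower semicontinuity: each of the finitely many counted vertices persists, with its open
    property, in all networks close enough to [g], and distinct vertices stay distinct. *)
Lemma scount_open k n (U : set (netclass M 'I_k.+2)) j : local_open U ->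
  local_open [set g : netclass M 'I_k.+1 | (j <= scount n U g)%N].
Proof.
move=> oU g /= jg.
set A := sphere n (rep g) `&` [set x | U (cls (addr x))] in jg.
have finA : finite_set A by apply: finite_setIl; exact: finite_sphere.
have ax (x : vert (rep g)) : exists a, A x -> forall r h, (a <= r)%N ->
    locally_close r (addr x) (rep h) -> U h.
  have [Ax|nAx] := pselect (A x); last by exists 0%N.
  have [a Ha] := oU _ Ax.2; exists a => _ r h ar cl.
  by apply: (Ha r) => //; apply: locally_close_iso cl; rewrite ?rep_cls.
have [a Ha] := choice ax.
pose s := enum_fset (fset_set A).
(* Adding a root on the sphere of radius [n] reduces the scale from [r] to [r - n], which must still
   reach [a x] for every counted [x]. *)
exists ((\max_(x <- s) a x) + n)%N => r h ar /locally_closeP[Rv [Rd c]].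
have nr : (n <= r)%N by apply: leq_trans ar; exact: leq_addl.
have phix (x : vert (rep g)) : exists x', A x -> Rv x x'.
  have [Ax|nAx] := pselect (A x); last first.
    by exists (root (rep h) ord0).
  have nx : nball (root (rep g)) r x.
    by case: Ax => -[[i [m [mn w]]] _] _; exists i, m; split=> //; exact: leq_trans nr.
  by have [x' xx'] := li_vl c.1 nx; exists x'.
have [phi Hphi] := choice phix.
apply: (leq_trans jg); rewrite /scount -/A.
have -> : #|` fset_set A|%fset = #|` (phi @` fset_set A)|%fset.
  rewrite card_in_imfset//= => x y; rewrite !in_fset_set// !inE => Ax Ay xy.
  exact/(li_vu c.1 (Hphi _ Ax) (Hphi _ Ay)).
apply: fsubset_leq_card; apply/fsubsetP => _ /imfsetP[x /= + ->].
rewrite in_fset_set ?inE// => Ax.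
rewrite in_fset_set ?inE; last by apply: finite_setIl; exact: finite_sphere.
have xx' := Hphi _ Ax.
have [[nx mx] Ux] := Ax.
split; first split.
- by apply/(close_nball c nr xx').
- move=> m mn /(close_nball c (leq_trans (ltnW mn) nr) xx'); exact: mx.
- apply: (Ha x Ax (r - n)%N).
    rewrite leq_subRL// addnC; apply: leq_trans ar; rewrite leq_add2r.
    apply: leq_bigmax_seq => //.
    by rewrite /s in_fset_set ?inE.
  have := @close_addr R M k.+1 _ _ _ _ _ c n (r - n) x (phi x).
  rewrite subnK// => /(_ (leqnn _) nx xx').
  by apply: locally_close_iso => //; rewrite rep_cls.
Qed.

Lemma measurable_nat_comp d (T : measurableType d) (c : T -> nat) :
  (forall j, measurable [set x | (j <= c x)%N]) ->
  forall d' (S : measurableType d') (h : nat -> S), measurable_fun setT (h \o c).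
Proof.
move=> mc d' S h _ B mB; rewrite setTI.
rewrite (_ : _ @^-1` _ = \bigcup_(j in [set j | B (h j)])
    ([set x | (j <= c x)%N] `\` [set x | (j.+1 <= c x)%N])).
  by apply: bigcup_measurable => j _; exact: measurableD.
apply/seteqP; split=> x /=.
  by move=> Bx; exists (c x) => //=; split=> //; rewrite ltnn.
move=> [j /= Bj [jc /negP]]; rewrite -leqNgt => cj.
by have -> : c x = j by apply/eqP; rewrite eqn_leq cj jc.
Qed.

Lemma indic_bigcup_series d (T : measurableType d) (F : (set T)^nat) x :
  (forall n, measurable (F n)) -> trivIset setT F ->
  (\1_(\bigcup_n F n) x)%:E = \sum_(n <oo) (\1_(F n) x)%:E :> \bar R.
Proof.
move=> mF tF.
have := @measure_bigcup _ _ _ (@dirac _ T x R) setT F (fun n _ => mF n) tF.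
rewrite -[in X in _ -> X]/(\d_x (\bigcup_n F n)) => H.
rewrite [LHS]H; by rewrite (@eq_eseriesl _ _ predT)// => n; rewrite in_setT.
Qed.

(** Dynkin induction from the open sets, where [scount_open] applies. Complements are handled by
    subtraction, which is legitimate because the counts on a sphere are finite. *)
Lemma measurable_ssum_indic k n (A : set (Gspace M k.+2)) : measurable A ->
  measurable_fun setT (ssum n (fun h => (\1_A h)%:E : \bar R) : Gspace M k.+1 -> _).
Proof.
move: A; apply: (@dynkin_induction _ (Gspace M k.+2) (@open (netclass M 'I_k.+2))
  (fun A => measurable_fun setT
    (ssum n (fun h => (\1_A h)%:E : \bar R) : Gspace M k.+1 -> _))) => //.
- by move=> A B; exact: openI.
- rewrite (_ : ssum _ _ = (fun j : nat => j%:R%:E : \bar R) \o scount n setT); last first.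
    by apply/funext => g; rewrite ssum_indic.
  apply: measurable_nat_comp => j; apply: local_open_measurable.
  by apply: scount_open; exact: local_openT.
- move=> U oU.
  rewrite (_ : ssum _ _ = (fun j : nat => j%:R%:E : \bar R) \o scount n U); last first.
    by apply/funext => g; rewrite ssum_indic.
  apply: measurable_nat_comp => j; apply: local_open_measurable.
  by apply: scount_open.
- move=> A mA PA.
  have PT : measurable_fun setT (ssum n (fun h => (\1_setT h)%:E : \bar R) : Gspace M k.+1 -> _).
    rewrite (_ : ssum _ _ = (fun j : nat => j%:R%:E : \bar R) \o scount n setT); last first.
      by apply/funext => g; rewrite ssum_indic.
    apply: measurable_nat_comp => j; apply: local_open_measurable.
    by apply: scount_open; exact: local_openT.
  rewrite (_ : ssum _ _ = (fun g => ssum n (fun h => (\1_setT h)%:E) g -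
      ssum n (fun h => (\1_A h)%:E) g)); first exact: emeasurable_funB.
  apply/funext => g; rewrite [X in X - _](_ : _ =
    ssum n (fun h => (\1_(~` A) h)%:E) g + ssum n (fun h => (\1_A h)%:E) g).
    by rewrite [X in _ + X - X]ssum_indic addeK.
  rewrite /ssum -esumD; [|by move=> *; rewrite lee_fin..].
  apply: eq_esum => x _; rewrite -EFinD !indicE in_setT in_setC.
  by case: (_ \in A); rewrite /= ?addr0 ?add0r.
- move=> F mF tF PF.
  rewrite (_ : ssum _ _ = fun g => \sum_(i <oo) ssum n (fun h => (\1_(F i) h)%:E) g).
    apply: ge0_emeasurable_sum => //.
    by move=> i g _ _; apply: esum_ge0 => x _; rewrite lee_fin.
  apply/funext => g; rewrite /ssum -esum_nneseries; last by move=> *; rewrite lee_fin.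
  by apply: eq_esum => x _; rewrite -indic_bigcup_series.
Qed.

(** For an indicator, the vertex sum is the series of its sums over spheres; these exhaust the
    connected network since it has at least one root. *)
Lemma measurable_vsum k (F : Gspace M k.+2 -> \bar R) :
  measurable_fun setT F -> (forall g, 0 <= F g) ->
  measurable_fun setT (vsum F : Gspace M k.+1 -> \bar R).
Proof.
move: F; apply: nonneg_ind.
- move=> A mA.
  rewrite (_ : vsum _ = fun g => \sum_(n <oo) ssum n (fun h => (\1_A h)%:E) g).
    apply: ge0_emeasurable_sum => [n g _ _|n _]; last exact: measurable_ssum_indic.
    by apply: esum_ge0 => x _; rewrite lee_fin.
  by apply/funext => g; rewrite vsum_ssum// => h; rewrite lee_fin.
- move=> c f c0 mf f0 mS.
  rewrite (_ : vsum _ = fun g => c%:E * vsum f g); first exact: measurable_funeM.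
  by apply/funext => g; rewrite /vsum esumZl.
- move=> f mf f0 mS.
  rewrite (_ : vsum _ = fun g => \sum_(n <oo) vsum (f n) g).
    by apply: ge0_emeasurable_sum => // n g _ _; apply: vsum_ge0.
  by apply/funext => g; rewrite /vsum esum_nneseries.
Qed.

End vertex_sum.

(** * The law of simple random walk *)

Section degrees.
Variables (R : realType) (M : Type) (N : network M).
Local Open Scope ereal_scope.

Lemma esum_card (T : choiceType) (A : set T) : finite_set A ->
  \esum_(x in A) (1 : \bar R) = (#|` fset_set A|%fset)%:R%:E.
Proof.
move=> fA; rewrite esum_fset// fsbig_finite//= sumEFin; congr (_%:E).
by rewrite big_const_seq count_predT iter_addr_0.
Qed.

Lemma esum_darts (x : vert N) (F : vert N -> \bar R) : locally_finite N ->
  (forall y, 0 <= F y) ->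
  \esum_(y in setT) ((cnt x y)%:R%:E * F y) =
  \esum_(d in [set d | src d = x]) F (tgt d).
Proof.
move=> lf F0.
transitivity (\esum_(y in setT) \esum_(d in [set d | src d = x /\ tgt d = y]) F (tgt d)).
  apply: eq_esum => y _.
  have fin : finite_set [set d | src d = x /\ tgt d = y].
    by apply: sub_finite_set (lf x) => d [].
  rewrite (eq_esum (b := fun=> F y)); last by move=> d [_ ->].
  rewrite esum_fset// fsbig_finite//= big_const_seq count_predT.
  by rewrite iter_addr_0 mule_natl.
rewrite esum_esum//; apply/esym; rewrite (@reindex_esum _ _ _
  ([set: vert N] `*`` (fun y => [set d | src d = x /\ tgt d = y]))
  [set d | src d = x] snd)//; split.
- by move=> [y d] /= [_ []].
- by move=> [y d] [y' d'] /[!inE] /= -[_ [_ <-]] [_ [_ <-]] ->.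
- by move=> d /= dx; exists (tgt d, d).
Qed.

Lemma esum_cnt (x : vert N) : locally_finite N ->
  \esum_(y in setT) (cnt x y)%:R%:E = (deg x)%:R%:E :> \bar R.
Proof.
move=> lf; rewrite -esum_card//.
rewrite -(esum_darts x (F := fun=> 1%R%:E))//.
by apply: eq_esum => y _; rewrite mule1.
Qed.

Lemma cnt_sym (x y : vert N) : cnt x y = cnt y x.
Proof.
rewrite /cnt -(@card_fset_image_inj _ _ rev [set d | src d = x /\ tgt d = y]).
  congr (#|` fset_set _|%fset); apply/seteqP; split=> d /=.
    by move=> [d' [<- <-] <-]; rewrite /tgt revK.
  by move=> [<- <-]; exists (rev d); rewrite ?revK// /tgt revK.
exact: inv_inj (@revK M N).
Qed.

End degrees.

(** * The transition kernel on classes of networks *)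

Section walk_operator.
Variables (R : realType) (M : completeMetricType R).
Implicit Types k n : nat.
Local Open Scope ereal_scope.

Definition penult k : 'I_k.+2 := lift ord_max (ord_max : 'I_k.+1).

Definition stepc k (g : netclass M 'I_k.+2) : R :=
  ((cntc (penult k) ord_max g)%:R / (degc (penult k) g)%:R)%R.

Lemma root_addr_max k (N : rnet M 'I_k) x : root (addr (N := N) x) ord_max = x.
Proof. by rewrite /= unlift_none. Qed.

Lemma root_addr_lift k (N : rnet M 'I_k) x j :
  root (addr (N := N) x) (lift ord_max j) = root N j.
Proof. by rewrite /= liftK. Qed.

Lemma stepcE k (N : rnet M 'I_k.+1) x :
  stepc (cls (addr (N := N) x)) = step_prob (root N ord_max) x.
Proof.
by rewrite /stepc cntcE degcE root_addr_max root_addr_lift.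
Qed.

Lemma stepc_ge0 k (g : netclass M 'I_k.+2) : (0 <= stepc g)%R.
Proof. by rewrite divr_ge0. Qed.

Lemma step_prob_ge0 (N : network M) (x y : vert N) : (0 <= step_prob x y :> R)%R.
Proof. by rewrite divr_ge0. Qed.

Lemma measurable_stepc k : measurable_fun setT (@stepc k : Gspace M k.+2 -> R).
Proof.
apply: measurable_funM.
  apply: (measurable_locally_determined (fun j : nat => j%:R : R)).
  exact: cntc_determined.
apply: (measurable_locally_determined (fun j : nat => (j%:R)^-1 : R)%R).
exact: degc_determined.
Qed.

(** The Markov kernel of the walk: the last distinguished vertex is the next position, and it is
    averaged out. *)
Definition step_op k (F : netclass M 'I_k.+2 -> \bar R) :=
  vsum (fun h => (stepc h)%:E * F h).

Lemma step_opE k F (N : rnet M 'I_k.+1) :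
  step_op F (cls N) = \esum_(x in [set: vert N])
    ((step_prob (root N ord_max) x)%:E * F (cls (addr x))).
Proof. by rewrite /step_op vsumE; apply: eq_esum => x _; rewrite stepcE. Qed.

Lemma measurable_step_op k (F : Gspace M k.+2 -> \bar R) :
  measurable_fun setT F -> (forall g, 0 <= F g) ->
  measurable_fun setT (step_op F : Gspace M k.+1 -> \bar R).
Proof.
move=> mF F0; apply: measurable_vsum => [|g].
  by apply: emeasurable_funM => //; apply/measurable_EFinP; exact: measurable_stepc.
by rewrite mule_ge0// lee_fin stepc_ge0.
Qed.

Lemma step_op_ge0 k (F : netclass M 'I_k.+2 -> \bar R) g :
  (forall g, 0 <= F g) -> 0 <= step_op F g.
Proof.
by move=> F0; apply: vsum_ge0 => h; rewrite mule_ge0// lee_fin stepc_ge0.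
Qed.

Lemma step_opZ k (c : R) (F : netclass M 'I_k.+2 -> \bar R) :
  (0 <= c)%R -> (forall g, 0 <= F g) ->
  step_op (fun h => c%:E * F h) = fun g => c%:E * step_op F g.
Proof.
move=> c0 F0; apply/funext => g; rewrite /step_op /vsum -esumZl//.
  by apply: eq_esum => x _; rewrite muleCA.
by move=> x; rewrite mule_ge0// lee_fin stepc_ge0.
Qed.

Lemma step_op_series k (f : (netclass M 'I_k.+2 -> \bar R)^nat) :
  (forall n g, 0 <= f n g) ->
  step_op (fun h => \sum_(n <oo) f n h) = fun g => \sum_(n <oo) step_op (f n) g.
Proof.
move=> f0; apply/funext => g; rewrite /step_op /vsum -esum_nneseries.
  by apply: eq_esum => x _; rewrite nneseriesZl.
by move=> n x; rewrite mule_ge0// lee_fin stepc_ge0.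
Qed.

Lemma le_step_op k (F G : netclass M 'I_k.+2 -> \bar R) g :
  (forall h, F h <= G h) -> step_op F g <= step_op G g.
Proof.
move=> FG; apply: le_esum => x _; apply: lee_wpmul2l => //.
by rewrite lee_fin stepc_ge0.
Qed.

(* The expectation of [F (G, w_0, ..., w_n)] for the walk started at the root. *)
Fixpoint walk_op n : (netclass M 'I_n.+1 -> \bar R) -> netclass M 'I_1 -> \bar R :=
  if n is m.+1 then fun F => walk_op (step_op F) else fun F => F.

Lemma measurable_walk_op n (F : Gspace M n.+1 -> \bar R) :
  measurable_fun setT F -> (forall g, 0 <= F g) ->
  measurable_fun setT (walk_op F : Gspace M 1 -> \bar R).
Proof.
elim: n F => [//|n IH] F mF F0 /=; apply: IH; first exact: measurable_step_op.
by move=> g; exact: step_op_ge0.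
Qed.

Lemma walk_op_ge0 n (F : netclass M 'I_n.+1 -> \bar R) g :
  (forall g, 0 <= F g) -> 0 <= walk_op F g.
Proof.
by elim: n F => [//|n IH] F F0 /=; apply: IH => h; exact: step_op_ge0.
Qed.

Lemma walk_opZ n (c : R) (F : netclass M 'I_n.+1 -> \bar R) g :
  (0 <= c)%R -> (forall g, 0 <= F g) ->
  walk_op (fun h => c%:E * F h) g = c%:E * walk_op F g.
Proof.
move=> c0; elim: n F => [//|n IH] F F0 /=.
by rewrite step_opZ// IH// => h; exact: step_op_ge0.
Qed.

Lemma walk_op_series n (f : (netclass M 'I_n.+1 -> \bar R)^nat) g :
  (forall i g, 0 <= f i g) ->
  walk_op (fun h => \sum_(i <oo) f i h) g = \sum_(i <oo) walk_op (f i) g.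
Proof.
elim: n f => [//|n IH] f f0 /=.
by rewrite step_op_series// IH// => i h; exact: step_op_ge0.
Qed.

Lemma walk_prob_rcons (N : network M) (x y : vert N) s :
  walk_prob x (rcons s y) = (walk_prob x s * step_prob (last x s) y :> R)%R.
Proof.
by elim: s x => [|z s IH] x /=; rewrite ?mulr1 ?mul1r// IH mulrA.
Qed.

Lemma walk_prob_ge0 (N : network M) (x : vert N) s : (0 <= walk_prob x s :> R)%R.
Proof. by elim: s x => [//|z s IH] x /=; rewrite mulr_ge0// step_prob_ge0. Qed.

Lemma cls_rcons (I : Type) (N : rnet M I) n (x y : vert N) (s : n.-tuple (vert N)) :
  cls (reroot (tnth [tuple of x :: [tuple of rcons s y]])) =
  cls (addr (N := reroot (tnth [tuple of x :: s])) y).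
Proof.
congr (cls (reroot _)); apply/funext => i /=.
case: unliftP => [j ->|->] /=; rewrite !(tnth_nth x).
  rewrite lift_max -[LHS]/(nth x (rcons (x :: s) y) j) nth_rcons /=.
  by rewrite size_tuple ltn_ord.
rewrite -[LHS]/(nth x (rcons (x :: s) y) n.+1) nth_rcons /=.
by rewrite size_tuple ltnn eqxx.
Qed.

(** This unfolds the nested kernels into the sum over paths that appears in [walk_law]. *)
Lemma walk_opE (I : Type) (N : rnet M I) (x : vert N) n
    (F : netclass M 'I_n.+1 -> \bar R) : (forall g, 0 <= F g) ->
  walk_op F (cls (reroot (fun _ : 'I_1 => x))) =
  \esum_(s in [set: n.-tuple (vert N)])
    ((walk_prob x s)%:E * F (cls (reroot (tnth [tuple of x :: s])))).
Proof.
elim: n F => [|n IH] F F0 /=.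
  rewrite (_ : [set: 0.-tuple (vert N)] = [set [tuple]]).
    rewrite esum_set1 /= ?mul1e//.
    by congr (F (cls (reroot _))); apply/funext => i; rewrite (tnth_nth x) ord1.
  by apply/seteqP; split=> // s _ /=; rewrite tuple0.
rewrite IH; last by move=> g; exact: step_op_ge0.
pose T (s : n.-tuple (vert N)) y := (walk_prob x s)%:E *
  ((step_prob (last x s) y)%:E *
   F (cls (addr (N := reroot (tnth [tuple of x :: s])) y))).
rewrite (eq_esum (b := fun s => \esum_(y in [set: vert N]) T s y)); last first.
  move=> s _; rewrite step_opE -esumZl; last 2 first.
  - exact: walk_prob_ge0.
  - by move=> y; rewrite mule_ge0// lee_fin step_prob_ge0.
  apply: eq_esum => y _; congr (_ * (_ * _)); congr (step_prob _ _)%:E.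
  rewrite /= (tnth_nth x) (last_nth x).
  by apply: (@eq_trans _ _ (nth x (x :: s) n)); rewrite ?size_tuple.
rewrite esum_esum; last first.
  by move=> s y _ _; rewrite !mule_ge0// lee_fin ?walk_prob_ge0 ?step_prob_ge0.
rewrite (@reindex_esum _ _ _ ([set: n.-tuple (vert N)] `*`` (fun=> [set: vert N]))
  setT (fun p => [tuple of rcons p.1 p.2])); last first.
  split=> //.
    move=> [s y] [s' y'] _ _ /= /(congr1 val)/= /rcons_inj[ss' ->].
    by congr (_, _); apply: val_inj.
  move=> s _ /=.
  have [s' [y sE]] : exists s' y, tval s = rcons s' y.
    by case/lastP: (tval s) (size_tuple s) => // s' y _; exists s', y.
  have s's : size s' == n by rewrite -eqSS -(size_rcons s' y) -sE size_tuple.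
  by exists (Tuple s's, y) => //; apply: val_inj.
apply: eq_esum => -[s y] _ /=; rewrite cls_rcons walk_prob_rcons.
by rewrite /T muleA -EFinM.
Qed.

End walk_operator.

Lemma cnt_le_deg (M : Type) (N : network M) (x y : vert N) :
  locally_finite N -> (cnt x y <= deg x)%N.
Proof.
move=> lf; apply: fsubset_leq_card; rewrite -fset_set_sub//.
- by move=> d [].
- by apply: sub_finite_set (lf x) => d [].
Qed.

Lemma pull_comp (M I J K : Type) (s : J -> I) (t : K -> J) (g : netclass M I) :
  pull t (pull s g) = pull (s \o t) g.
Proof. by rewrite {2}/pull pullE. Qed.

(** * The shift of trajectories and its invariant law *)

Section trajectories.
Variables (R : realType) (M : completeMetricType R).
Implicit Types k n : nat.
Local Open Scope ereal_scope.

Definition shift (t : Trajectory M) : Trajectory M := pull S t.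

Definition drop0 k : netclass M 'I_k.+1 -> netclass M 'I_k := pull (lift ord0).

Lemma segmentE n (t : Trajectory M) :
  segment n t = pull (fun i : 'I_n.+1 => i : nat) t.
Proof. by []. Qed.

Lemma segment_pull n m (s : 'I_m.+1 -> 'I_n.+1) (u : 'I_m.+1 -> nat) (t : Trajectory M) :
  (forall i, u i = s i) -> pull s (segment n t) = pull u t.
Proof.
move=> us; rewrite segmentE pull_comp; congr pull.
by apply/funext => i /=; rewrite us.
Qed.

Lemma segment_shift n (t : Trajectory M) :
  segment n (shift t) = drop0 (segment n.+1 t).
Proof.
rewrite segmentE /shift pull_comp /drop0 segmentE pull_comp.
by congr pull; apply/funext => i /=; rewrite /bump.
Qed.

Lemma measurable_segment n :
  measurable_fun setT (@segment R M n : Trajectory M -> Gspace M n.+1).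
Proof.
move=> _ A mA; rewrite setTI; apply: sub_sigma_algebra.
by exists n, A.
Qed.

Definition cylinders : set (set (netclass M nat)) :=
  [set B | exists n (A : set (Gspace M n.+1)),
     measurable A /\ B = @segment R M n @^-1` A].

Lemma preimage_shift n (A : set (Gspace M n.+1)) :
  shift @^-1` (@segment R M n @^-1` A) = @segment R M n.+1 @^-1` (@drop0 n.+1 @^-1` A).
Proof. by apply/funext => t; rewrite /preimage /mkset segment_shift. Qed.

Lemma measurable_shift : measurable_fun setT shift.
Proof.
apply: (@measurability _ _ (Trajectory M) (Trajectory M) setT shift cylinders) => //.
move=> _ [_ [n [A [mA ->]]] <-]; rewrite setTI.
rewrite preimage_shift -[X in measurable X]setTI; apply: measurable_segment => //.
by rewrite -[X in measurable X]setTI; apply: measurable_pull.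
Qed.

(** Both events are read off the longer of the two segments. *)
Lemma cylinders_setI : setI_closed cylinders.
Proof.
move=> _ _ [n [A [mA ->]]] [m [B [mB ->]]].
have hn : (n < (maxn n m).+1)%N by rewrite ltnS leq_maxl.
have hm : (m < (maxn n m).+1)%N by rewrite ltnS leq_maxr.
exists (maxn n m), (pull (widen_ord hn) @^-1` A `&` pull (widen_ord hm) @^-1` B).
split.
  apply: measurableI; rewrite -[X in measurable X]setTI;
    exact: (measurable_pull (widen_ord _)).
apply/seteqP; split=> t /=.
  by rewrite !(segment_pull (u := fun i => i : nat)).
by rewrite !(segment_pull (u := fun i => i : nat)).
Qed.

Lemma drop0_addr k (N : rnet M 'I_k.+1) x :
  drop0 (cls (addr (N := N) x)) =
  cls (addr (N := reroot (root N \o lift ord0) : rnet M 'I_k) x).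
Proof.
rewrite /drop0 pullE; congr (cls (reroot _)); apply/funext => i /=.
case: (unliftP ord_max i) => [j ->|->] /=.
  rewrite (_ : lift ord0 (lift ord_max j) = lift ord_max (lift ord0 j)) ?liftK//.
  by apply: val_inj; rewrite /= /bump !leq0n /= !add1n addnS; case: leqP; case: leqP => //; lia.
rewrite (_ : lift ord0 ord_max = ord_max) ?unlift_none//.
by apply: val_inj; rewrite /= /bump.
Qed.

Lemma step_op_drop0 k (F : netclass M 'I_k.+2 -> \bar R) g :
  step_op (F \o @drop0 k.+2) g = step_op F (drop0 g).
Proof.
rewrite -(cls_rep g) {2}/drop0 pullE !step_opE.
apply: eq_esum => x _ /=; rewrite drop0_addr; congr ((step_prob _ _)%:E * _).
by congr root; apply: val_inj; rewrite /= /bump.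
Qed.

(** Decomposition at the first step: a function that ignores [w_0] is averaged over the walk
    restarted at [w_1]. It follows from [step_op_drop0], as a transition depends on the current
    position only. *)
Lemma walk_op_drop0 n (F : netclass M 'I_n.+1 -> \bar R) g :
  walk_op (n := n.+1) (F \o @drop0 n.+1) g =
  step_op (walk_op F \o @drop0 1) g.
Proof.
elim: n F g => [|n IH] F g; first by [].
apply: etrans (IH (step_op F) g).
rewrite -[LHS]/(walk_op (n := n.+1) (step_op (F \o @drop0 n.+2)) g).
congr (walk_op _ g); apply/funext => h; exact: step_op_drop0.
Qed.

Section law.
Variables (mu : probability (Gstar M) R) (P : probability (Trajectory M) R).
Hypothesis mu_uni : unimodular mu.
Hypothesis muP : walk_law mu P.

Definition bias (g : Gstar M) : R := ((deg (rt g))%:R / fine (mean_degree mu))%R.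

Lemma measurable_bias : measurable_fun setT bias.
Proof.
exact: (measurable_locally_determined (fun j : nat => j%:R / fine (mean_degree mu) : R)%R
  (@degc_determined R M 1 ord0)).
Qed.

Lemma mean_degree_ge0 : (0 <= fine (mean_degree mu))%R.
Proof.
by rewrite fine_ge0// /mean_degree; apply: integral_ge0 => g _; rewrite lee_fin.
Qed.

Lemma bias_ge0 g : (0 <= bias g)%R.
Proof. by rewrite divr_ge0// mean_degree_ge0. Qed.

Lemma rep_root_eq (g : Gstar M) : cls (reroot (fun _ : 'I_1 => rt g)) = g.
Proof.
rewrite -[RHS]cls_rep /rt; congr cls; rewrite /reroot; case: (rep g) => //= N o c l.
suff -> : (fun=> o ord0) = o by [].
by apply/funext => i; rewrite [i]ord1.
Qed.

Lemma prob_segment n (A : set (Gspace M n.+1)) : measurable A ->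
  P (@segment R M n @^-1` A) = \int[P]_t (\1_A (segment n t))%:E.
Proof.
move=> mA; rewrite -[X in P X]setIT -integral_indic//.
by rewrite -[X in measurable X]setTI; apply: measurable_segment.
Qed.

Lemma walk_expectation n (F : Gspace M n.+1 -> \bar R) :
  measurable_fun setT F -> (forall h, 0 <= F h) ->
  \int[P]_t F (segment n t) = \int[mu]_g ((bias g)%:E * walk_op F g).
Proof.
have mb : measurable_fun setT (fun g => (bias g)%:E).
  by apply/measurable_EFinP; exact: measurable_bias.
move: F; apply: nonneg_ind.
- move=> A mA; rewrite -prob_segment// muP//; apply: eq_integral => g _; congr (_ * _).
  rewrite -[in RHS](rep_root_eq g) walk_opE; last by move=> h; rewrite lee_fin.
  rewrite esum_mkcond; apply: eq_esum => s _.
  rewrite indicE; case: ifPn => [/set_mem h|/negP h].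
    by rewrite mem_set// mule1.
  by rewrite memNset ?mule0// => Ah; apply: h; rewrite inE.
- move=> c f c0 mf f0 IH.
  rewrite ge0_integralZl_EFin//; last first.
    by apply: measurableT_comp => //; exact: measurable_segment.
  rewrite IH -ge0_integralZl_EFin//; last 2 first.
  - by move=> g _; rewrite mule_ge0// ?lee_fin ?bias_ge0// walk_op_ge0.
  - by apply: emeasurable_funM => //; exact: measurable_walk_op.
  by apply: eq_integral => g _; rewrite walk_opZ// muleCA.
- move=> f mf f0 IH.
  rewrite integral_nneseries//; last first.
    by move=> i; apply: measurableT_comp => //; exact: measurable_segment.
  rewrite (eq_eseriesr (fun i _ => IH i)) -integral_nneseries//; last 2 first.
  - by move=> i; apply: emeasurable_funM => //; exact: measurable_walk_op.
  - by move=> i g _; rewrite mule_ge0// ?lee_fin ?bias_ge0// walk_op_ge0.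
  apply: eq_integral => g _; rewrite walk_op_series// nneseriesZl// => i _.
  exact: walk_op_ge0.
Qed.

Lemma expectation_step n (F : Gspace M n.+2 -> \bar R) :
  measurable_fun setT F -> (forall h, 0 <= F h) ->
  \int[P]_t F (segment n.+1 t) = \int[P]_t step_op F (segment n t).
Proof.
move=> mF F0; rewrite !walk_expectation//.
- exact: measurable_step_op.
- by move=> h; exact: step_op_ge0.
Qed.

(** The degree-biased measure is stationary for one step. This is the mass transport principle for
    the mass [cnt(x, y) * H(y) / a]: what leaves the root is the average after one step, and what
    enters is [H] times the number of darts, because [cnt] is symmetric. *)
Lemma unimodular_step (H : Gstar M -> \bar R) :
  measurable_fun setT H -> (forall h, 0 <= H h) ->
  \int[mu]_g ((bias g)%:E * step_op (H \o @drop0 1) g) =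
  \int[mu]_g ((bias g)%:E * H g).
Proof.
move=> mH H0; pose a : R := fine (mean_degree mu).
have a0 : (0 <= a^-1)%R by rewrite invr_ge0 mean_degree_ge0.
pose f (h : Gstar2 M) := ((cntc ord0 ord_max h)%:R / a)%:E * H (drop0 h).
have mf : measurable_fun setT f.
  apply: emeasurable_funM.
    apply/measurable_EFinP; apply: (measurable_locally_determined
      (fun j : nat => j%:R / a : R)%R (@cntc_determined R M 2 ord0 ord_max)).
  exact: (measurableT_comp mH (@measurable_pull R M 2 1 (lift ord0))).
have f0 h : 0 <= f h by rewrite mule_ge0// lee_fin mulr_ge0.
have cls2E (g : Gstar M) (x y : vert (rep g)) :
    f (cls2 x y) = ((cnt x y)%:R / a)%:E * H (cls (reroot (fun _ : 'I_1 => y))).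
  rewrite /f /cls2 cntcE /drop0 pullE /=.
  by congr (_ * H (cls (reroot _))); apply/funext => i; rewrite [i]ord1.
transitivity (\int[mu]_g (\esum_(x in [set: vert (rep g)]) f (cls2 (rt g) x))).
  apply: eq_integral => g _.
  rewrite -{2}(cls_rep g) step_opE -esumZl ?bias_ge0//; last first.
    by move=> x; apply: mule_ge0; [rewrite lee_fin step_prob_ge0|exact: H0].
  apply: eq_esum => x _; rewrite cls2E// muleA -EFinM; congr (_%:E * _); last first.
    rewrite /= drop0_addr; congr (H (cls (reroot _))); apply/funext => i /=.
    by case: (unliftP ord_max i) => [[]|].
  rewrite /bias /step_prob -/(cnt _ _) (_ : root (rep g) ord_max = rt g); last first.
    by congr root; apply: val_inj.
  (* If the root has degree 0, division by the degree yields 0 and there are no darts to count, so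
     both sides vanish. *)
  have [d0|d0] := eqVneq (deg (rt g)) 0%N; last by rewrite mulrC mulrA mulfVK ?pnatr_eq0.
  rewrite d0 !mul0r; suff -> : cnt (rt g) x = 0%N by rewrite mul0r.
  have := cnt_le_deg (rt g) x (@net_locfin _ _ (rep g)).
  by rewrite d0 leqn0 => /eqP.
rewrite mu_uni//; apply: eq_integral => g _.
under eq_esum => x _ do rewrite cls2E// rep_root_eq muleC.
transitivity (\esum_(x in setT) ((cnt (rt g) x)%:R%:E * (a^-1%:E * H g))).
  by apply: eq_esum => x _; rewrite cnt_sym EFinM muleC muleA.
rewrite esum_darts//; last 2 first.
- exact: net_locfin.
- by move=> _; rewrite mule_ge0// lee_fin.
rewrite esum_fset//=; last 2 first.
- exact: net_locfin.
- by move=> *; rewrite mule_ge0// lee_fin.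
rewrite fsbig_finite//=; last exact: net_locfin.
rewrite big_const_seq count_predT iter_addr_0.
transitivity ((deg (rt g))%:R%:E * (a^-1%:E * H g)); first by rewrite mule_natl.
by rewrite muleA -EFinM.
Qed.

(** On a cylinder, [walk_op_drop0] isolates the first step and [unimodular_step] removes it; the
    cylinders generate and are stable under intersection. *)
Lemma shift_invariant (B : set (Trajectory M)) : measurable B ->
  P (shift @^-1` B) = P B.
Proof.
have msh : measurable_fun setT shift := measurable_shift.
move=> mB; move: B mB.
apply: (@dynkin_induction _ (Trajectory M) cylinders (fun B => P (shift @^-1` B) = P B)) => //.
- exact: cylinders_setI.
- move=> _ [n [A [mA ->]]].
  have mI : measurable_fun setT (fun h : Gspace M n.+1 => (\1_A h)%:E : \bar R).
    by apply/measurable_EFinP; apply: measurable_indic.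
  have -> : shift @^-1` (segment n @^-1` A) = segment n.+1 @^-1` (@drop0 n.+1 @^-1` A).
    exact: preimage_shift.
  have md : measurable (@drop0 n.+1 @^-1` A : set (Gspace M n.+2)).
    by rewrite -[X in measurable X]setTI; apply: measurable_pull.
  rewrite !prob_segment//.
  rewrite (walk_expectation (F := fun h => (\1_A h)%:E))//.
  rewrite -unimodular_step; last 2 first.
  - by apply: measurable_walk_op => // h; rewrite lee_fin.
  - by move=> h; apply: walk_op_ge0 => h'; rewrite lee_fin.
  rewrite (walk_expectation (F := fun h => (\1_(@drop0 n.+1 @^-1` A) h)%:E)); last 2 first.
  - by apply/measurable_EFinP; apply: measurable_indic.
  - by move=> h; rewrite lee_fin.
  by apply: eq_integral => g _; rewrite -walk_op_drop0.
- move=> B mB PB; rewrite preimage_setC !probability_setC// ?PB//.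
  by rewrite -[X in measurable X]setTI; apply: msh.
- move=> F mF tF PF; rewrite preimage_bigcup !measure_bigcup//.
  + by apply: eq_eseriesr => i _; exact: PF.
  + by move=> i _; rewrite -[X in measurable X]setTI; apply: msh.
  + apply/trivIsetP => i j _ _ ij.
    by rewrite -preimage_setI (trivIsetP.1 tF)// preimage_set0.
Qed.

Lemma expectation_shift (f : Trajectory M -> \bar R) :
  measurable_fun setT f -> (forall t, 0 <= f t) ->
  \int[P]_t f (shift t) = \int[P]_t f t.
Proof.
move=> mf f0; have msh := measurable_shift.
rewrite -[LHS](@ge0_integral_pushforward _ _ _ _ _ shift msh P setT f)//.
apply: eq_measure_integral => B mB _; rewrite /pushforward.
exact: shift_invariant.
Qed.

End law.
End trajectories.

(** * Birkhoff's ergodic theorem for bounded functions *)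

Section unit_limsup.
Variable R : realType.
Implicit Types u v : R^nat.

Let ub u : (forall n, 0 <= u n <= 1) -> has_ubound (range u).
Proof. by move=> u01; exists 1 => _ [n _ <-]; have /andP[] := u01 n. Qed.

Let lb u : (forall n, 0 <= u n <= 1) -> has_lbound (range u).
Proof. by move=> u01; exists 0 => _ [n _ <-]; have /andP[] := u01 n. Qed.

Let limsupE u : (forall n, 0 <= u n <= 1) -> limn_sup u = inf (range (sups u)).
Proof.
move=> u01; apply: limn_supE; exists 1; split=> // x x1 n _ /=.
have /andP[u0 u1] := u01 n.
by rewrite ger0_norm// (le_trans u1)// ltW.
Qed.

Let sdrop_ub u n : (forall n, 0 <= u n <= 1) -> has_sup (sdrop u n).
Proof.
move=> u01; split; first by exists (u n), n => /=.
by exists 1 => _ [k _ <-]; have /andP[] := u01 k.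
Qed.

Let range_inf u : (forall n, 0 <= u n <= 1) -> has_inf (range (sups u)).
Proof.
move=> u01; split; first by exists (sups u 0%N), 0%N.
exists 0 => _ [n _ <-]; rewrite /sups /=.
have /andP[u0 _] := u01 n; apply: (le_trans u0).
by apply: ub_le_sup; [exact: (sdrop_ub n u01).2|exists n => /=].
Qed.

Lemma limn_sup_ub u : (forall n, 0 <= u n <= 1) ->
  forall e, 0 < e -> exists N, forall n, (N <= n)%N -> u n <= limn_sup u + e.
Proof.
move=> u01 e e0; rewrite limsupE//.
have [_ [N _ <-] lt] := inf_adherent e0 (range_inf u01).
exists N => n Nn; apply: le_trans (ltW lt); rewrite /sups /=.
by apply: ub_le_sup; [exact: (sdrop_ub N u01).2|exists n].
Qed.

Lemma limn_sup_lb u : (forall n, 0 <= u n <= 1) ->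
  forall e N, 0 < e -> exists2 n, (N <= n)%N & limn_sup u - e <= u n.
Proof.
move=> u01 e N e0; rewrite limsupE//.
have [_ [n /= Nn <-] lt] := sup_adherent e0 (sdrop_ub N u01).
exists n => //; apply: le_trans (ltW lt); rewrite lerD2r.
by apply: ge_inf; [exact: (range_inf u01).2|exists N].
Qed.

(** The index may drop by one, which is what comparing averages along an orbit and along its shift
    needs. *)
Lemma le_limn_sup u v : (forall n, 0 <= u n <= 1) -> (forall n, 0 <= v n <= 1) ->
  (forall e, 0 < e -> exists N, forall n, (N <= n)%N -> exists2 m, (n <= m.+1)%N &
    u n <= v m + e) ->
  limn_sup u <= limn_sup v.
Proof.
move=> u01 v01 uv; apply/ler_addgt0Pl => e e0.
have e3 : 0 < e / 3 by rewrite divr_gt0.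
have [N1 uvN] := uv _ e3.
have [N2 vN] := limn_sup_ub v01 e3.
have [n] := limn_sup_lb u01 (maxn N1 N2.+1) e3.
rewrite geq_max => /andP[N1n N2n] un.
have [m nm unm] := uvN n N1n.
have := vN m (leq_trans N2n nm : (N2 < m.+1)%N); lra.
Qed.

Lemma limn_sup_ge0 u : (forall n, 0 <= u n <= 1) -> 0 <= limn_sup u.
Proof.
move=> u01; apply/ler_addgt0Pl => e e0.
have [N uN] := limn_sup_ub u01 e0.
have := uN N (leqnn N); have /andP[] := u01 N; lra.
Qed.

Lemma limn_sup_le1 u : (forall n, 0 <= u n <= 1) -> limn_sup u <= 1.
Proof.
move=> u01; apply/ler_addgt0Pl => e e0.
have [n _ un] := limn_sup_lb u01 0%N e0.
have /andP[] := u01 n; lra.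
Qed.

End unit_limsup.

Section birkhoff.
Context d (T : measurableType d) (R : realType) (P : probability T R).
Variable tau : T -> T.
Hypothesis mtau : measurable_fun setT tau.
Hypothesis tauP : forall f : T -> \bar R, measurable_fun setT f ->
  (forall x, (0 <= f x)%E) -> (\int[P]_x f (tau x) = \int[P]_x f x)%E.

Definition bsum (f : T -> R) n x := \sum_(k < n) f (iter k tau x).
Definition bavg (f : T -> R) n x := bsum f n x / n%:R.

Lemma bsumD f m n x : bsum f (m + n) x = bsum f m x + bsum f n (iter m tau x).
Proof.
rewrite /bsum big_split_ord /=; congr (_ + _); apply: eq_bigr => i _.
by rewrite addnC iterD.
Qed.

Lemma bsumS f n x : bsum f n.+1 x = f x + bsum f n (tau x).
Proof. by rewrite -add1n bsumD /bsum big_ord1. Qed.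

Lemma measurable_iter_tau k : measurable_fun setT (iter k tau).
Proof.
elim: k => [|k IH]; first exact: measurable_id.
exact: (measurableT_comp mtau IH).
Qed.

Lemma measurable_bsum f n : measurable_fun setT f -> measurable_fun setT (bsum f n).
Proof.
move=> mf; apply: measurable_sum => k.
exact: (measurableT_comp mf (measurable_iter_tau k)).
Qed.

Lemma measurable_bavg f n : measurable_fun setT f -> measurable_fun setT (bavg f n).
Proof. by move=> mf; apply: measurable_funM => //; exact: measurable_bsum. Qed.

Lemma integral_iter (f : T -> \bar R) k : measurable_fun setT f -> (forall x, 0 <= f x)%E ->
  (\int[P]_x f (iter k tau x) = \int[P]_x f x)%E.
Proof.
move=> mf f0; elim: k => [//|k IH]; rewrite -IH.
under eq_integral do rewrite iterSr.
apply: (tauP (f := f \o iter k tau)) => [|x]; last exact: f0.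
exact: (measurableT_comp mf (measurable_iter_tau k)).
Qed.

Lemma integral_bsum (f : T -> R) n : measurable_fun setT f -> (forall x, 0 <= f x) ->
  (\int[P]_x (bsum f n x)%:E = n%:R%:E * \int[P]_x (f x)%:E)%E.
Proof.
move=> mf f0; under eq_integral do rewrite /bsum -sumEFin.
rewrite ge0_integral_sum//; last 2 first.
- move=> k; apply/measurable_EFinP.
  exact: (measurableT_comp mf (measurable_iter_tau k)).
- by move=> k x _; rewrite lee_fin.
rewrite (eq_bigr (fun=> \int[P]_x (f x)%:E)%E); last first.
  move=> k _; apply: (@integral_iter (fun x => (f x)%:E)) => //.
  exact/measurable_EFinP.
by rewrite big_const_ord iter_addr_0 mule_natl.
Qed.

Section unit_function.
Variable f : T -> R.
Hypothesis mf : measurable_fun setT f.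
Hypothesis f01 : forall x, 0 <= f x <= 1.

Let f0 x : 0 <= f x. Proof. by have /andP[] := f01 x. Qed.
Let f1 x : f x <= 1. Proof. by have /andP[] := f01 x. Qed.

Lemma bavg01 x n : 0 <= bavg f n x <= 1.
Proof.
rewrite divr_ge0 ?sumr_ge0//=.
case: n => [|n]; first by rewrite /bavg invr0 mulr0.
rewrite ler_pdivrMr ?ltr0n// mul1r.
rewrite (_ : n.+1%:R = \sum_(k < n.+1) 1); first exact: ler_sum.
by rewrite sumr_const card_ord.
Qed.

Definition bsup x := limn_sup (bavg f ^~ x).

Lemma measurable_bsup : measurable_fun setT bsup.
Proof.
apply: measurable_fun_limn_sup.
- by move=> x _; exists 1 => _ [n _ <-]; have /andP[] := bavg01 x n.
- by move=> x _; exists 0 => _ [n _ <-]; have /andP[] := bavg01 x n.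
- by move=> n; exact: measurable_bavg.
Qed.

Lemma bavg_tau n x : `|bavg f n.+1 x - bavg f n (tau x)| <= 2 / n.+1%:R.
Proof.
case: n => [|n].
  rewrite /bavg /bsum big_ord0 big_ord1 mul0r subr0 /= divr1 invr1 ger0_norm//.
  by rewrite mulr1 (le_trans (f1 _))// ler1n.
rewrite /bavg bsumS; set s := bsum f n.+1 (tau x).
have s0 : 0 <= s by rewrite /s /bsum sumr_ge0.
have s1 : s <= n.+1%:R.
  have /andP[_] := bavg01 (tau x) n.+1.
  by rewrite /bavg ler_pdivrMr ?ltr0n// mul1r.
have n0 : 0 < n.+1%:R :> R by rewrite ltr0n.
have -> : (f x + s) / n.+2%:R - s / n.+1%:R = (f x - s / n.+1%:R) / n.+2%:R.
  rewrite -[n.+2%:R]natr1; move: n0; set a := n.+1%:R => a0.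
  by field; rewrite !gt_eqF// addr_gt0.
rewrite normrM normfV (ger0_norm (ler0n _ _)).
apply: ler_wpM2r; first by rewrite invr_ge0 ler0n.
have : s / n.+1%:R <= 1 by rewrite ler_pdivrMr// mul1r.
have : 0 <= s / n.+1%:R by rewrite divr_ge0.
have := f0 x; have := f1 x; set q := s / n.+1%:R => a1 a2 a3 a4.
by rewrite ler_norml; apply/andP; split; lra.
Qed.

Lemma bsup_tau x : bsup (tau x) = bsup x.
Proof.
have small e : 0 < e -> exists N, forall n, (N <= n)%N -> 2 / n.+1%:R <= e :> R.
  move=> e0; exists (Num.truncn (2 / e)) => n nN.
  rewrite ler_pdivrMr ?ltr0n// mulrC -ler_pdivrMr//.
  apply: le_trans (ltW (truncnS_gt _)) _.
  by rewrite ler_nat.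
apply/eqP; rewrite eq_le; apply/andP; split; apply: le_limn_sup => [n|n|e e0].
- exact: bavg01.
- exact: bavg01.
- have [N sN] := small e e0; exists N => n Nn; exists n.+1; first exact: leqW (leqnSn n).
  have := bavg_tau n x; have := sN n Nn.
  rewrite ler_norml; move: (2 / n.+1%:R) => q h1 /andP[h2 h3] /=; lra.
- exact: bavg01.
- exact: bavg01.
- have [N sN] := small e e0; exists N.+1 => -[//|n] Nn; exists n => //.
  have := bavg_tau n x; have := sN n Nn.
  rewrite ler_norml; move: (2 / n.+1%:R) => q h1 /andP[h2 h3] /=; lra.
Qed.

(** A covering argument: long orbits are cut into bounded blocks on which the average of [f] almost
    reaches the invariant function [bsup], and the resulting inequality is integrated. *)
Lemma integral_bsup_le : (\int[P]_x (bsup x)%:E <= \int[P]_x (f x)%:E)%E.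
Proof.
have fin (g : T -> R) : measurable_fun setT g -> (forall x, 0 <= g x <= 1) ->
    (\int[P]_x (g x)%:E)%E \is a fin_num.
  move=> mg g01; rewrite ge0_fin_numE; last first.
    by apply: integral_ge0 => x _; rewrite lee_fin; have /andP[] := g01 x.
  apply: (@le_lt_trans _ _ (\int[P]_x (cst 1%:E) x)%E).
    apply: ge0_le_integral => //.
    - by move=> x _; rewrite lee_fin; have /andP[] := g01 x.
    - exact/measurable_EFinP.
    - by move=> x _; rewrite lee_fin; have /andP[] := g01 x.
  rewrite integral_cst// mul1e; apply: le_lt_trans (probability_le1 P measurableT) _.
  exact: ltry.
have s01 x : 0 <= bsup x <= 1.
  by rewrite limn_sup_ge0 ?limn_sup_le1// => n; exact: bavg01.
have ms := measurable_bsup.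
apply/lee_addgt0Pr => e e0.
have e2 : 0 < e / 4 by rewrite divr_gt0.
(* The points at which some average of length at most [L] comes within [e / 4] of the limsup; they
   exhaust the space as [L] grows. *)
pose E L := \bigcup_(n in [set n | (0 < n <= L)%N]) [set x | bsup x - e / 4 <= bavg f n x].
have mE L : measurable (E L).
  apply: bigcup_measurable => n _.
  rewrite (_ : [set x | _] = (fun x => bavg f n x - bsup x) @^-1` `[- (e / 4), +oo[).
    rewrite -[X in measurable X]setTI.
    apply: (measurable_funB (measurable_bavg n mf) ms) => //.
  by apply/seteqP; split=> x /=; rewrite in_itv/= andbT; lra.
have ndE : nondecreasing_seq E.
  move=> L L' LL'; apply/subsetPset => x [n /= /andP[n0 nL] h].
  by exists n => //=; rewrite n0 (leq_trans nL).
have ET : \bigcup_L E L = setT.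
  apply/seteqP; split=> // x _.
  have [n n1 h] := limn_sup_lb (bavg01 x) 1%N e2.
  by exists n => //; exists n => //=; rewrite n1 leqnn.
have cE : P (E L) @[L --> \oo] --> (1%:E : \bar R).
  rewrite -(@probability_setT _ _ _ P) -ET; apply: nondecreasing_cvg_mu => //.
  exact: bigcup_measurable.
have [L PL] : exists L, (P (~` E L) <= (e / 4)%:E)%E.
  apply: contrapT => /forallNP none.
  have : (1%:E <= (1 - e / 4)%:E :> \bar R)%E.
    apply: (cvge_to_le cE); apply: nearW => L.
    have := none L; move/negP; rewrite -ltNge probability_setC// => h.
    have : P (E L) \is a fin_num by exact: fin_num_measure.
    case: (P (E L)) h => // r; rewrite -EFinB !lte_fin !lee_fin; lra.
  by rewrite lee_fin; lra.
(* Adding 1 on the bad set makes blocks of length 1 acceptable there, at a cost of at most [e / 4]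
   in the integral. *)
pose h x := f x + \1_(~` E L) x.
have mi : measurable_fun setT (\1_(~` E L) : T -> R).
  by apply: measurable_indic; exact: measurableC.
have mh : measurable_fun setT h by exact: measurable_funD.
have h0 x : 0 <= h x by rewrite addr_ge0.
have fh x : f x <= h x by rewrite lerDl.
(* The orbit is cut greedily into blocks whose [h]-sum is at least their length times
   [bsup x - e / 4]; the piece left over has length at most [L]. *)
have key n : forall x, n%:R * (bsup x - e / 4) <= bsum h n x + L%:R.
  elim/ltn_ind: n => n IH x.
  have s1 : bsup x - e / 4 <= 1 by have /andP[] := s01 x; lra.
  have b0 m y : 0 <= bsum h m y by apply: sumr_ge0.
  have [nL|Ln] := leqP n L.
    apply: (@le_trans _ _ n%:R); first exact: ler_piMr.
    by rewrite -[leLHS]add0r lerD// ler_nat.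
  have [m [m0 mn hm]] : exists m, [/\ (0 < m)%N, (m <= n)%N &
      m%:R * (bsup x - e / 4) <= bsum h m x].
    have [[m /= /andP[m0 mL] hm]|nE] := pselect (E L x).
      exists m; split=> //; first exact: leq_trans mL (ltnW Ln).
      rewrite mulrC -ler_pdivlMr ?ltr0n//; apply: (le_trans hm).
      by rewrite ler_wpM2r ?invr_ge0//; apply: ler_sum.
    exists 1%N; split=> //; first exact: leq_ltn_trans Ln.
    rewrite mul1r /bsum big_ord1 /= (le_trans s1)//.
    by rewrite /h indicE mem_set// lerDr.
  rewrite -{1}(subnKC mn) natrD mulrDl -{2}(subnKC mn) bsumD -addrA lerD//.
  have := IH (n - m)%N _ (iter m tau x).
  have -> : bsup (iter m tau x) = bsup x.
    by elim: m {m0 mn hm} => // m IHm; rewrite iterS bsup_tau.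
  by apply; lia.
pose I (g : T -> R) := fine (\int[P]_x (g x)%:E)%E.
have fI (g : T -> R) : measurable_fun setT g -> (forall x, 0 <= g x <= 1) ->
  (\int[P]_x (g x)%:E)%E = (I g)%:E by move=> *; rewrite /I fineK// fin.
have i01 x : 0 <= (\1_(~` E L) x : R) <= 1.
  by rewrite indicE; case: (_ \in _); rewrite lexx ler01.
have Ii : I (\1_(~` E L)) <= e / 4.
  rewrite -lee_fin -fI// integral_indic ?setIT//; exact: measurableC.
have cstI (r : R) : (\int[P]__ r%:E = r%:E)%E.
  rewrite integral_cst//; transitivity (r%:E * 1)%E; last by rewrite mule1.
  by congr (_ * _)%E; exact: probability_setT.
have keyI n : n%:R * I bsup <= n%:R * (I f + I (\1_(~` E L))) + n%:R * (e / 4) + L%:R.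
  have : (\int[P]_x (n%:R * bsup x)%:E <=
      \int[P]_x ((bsum h n x)%:E + (n%:R * (e / 4) + L%:R)%:E))%E.
    apply: ge0_le_integral => //.
    - by move=> x _; rewrite lee_fin mulr_ge0//; have /andP[] := s01 x.
    - by apply/measurable_EFinP; apply: measurable_funM.
    - apply/measurable_EFinP; apply: measurable_funD => //.
      exact: measurable_bsum.
    - by move=> x _; rewrite -EFinD lee_fin; have := key n x; lra.
  under eq_integral do rewrite EFinM.
  rewrite ge0_integralZl_EFin//; last 2 first.
  - by move=> x _; rewrite lee_fin; have /andP[] := s01 x.
  - exact/measurable_EFinP.
  rewrite ge0_integralD//; last 3 first.
  - by move=> x _; rewrite lee_fin; apply: sumr_ge0.
  - by apply/measurable_EFinP; exact: measurable_bsum.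
  - by move=> x _; rewrite lee_fin addr_ge0// mulr_ge0// ltW.
  rewrite integral_bsum// cstI.
  rewrite /h; under [in X in (_ <= X)%E]eq_integral do rewrite EFinD.
  rewrite ge0_integralD//; last 3 first.
  - by move=> x _; rewrite lee_fin.
  - exact/measurable_EFinP.
  - exact/measurable_EFinP.
  rewrite (fI bsup)// (fI f)// (fI (\1_(~` E L)))// => H.
  have : ((n%:R * I bsup)%:E <= (n%:R * (I f + I (\1_(~` E L))) +
    (n%:R * (e / 4) + L%:R))%:E)%E := H.
  by rewrite lee_fin addrA.
rewrite (fI bsup)// (fI f)//.
suff : ((I bsup)%:E <= (I f + e)%:E)%E by [].
rewrite lee_fin.
rewrite leNgt; apply/negP => lt.
(* At this length the leftover [L] is less than [n * (e / 4)], so the three errors together stay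
   below [n * e]. *)
pose n := (Num.truncn (L%:R / (e / 4))).+1.
have n0 : 0 < n%:R :> R by rewrite ltr0n.
have : L%:R < n%:R * (e / 4).
  by rewrite -ltr_pdivrMr// truncnS_gt.
have := keyI n => k1 k2.
have : n%:R * (I f + e) < n%:R * I bsup by rewrite ltr_pM2l.
have : n%:R * I (\1_(~` E L)) <= n%:R * (e / 4) by rewrite ler_pM2l.
have : 0 < n%:R * (e / 4) by rewrite mulr_gt0.
move: k1 k2; rewrite !mulrDr; set a := n%:R * (e / 4).
have -> : n%:R * e = 4 * a by rewrite /a; field.
lra.
Qed.

End unit_function.

Lemma fine_integral01 (g : T -> R) : measurable_fun setT g ->
  (forall x, 0 <= g x <= 1) ->
  (\int[P]_x (g x)%:E = (fine (\int[P]_x (g x)%:E))%:E)%E.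
Proof.
move=> mg g01; rewrite fineK// ge0_fin_numE; last first.
  by apply: integral_ge0 => x _; rewrite lee_fin; have /andP[] := g01 x.
apply: (@le_lt_trans _ _ (\int[P]_x (cst 1%:E) x)%E).
  apply: ge0_le_integral => //.
  - by move=> x _; rewrite lee_fin; have /andP[] := g01 x.
  - exact/measurable_EFinP.
  - by move=> x _; rewrite lee_fin; have /andP[] := g01 x.
rewrite integral_cst// mul1e; apply: le_lt_trans (probability_le1 P measurableT) _.
exact: ltry.
Qed.

Lemma bsup01 f x : (forall x, 0 <= f x <= 1) -> 0 <= bsup f x <= 1.
Proof.
by move=> f01; rewrite limn_sup_ge0 ?limn_sup_le1// => n; exact: bavg01.
Qed.

(** [integral_bsup_le] is applied to [f] and to [1 - f]. Since a limsup is at least the liminf, the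
    two functions [bsup] add up to at least 1; their integrals add up to at most 1. So the sum is 1
    almost everywhere, which says that limsup and liminf agree. *)
Lemma birkhoff (f : T -> R) : measurable_fun setT f ->
  (forall x, 0 <= f x <= 1) ->
  {ae P, forall x, bavg f n x @[n --> \oo] --> bsup f x} /\
  (\int[P]_x (bsup f x)%:E = \int[P]_x (f x)%:E)%E.
Proof.
move=> mf f01; pose h x := 1 - f x.
have mh : measurable_fun setT h by exact: measurable_funB.
have h01 x : 0 <= h x <= 1 by have /andP[f0 f1] := f01 x; apply/andP; rewrite /h; split; lra.
have hf n x : (0 < n)%N -> bavg h n x = 1 - bavg f n x.
  move=> n0; rewrite /bavg /bsum /h sumrB sumr_const card_ord mulrBl divff//.
  by rewrite pnatr_eq0 -lt0n.
have mG := measurable_bsup mf f01; have mH := measurable_bsup mh h01.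
have G01 x := bsup01 x f01; have H01 x := bsup01 x h01.
have GH x : 1 <= bsup f x + bsup h x.
  apply/ler_addgt0Pl => e e0.
  have e2 : 0 < e / 2 by rewrite divr_gt0.
  have [N1 h1] := limn_sup_ub (bavg01 f01 x) e2.
  have [N2 h2] := limn_sup_ub (bavg01 h01 x) e2.
  have := h1 (maxn N1 N2).+1 (leqW (leq_maxl _ _)).
  have := h2 (maxn N1 N2).+1 (leqW (leq_maxr _ _)).
  by rewrite hf// /bsup /=; lra.
have iG := integral_bsup_le mf f01; have iH := integral_bsup_le mh h01.
have PT : (\int[P]_x (1 : R)%:E = 1%:E)%E.
  rewrite integral_cst//; transitivity (1%:E * 1 : \bar R)%E; last by rewrite mule1.
  by congr (_ * _)%E; exact: probability_setT.
pose I (g : T -> R) := fine (\int[P]_x (g x)%:E)%E.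
have IE (g : T -> R) : measurable_fun setT g -> (forall x, 0 <= g x <= 1) ->
  (\int[P]_x (g x)%:E = (I g)%:E)%E by exact: fine_integral01.
have ID (g1 g2 : T -> R) : measurable_fun setT g1 -> (forall x, 0 <= g1 x <= 1) ->
    measurable_fun setT g2 -> (forall x, 0 <= g2 x <= 1) ->
    (\int[P]_x (g1 x + g2 x)%:E = (I g1 + I g2)%:E)%E.
  move=> m1 b1 m2 b2; under eq_integral do rewrite EFinD.
  rewrite ge0_integralD//; last 4 first.
  - by move=> x _; rewrite lee_fin; have /andP[] := b1 x.
  - exact/measurable_EFinP.
  - by move=> x _; rewrite lee_fin; have /andP[] := b2 x.
  - exact/measurable_EFinP.
  by rewrite (IE g1)// (IE g2).
have Ifh : I f + I h = 1.
  have := ID f h mf f01 mh h01.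
  under eq_integral do rewrite /h addrC subrK.
  by rewrite PT => -[].
move: iG iH; rewrite (IE _ mG G01) (IE _ mf f01) (IE _ mH H01) (IE _ mh h01).
rewrite !lee_fin => iG iH.
have mGH : measurable_fun setT (fun x => bsup f x + bsup h x) by exact: measurable_funD.
have I1 : 1 <= I (bsup f) + I (bsup h).
  rewrite -lee_fin -(ID _ _ mG G01 mH H01) -PT; apply: ge0_le_integral => //.
    exact/measurable_EFinP.
  by move=> x _; rewrite lee_fin.
split; last by rewrite (_ : I (bsup f) = I f)//; lra.
have z : (\int[P]_x `|(bsup f x + bsup h x - 1)%:E| = 0)%E.
  have : (\int[P]_x ((bsup f x + bsup h x - 1)%:E + 1%:E) =
      \int[P]_x (bsup f x + bsup h x - 1)%:E + 1%:E)%E.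
    rewrite ge0_integralD ?PT//.
    - by move=> x _; rewrite lee_fin subr_ge0.
    - by apply/measurable_EFinP; exact: measurable_funB.
  rewrite (eq_integral (fun x => (bsup f x + bsup h x)%:E)); last first.
    by move=> x _; rewrite -EFinD subrK.
  rewrite (ID _ _ mG G01 mH H01) (_ : I (bsup f) + I (bsup h) = 1); last by lra.
  have -> : (\int[P]_x `|(bsup f x + bsup h x - 1)%:E| =
      \int[P]_x (bsup f x + bsup h x - 1)%:E)%E.
    by apply: eq_integral => x _; rewrite abse_EFin ger0_norm// subr_ge0.
  case: (\int[P]_x _)%E => [r| |]//=.
  rewrite -EFinD => -[r1]; congr (_%:E); lra.
have mz : measurable_fun setT (fun x => (bsup f x + bsup h x - 1)%:E).
  by apply/measurable_EFinP; exact: measurable_funB.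
have /(ae_eq_integral_abs P measurableT mz) := z.
apply: filterS => x /(_ Logic.I) [] xz.
have GHx : bsup h x = 1 - bsup f x by lra.
apply/cvgrPdist_le => e e0.
have [N1 h1] := limn_sup_ub (bavg01 f01 x) e0.
have [N2 h2] := limn_sup_ub (bavg01 h01 x) e0.
exists (maxn N1 N2).+1 => // n /= nN.
have n0 : (0 < n)%N by exact: leq_ltn_trans nN.
have := h1 n (leq_trans (leqW (leq_maxl _ _)) nN).
have := h2 n (leq_trans (leqW (leq_maxr _ _)) nN).
rewrite /= hf// -!/(bsup _ x) GHx => a1 a2.
by rewrite ler_norml; apply/andP; split; clear -a1 a2; lra.
Qed.

End birkhoff.

(** * Ergodic averages along the walk *)

Section bounded_expectation.
Context d (T : measurableType d) (R : realType) (P : probability T R).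
Implicit Types f g : T -> R.

Definition bmfun f := measurable_fun setT f /\ exists C, forall x, `|f x| <= C.

Definition expect f : R := \int[P]_x f x.

Lemma bmfun_integrable f : bmfun f -> P.-integrable setT (EFin \o f).
Proof.
move=> [mf [C fC]]; apply: measurable_bounded_integrable => //.
  by apply: le_lt_trans (probability_le1 P measurableT) _; exact: ltry.
exists C; split; first exact: num_real.
by move=> x Cx y _; apply: (le_trans (fC y)); exact: ltW.
Qed.

Lemma expectE f : bmfun f -> (\int[P]_x (f x)%:E = (expect f)%:E)%E.
Proof.
by move=> /bmfun_integrable bf; rewrite /expect /Rintegral fineK// integrable_fin_num.
Qed.

Lemma bmfunD f g : bmfun f -> bmfun g -> bmfun (fun x => f x + g x).
Proof.
move=> [mf [C fC]] [mg [D gD]]; split; first exact: measurable_funD.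
by exists (C + D) => x; apply: (le_trans (ler_normD _ _)); exact: lerD.
Qed.

Lemma bmfunM f g : bmfun f -> bmfun g -> bmfun (fun x => f x * g x).
Proof.
move=> [mf [C fC]] [mg [D gD]]; split; first exact: measurable_funM.
by exists (C * D) => x; rewrite normrM; exact: ler_pM.
Qed.

Lemma bmfun_cst (c : R) : bmfun (fun=> c).
Proof. by split; [exact: measurable_cst|exists `|c|]. Qed.

Lemma bmfunB f g : bmfun f -> bmfun g -> bmfun (fun x => f x - g x).
Proof.
move=> bf bg; rewrite (_ : (fun x => _) = (fun x => f x + (-1) * g x)).
  by apply: bmfunD => //; apply: bmfunM => //; exact: bmfun_cst.
by apply/funext => x; rewrite mulN1r.
Qed.

Lemma bmfun_norm f : bmfun f -> bmfun (fun x => `|f x|).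
Proof.
move=> [mf [C fC]]; split; first exact: measurableT_comp.
by exists C => x; rewrite normr_id.
Qed.

Lemma bmfun_sum (I : Type) (r : seq I) (f : I -> T -> R) :
  (forall i, bmfun (f i)) -> bmfun (fun x => \sum_(i <- r) f i x).
Proof.
move=> bf; elim: r => [|i r IH].
  rewrite (_ : (fun x => _) = fun=> 0); first exact: bmfun_cst.
  by apply/funext => x; rewrite big_nil.
rewrite (_ : (fun x => _) = fun x => f i x + \sum_(j <- r) f j x).
  exact: bmfunD.
by apply/funext => x; rewrite big_cons.
Qed.

Lemma expectD f g : bmfun f -> bmfun g ->
  expect (fun x => f x + g x) = expect f + expect g.
Proof. by move=> bf bg; rewrite /expect RintegralD//; exact: bmfun_integrable. Qed.

Lemma expectB f g : bmfun f -> bmfun g ->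
  expect (fun x => f x - g x) = expect f - expect g.
Proof. by move=> bf bg; rewrite /expect RintegralB//; exact: bmfun_integrable. Qed.

Lemma expectZ c f : bmfun f -> expect (fun x => c * f x) = c * expect f.
Proof. by move=> bf; rewrite /expect RintegralZl//; exact: bmfun_integrable. Qed.

Lemma expect_cst (c : R) : expect (fun=> c) = c.
Proof.
rewrite /expect Rintegral_cst// -[RHS]mulr1; congr (c * _).
by rewrite -[RHS]/(fine 1%:E); congr fine; exact: probability_setT.
Qed.

Lemma expect_sum (I : Type) (r : seq I) (f : I -> T -> R) :
  (forall i, bmfun (f i)) ->
  expect (fun x => \sum_(i <- r) f i x) = \sum_(i <- r) expect (f i).
Proof.
move=> bf; elim: r => [|i r IH].
  rewrite big_nil -[RHS]expect_cst; congr expect.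
  by apply/funext => x; rewrite big_nil.
rewrite big_cons -IH -expectD//; last exact: bmfun_sum.
by congr expect; apply/funext => x; rewrite big_cons.
Qed.

Lemma le_expect f g : bmfun f -> bmfun g -> (forall x, f x <= g x) ->
  expect f <= expect g.
Proof. by move=> bf bg fg; apply: le_Rintegral => //; exact: bmfun_integrable. Qed.

Lemma expect_ge0 f : (forall x, 0 <= f x) -> 0 <= expect f.
Proof. by move=> f0; apply: Rintegral_ge0. Qed.

Lemma bmfun_unit f : measurable_fun setT f -> (forall x, 0 <= f x <= 1) -> bmfun f.
Proof.
move=> mf f01; split=> //; exists 1 => x; have /andP[f0 f1] := f01 x.
by rewrite ger0_norm.
Qed.

Lemma expect_ae0 f : bmfun f -> (forall x, 0 <= f x) -> expect f = 0 ->
  {ae P, forall x, f x = 0}.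
Proof.
move=> bf f0 Ef.
have z : (\int[P]_x `|(f x)%:E| = 0)%E.
  rewrite (eq_integral (fun x => (f x)%:E)); first by rewrite expectE// Ef.
  by move=> x _; rewrite abse_EFin ger0_norm.
have mz : measurable_fun setT (fun x => (f x)%:E).
  by apply/measurable_EFinP; case: bf.
have /(ae_eq_integral_abs P measurableT mz) := z.
by apply: filterS => x /(_ Logic.I) [].
Qed.

Lemma expect_cvg (f_ : (T -> R)^nat) f C : (forall n, measurable_fun setT (f_ n)) ->
  bmfun f -> (forall n x, `|f_ n x| <= C) ->
  {ae P, forall x, f_ n x @[n --> \oo] --> f x} ->
  expect (f_ n) @[n --> \oo] --> expect f.
Proof.
move=> mf_ bf fC cf.
have bf_ n : bmfun (f_ n) by split => //; exists C.
have [||||| _ _] := @dominated_convergence _ _ _ P setT measurableT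
  (fun n x => (f_ n x)%:E) (fun x => (f x)%:E) (fun=> C%:E).
- by move=> n; apply/measurable_EFinP.
- by apply/measurable_EFinP; case: bf.
- by apply: filterS cf => x cx _; apply: cvg_EFin => //; exact: nearW.
- by apply: (bmfun_integrable (f := fun=> C)); exact: bmfun_cst.
- by apply: aeW => x n _; rewrite abse_EFin lee_fin.
rewrite expectE// => /fine_cvg.
apply: cvg_trans; apply: near_eq_cvg; apply: nearW => n /=.
by rewrite expectE.
Qed.

End bounded_expectation.

Section positions.
Variables (R : realType) (M : completeMetricType R).
Implicit Types k n : nat.

Definition at_ k : Trajectory M -> Gstar M := pull (fun _ : 'I_1 => k).
Definition lastc k : netclass M 'I_k.+1 -> netclass M 'I_1 := pull (fun=> ord_max).
Definition firstc k : netclass M 'I_k.+1 -> netclass M 'I_1 := pull (fun=> ord0).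

Lemma at_lastc k t : at_ k t = lastc (segment k t).
Proof. by rewrite /lastc segmentE pull_comp. Qed.

Lemma at0_firstc k t : at_ 0 t = firstc (segment k t).
Proof. by rewrite /firstc segmentE pull_comp. Qed.

Lemma measurable_at k : measurable_fun setT (at_ k).
Proof.
rewrite (_ : at_ k = @lastc k \o segment k); last first.
  by apply/funext => t /=; rewrite -at_lastc.
apply: (measurableT_comp (measurable_pull _)); exact: measurable_segment.
Qed.

Lemma at_shift k t : at_ k (shift t) = at_ k.+1 t.
Proof. by rewrite /at_ /shift pull_comp. Qed.

Lemma at_iter_shift k j t : at_ k (iter j (@shift R M) t) = at_ (k + j) t.
Proof.
elim: j k => [|j IH] k; first by rewrite addn0.
by rewrite iterS at_shift IH addSnnS.
Qed.

Lemma lastc_addr k (N : rnet M 'I_k) x :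
  lastc (cls (addr (N := N) x)) = cls (reroot (fun=> x)).
Proof.
rewrite /lastc pullE; congr (cls (reroot _)); apply/funext => i.
exact: root_addr_max.
Qed.

Lemma firstc_addr k (N : rnet M 'I_k.+1) x :
  firstc (cls (addr (N := N) x)) = firstc (cls N).
Proof.
rewrite /firstc !pullE; congr (cls (reroot _)); apply/funext => i /=.
by rewrite (_ : ord0 = lift ord_max ord0) ?liftK//; apply: val_inj.
Qed.

Lemma cls_root1 (N : rnet M 'I_1) (i : 'I_1) : cls N = cls (reroot (fun _ : 'I_1 => root N i)).
Proof.
case: N => N o c l /=; congr cls; rewrite /reroot /=.
suff -> : (fun=> o i) = o by [].
by apply/funext => j; rewrite [j]ord1 [i]ord1.
Qed.

Lemma firstc1 (g : netclass M 'I_1) : firstc g = g.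
Proof. by rewrite /firstc -(cls_rep g) pullE [RHS](cls_root1 _ ord0). Qed.

Lemma lastc1 (g : netclass M 'I_1) : lastc g = g.
Proof. by rewrite /lastc -(cls_rep g) pullE [RHS](cls_root1 _ ord_max). Qed.

Lemma step_prob_sum (N : network M) (x : vert N) : locally_finite N ->
  (\esum_(y in setT) (step_prob x y : R)%:E <= 1%:E)%E.
Proof.
move=> lf.
have -> : \esum_(y in setT) (step_prob x y : R)%:E =
    (((deg x)%:R^-1)%:E * \esum_(y in setT) (cnt x y)%:R%:E)%E.
  rewrite -esumZl ?invr_ge0//.
  by apply: eq_esum => y _; rewrite -EFinM mulrC.
rewrite esum_cnt// -EFinM lee_fin.
have [->|d0] := eqVneq (deg x) 0%N; first by rewrite mulr0.
by rewrite mulVf// pnatr_eq0.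
Qed.

Lemma step_op_lastc k (f : netclass M 'I_1 -> \bar R) (g : netclass M 'I_k.+1) :
  step_op (fun h => f (lastc h)) g = step_op (fun h => f (lastc h)) (lastc g).
Proof.
rewrite -{1}(cls_rep g) [lastc g]/lastc /pull !step_opE.
by apply: eq_esum => x _; rewrite !lastc_addr.
Qed.

Lemma step_op_le_cst k (F : netclass M 'I_k.+2 -> \bar R) (C : R) g : (0 <= C)%R ->
  (forall h, F h <= C%:E)%E -> (step_op F g <= C%:E)%E.
Proof.
move=> C0 FC; rewrite -(cls_rep g) step_opE.
apply: (@le_trans _ _ (C%:E * \esum_(x in [set: vert (rep g)])
    (step_prob (root (rep g) ord_max) x : R)%:E)%E).
  rewrite -esumZl//; last by move=> x; rewrite lee_fin step_prob_ge0.
  apply: le_esum => x _; rewrite [leRHS]muleC; apply: lee_wpmul2l => //.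
  by rewrite lee_fin step_prob_ge0.
rewrite -[leRHS]mule1; apply: lee_wpmul2l => //.
exact/step_prob_sum/net_locfin.
Qed.

(* Junk outside bounded nonnegative [f], where the sum could be infinite. *)
Definition avg_op (f : Gstar M -> R) (g : Gstar M) : R :=
  fine (step_op (k := 0) (fun h => (f (lastc h))%:E) g).

Lemma avg_opE (f : Gstar M -> R) C g : (forall g, 0 <= f g <= C) ->
  ((avg_op f g)%:E = step_op (k := 0) (fun h => (f (lastc h))%:E) g)%E.
Proof.
move=> f01; have f0 h : (0 <= f h) by have /andP[] := f01 h.
have f1 h : (f h <= C) by have /andP[] := f01 h.
have C0 : 0 <= C by exact: le_trans (f0 g) (f1 g).
rewrite /avg_op fineK// ge0_fin_numE; last first.
  by apply: step_op_ge0 => h; rewrite lee_fin.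
apply: (@le_lt_trans _ _ C%:E); last exact: ltry.
by apply: step_op_le_cst => // h; rewrite lee_fin.
Qed.

Lemma avg_op_bound (f : Gstar M -> R) C g : (forall g, 0 <= f g <= C) ->
  0 <= avg_op f g <= C.
Proof.
move=> f01; have f0 h : (0 <= f h) by have /andP[] := f01 h.
have f1 h : (f h <= C) by have /andP[] := f01 h.
have C0 : 0 <= C by exact: le_trans (f0 g) (f1 g).
rewrite -!lee_fin (avg_opE g f01) step_op_ge0/=; last by move=> h; rewrite lee_fin.
by apply: step_op_le_cst => // h; rewrite lee_fin.
Qed.

Lemma measurable_avg_op (f : Gstar M -> R) : measurable_fun setT f ->
  (forall g, 0 <= f g) -> measurable_fun setT (avg_op f).
Proof.
move=> mf f0; apply: measurableT_comp; first exact: (@fine_measurable R setT measurableT).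
apply: measurable_step_op => [|h]; last by rewrite lee_fin.
by apply/measurable_EFinP; apply: (measurableT_comp mf (measurable_pull _)).
Qed.

Lemma avg_op_avg (F : nat -> Gstar M -> R) n g : (forall k g, 0 <= F k g <= 1) ->
  avg_op (fun g => (\sum_(k < n) F k g) / n%:R) g =
  (\sum_(k < n) avg_op (F k) g) / n%:R.
Proof.
move=> F01; have F0 k h : 0 <= F k h by have /andP[] := F01 k h.
have F1 k h : F k h <= 1 by have /andP[] := F01 k h.
have n0 : 0 <= n%:R^-1 :> R by rewrite invr_ge0.
apply: EFin_inj; rewrite (avg_opE (C := 1)); last first.
  move=> h; rewrite divr_ge0 ?sumr_ge0//=.
  have [->|] := eqVneq n 0%N; first by rewrite invr0 mulr0.
  rewrite -lt0n => n0'; rewrite ler_pdivrMr ?ltr0n// mul1r.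
  rewrite (_ : n%:R = \sum_(k < n) 1); first exact: ler_sum.
  by rewrite sumr_const card_ord.
under eq_fun do rewrite mulrC EFinM.
rewrite step_opZ//; last by move=> h; rewrite lee_fin sumr_ge0.
rewrite mulrC EFinM -sumEFin; congr (_ * _)%E.
rewrite /step_op /vsum.
rewrite (eq_esum (b := fun x => \sum_(k < n) ((stepc (cls (addr x)))%:E *
  (F k (lastc (cls (addr x))))%:E))%E); last first.
  by move=> x _; rewrite -sumEFin ge0_sume_distrr// => k _; rewrite lee_fin.
rewrite esum_sum; last by move=> *; apply: mule_ge0; rewrite lee_fin ?stepc_ge0.
by apply: eq_bigr => k _; rewrite (avg_opE _ (F01 k)).
Qed.

Section law.
Variables (mu : probability (Gstar M) R) (P : probability (Trajectory M) R).
Hypothesis mu_uni : unimodular mu.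
Hypothesis muP : walk_law mu P.

(** The Markov property: averaging over the last step replaces [f] by [avg_op f] and leaves one step
    less. *)
Lemma expectation_at (f : Gstar M -> R) (k : nat) (G : Gstar M -> \bar R) :
  measurable_fun setT f -> (forall g, 0 <= f g <= 1) ->
  measurable_fun setT G -> (forall g, 0 <= G g)%E ->
  (\int[P]_t ((f (at_ k t))%:E * G (at_ 0 t)) =
   \int[P]_t ((iter k avg_op f (at_ 0 t))%:E * G (at_ 0 t)))%E.
Proof.
move=> mf f01.
have it k' : measurable_fun setT (iter k' avg_op f) /\
    forall g, 0 <= iter k' avg_op f g <= 1.
  elim: k' => [//|k' [IH1 IH2]] /=; split.
    by apply: measurable_avg_op => // g; have /andP[] := IH2 g.
  by move=> g; apply: avg_op_bound.
have mat k' : measurable_fun setT (fun t => (f (at_ k' t))%:E).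
  by apply/measurable_EFinP; apply: (measurableT_comp mf (measurable_at k')).
have mit k' : measurable_fun setT (fun t => (iter k' avg_op f (at_ 0 t))%:E).
  by apply/measurable_EFinP; apply: (measurableT_comp (it k').1 (measurable_at 0)).
have f0 g : (0 <= (f g)%:E)%E by rewrite lee_fin; have /andP[] := f01 g.
have it0 k' g : (0 <= (iter k' avg_op f g)%:E)%E.
  by rewrite lee_fin; have /andP[] := (it k').2 g.
move: G; apply: nonneg_ind.
- move=> A mA; move: {it it0 mit mat} f mf f01 f0; elim: k => [//|k IH] f mf f01 f0.
  rewrite iterSr -IH//; last 3 first.
  - by apply: measurable_avg_op => // g; rewrite -lee_fin.
  - by move=> g; exact: avg_op_bound.
  - by move=> g; rewrite lee_fin; have /andP[] := avg_op_bound g f01.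
  have ind0 k' (h : netclass M 'I_k'.+1) : (0 <= (\1_A (firstc h) : R)%:E)%E by rewrite lee_fin.
  transitivity (\int[P]_t (fun h => (f (lastc h))%:E * (\1_A (firstc h))%:E) (segment k.+1 t))%E.
    by apply: eq_integral => t _ /=; rewrite at_lastc (at0_firstc k.+1).
  rewrite (expectation_step muP (F := fun h => (f (lastc h))%:E * (\1_A (firstc h))%:E)%E); last 2 first.
  - apply: emeasurable_funM.
      by apply/measurable_EFinP; apply: (measurableT_comp mf (measurable_pull _)).
    by apply/measurable_EFinP; apply: (measurableT_comp (measurable_indic mA) (measurable_pull _)).
  - by move=> h; rewrite mule_ge0.
  apply: eq_integral => t _; rewrite at_lastc (at0_firstc k).
  move: (segment k t) => g; rewrite (avg_opE _ f01) -(step_op_lastc (fun g => (f g)%:E)).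
  rewrite -(cls_rep g) !step_opE muleC -esumZl ?ler0n//; last first.
    by move=> x; rewrite mule_ge0// lee_fin step_prob_ge0.
  apply: eq_esum => x _; rewrite firstc_addr muleA muleC; congr (_ * _)%E.
- move=> c G c0 mG G0 IH.
  under eq_integral do rewrite muleCA.
  under [RHS]eq_integral do rewrite muleCA.
  rewrite !ge0_integralZl_EFin ?IH//.
  + by move=> t _; rewrite mule_ge0.
  + by apply: emeasurable_funM => //; apply: (measurableT_comp mG (measurable_at 0)).
  + by move=> t _; rewrite mule_ge0.
  + by apply: emeasurable_funM => //; apply: (measurableT_comp mG (measurable_at 0)).
- move=> G mG G0 IH.
  under eq_integral => t _ do rewrite -nneseriesZl//.
  under [RHS]eq_integral => t _ do rewrite -nneseriesZl//.
  rewrite integral_nneseries; last 3 first.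
  + exact: measurableT.
  + by move=> i; apply: emeasurable_funM => //; apply: (measurableT_comp (mG i) (measurable_at 0)).
  + by move=> i t _; rewrite mule_ge0.
  rewrite integral_nneseries; last 3 first.
  + exact: measurableT.
  + by move=> i; apply: emeasurable_funM => //; apply: (measurableT_comp (mG i) (measurable_at 0)).
  + by move=> i t _; rewrite mule_ge0.
  by apply: eq_eseriesr => i _; exact: IH.
Qed.

End law.
End positions.

(** * Cesaro means of the kernel's iterates and their energy *)

Section averages.
Variables (R : realType) (M : completeMetricType R).
Variables (mu : probability (Gstar M) R) (P : probability (Trajectory M) R).
Hypothesis mu_uni : unimodular mu.
Hypothesis muP : walk_law mu P.
Variable f : Gstar M -> R.
Hypothesis mf : measurable_fun setT f.
Hypothesis f01 : forall g, 0 <= f g <= 1.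
Implicit Types k n : nat.

Lemma iter_avg01 k g : 0 <= iter k (@avg_op R M) f g <= 1.
Proof. by elim: k g => [|k IH] g //=; exact: avg_op_bound. Qed.

Lemma measurable_iter_avg k : measurable_fun setT (iter k (@avg_op R M) f).
Proof.
elim: k => [//|k IH] /=; apply: measurable_avg_op => // g.
by have /andP[] := iter_avg01 k g.
Qed.

Definition uavg n g := (\sum_(k < n) iter k (@avg_op R M) f g) / n%:R.

Lemma uavg01 n g : 0 <= uavg n g <= 1.
Proof.
rewrite /uavg divr_ge0 ?sumr_ge0//=; last first.
  by move=> k _; have /andP[] := iter_avg01 k g.
have [->|] := eqVneq n 0%N; first by rewrite invr0 mulr0.
rewrite -lt0n => n0; rewrite ler_pdivrMr ?ltr0n// mul1r.
rewrite (_ : n%:R = \sum_(k < n) 1); last by rewrite sumr_const card_ord.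
by apply: ler_sum => k _; have /andP[] := iter_avg01 k g.
Qed.

Lemma measurable_uavg n : measurable_fun setT (uavg n).
Proof.
apply: measurable_funM => //; apply: measurable_sum => k.
exact: measurable_iter_avg.
Qed.

Lemma bmfun_at (h : Gstar M -> R) k : measurable_fun setT h ->
  (forall g, 0 <= h g <= 1) -> bmfun (fun t => h (at_ k t)).
Proof.
move=> mh h01; apply: bmfun_unit => //.
exact: (measurableT_comp mh (measurable_at k)).
Qed.

Lemma expect_shift (g : Trajectory M -> R) : measurable_fun setT g ->
  (forall t, 0 <= g t) -> expect P (g \o @shift R M) = expect P g.
Proof.
move=> mg g0; rewrite /expect /Rintegral; congr fine.
apply: (expectation_shift mu_uni muP (f := fun t => (g t)%:E)) => //.
exact/measurable_EFinP.
Qed.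

Lemma bavg_at n t : bavg (@shift R M) (f \o at_ 0) n t = (\sum_(k < n) f (at_ k t)) / n%:R.
Proof.
by rewrite /bavg /bsum; congr (_ / _); apply: eq_bigr => k _ /=; rewrite at_iter_shift.
Qed.

(** Against functions of the root, a time average along the walk can be traded for a function of the
    root, to which mass transport applies. *)
Lemma expectation_uavg n (G : Gstar M -> \bar R) :
  measurable_fun setT G -> (forall g, 0 <= G g)%E ->
  (\int[P]_t ((bavg (@shift R M) (f \o at_ 0) n t)%:E * G (at_ 0 t)) =
   \int[P]_t ((uavg n (at_ 0 t))%:E * G (at_ 0 t)))%E.
Proof.
move=> mG G0.
have mGa : measurable_fun setT (G \o at_ 0) by exact: (measurableT_comp mG (measurable_at 0)).
have key (F : nat -> Trajectory M -> R) : (forall k, measurable_fun setT (F k)) ->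
    (forall k t, 0 <= F k t) ->
    (\int[P]_t (((\sum_(k < n) F k t) / n%:R)%:E * G (at_ 0 t)) =
    (n%:R^-1)%:E * \sum_(k < n) \int[P]_t ((F k t)%:E * G (at_ 0 t)))%E.
  move=> mF F0; rewrite -ge0_integral_sum//; last 2 first.
  - by move=> k; apply: emeasurable_funM => //; apply/measurable_EFinP.
  - by move=> k t _; rewrite mule_ge0// lee_fin.
  rewrite -ge0_integralZl_EFin// ?invr_ge0//; last 2 first.
  - by move=> t _; apply: sume_ge0 => k _; rewrite mule_ge0// lee_fin.
  - by apply: emeasurable_sum => k; apply: emeasurable_funM => //; apply/measurable_EFinP.
  apply: eq_integral => t _; rewrite mulrC EFinM -muleA; congr (_ * _)%E.
  by rewrite -sumEFin ge0_sume_distrl// => k _; rewrite lee_fin.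
under eq_integral do rewrite bavg_at.
rewrite (key (fun k t => f (at_ k t))); last 2 first.
- by move=> k; exact: (measurableT_comp mf (measurable_at k)).
- by move=> k t; have /andP[] := f01 (at_ k t).
rewrite (key (fun k t => iter k (@avg_op R M) f (at_ 0 t))); last 2 first.
- by move=> k; exact: (measurableT_comp (measurable_iter_avg k) (measurable_at 0)).
- by move=> k t; have /andP[] := iter_avg01 k (at_ 0 t).
by congr (_ * _)%E; apply: eq_bigr => k _; rewrite (expectation_at muP).
Qed.

(** The kernel shifts the sum of iterates by one index, so only the two end terms differ, and they
    lie between 0 and 1. *)
Lemma uavg_avg_op n g : (0 < n)%N -> uavg n g <= avg_op (uavg n) g + n%:R^-1.
Proof.
move=> n0; rewrite (avg_op_avg _ _ (F := fun k => iter k (@avg_op R M) f)); last first.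
  exact: iter_avg01.
rewrite -[X in _ + X]mul1r -mulrDl ler_wpM2r ?invr_ge0//.
case: n n0 => // n _; rewrite big_ord_recl big_ord_recr/=.
have /andP[_ f1] := f01 g; have /andP[/= a0 a1] := iter_avg01 n.+1 g.
rewrite -[X in _ + X <= _]/(\sum_(i < n) avg_op (iter i (@avg_op R M) f) g).
move: (\sum_(i < n) _) => S; lra.
Qed.

(** By stationarity the mean square equals twice the expectation of
    [u(w_0) * (u(w_0) - (avg_op u)(w_0))], which [uavg_avg_op] bounds. *)
Lemma uavg_energy n : (0 < n)%N ->
  expect P (fun t => (uavg n (at_ 1 t) - uavg n (at_ 0 t)) ^+ 2) <= 2 / n%:R.
Proof.
move=> n0; set u := uavg n.
have mu_ : measurable_fun setT u by exact: measurable_uavg.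
have u01 g : 0 <= u g <= 1 by exact: uavg01.
have b k : bmfun (fun t => u (at_ k t)) by exact: bmfun_at.
have bb k j : bmfun (fun t => u (at_ k t) * u (at_ j t)) by exact: bmfunM.
have Pu01 g : 0 <= avg_op u g <= 1 by exact: avg_op_bound.
have mPu : measurable_fun setT (avg_op u).
  by apply: measurable_avg_op => // g; have /andP[] := u01 g.
have bP : bmfun (fun t => avg_op u (at_ 0 t)) by exact: bmfun_at.
have u0 g : 0 <= u g by have /andP[] := u01 g.
have E11 : expect P (fun t => u (at_ 1 t) * u (at_ 1 t)) =
    expect P (fun t => u (at_ 0 t) * u (at_ 0 t)).
  rewrite -[RHS](expect_shift (g := fun t => u (at_ 0 t) * u (at_ 0 t))).
  - by congr expect; apply/funext => t /=; rewrite at_shift.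
  - exact: (bb 0%N 0%N).1.
  - by move=> t; rewrite mulr_ge0.
have E10 : expect P (fun t => u (at_ 1 t) * u (at_ 0 t)) =
    expect P (fun t => avg_op u (at_ 0 t) * u (at_ 0 t)).
  rewrite /expect /Rintegral; congr fine.
  have mG : measurable_fun setT (fun g => (u g)%:E) by exact/measurable_EFinP.
  have G0 g : (0 <= (u g)%:E)%E by rewrite lee_fin.
  exact: (expectation_at muP 1 mu_ u01 mG G0).
have E00 : expect P (fun t => u (at_ 0 t) * u (at_ 0 t)) <=
    expect P (fun t => avg_op u (at_ 0 t) * u (at_ 0 t)) + n%:R^-1.
  rewrite -[X in _ <= _ + X](expect_cst P) -expectD//; last 2 first.
  - exact: bmfunM.
  - exact: bmfun_cst.
  apply: le_expect => //.
  - by apply: bmfunD; [exact: bmfunM|exact: bmfun_cst].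
  move=> t; have := uavg_avg_op (at_ 0 t) n0; rewrite -/u.
  have /andP[a0 a1] := u01 (at_ 0 t).
  have n1 : 0 <= n%:R^-1 :> R by rewrite invr_ge0.
  nra.
rewrite (_ : (fun t => _) = fun t =>
  u (at_ 1 t) * u (at_ 1 t) + u (at_ 0 t) * u (at_ 0 t) -
  2 * (u (at_ 1 t) * u (at_ 0 t))); last by apply/funext => t; ring.
rewrite expectB ?expectD ?expectZ//; last 2 first.
- exact: bmfunD.
- by apply: bmfunM => //; exact: bmfun_cst.
rewrite E11 E10; move: E00; set a := expect P _; set c := expect P _; lra.
Qed.

Lemma expect_osc n j :
  expect P (fun t => `|uavg n (at_ j t) - uavg n (at_ 0 t)|) <=
  j%:R * expect P (fun t => `|uavg n (at_ 1 t) - uavg n (at_ 0 t)|).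
Proof.
have b k : bmfun (fun t => uavg n (at_ k t)).
  by apply: bmfun_at; [exact: measurable_uavg|exact: uavg01].
have bd k i : bmfun (fun t => `|uavg n (at_ k t) - uavg n (at_ i t)|).
  by apply/bmfun_norm/bmfunB.
elim: j => [|j IH].
  rewrite mul0r -[leRHS](expect_cst P) le_expect//; first exact: bmfun_cst.
  by move=> t; rewrite subrr normr0.
have Ej i : expect P (fun t => `|uavg n (at_ i.+1 t) - uavg n (at_ i t)|) =
    expect P (fun t => `|uavg n (at_ 1 t) - uavg n (at_ 0 t)|).
  elim: i => [//|i IHi]; rewrite -IHi.
  rewrite -[RHS](expect_shift (g := fun t => `|uavg n (at_ i.+1 t) - uavg n (at_ i t)|)).
  - by congr expect; apply/funext => t /=; rewrite !at_shift.
  - exact: (bd _ _).1.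
  - by move=> t; exact: normr_ge0.
rewrite -natr1 mulrDl mul1r -[X in _ <= _ + X](Ej j).
apply: le_trans (lerD IH (lexx _)); rewrite -expectD//.
apply: le_expect => //; first exact: bmfunD.
move=> t; rewrite [leRHS]addrC; apply: le_trans (ler_normD _ _).
by rewrite addrA subrK.
Qed.

Lemma expect_osc_cvg j e : 0 < e -> exists N, forall n, (N <= n)%N ->
  expect P (fun t => `|uavg n (at_ j t) - uavg n (at_ 0 t)|) <= e.
Proof.
move=> e0; pose c : R := j.+1%:R; have c0 : 0 < c by rewrite ltr0n.
have [h h0 hE] : exists2 h, 0 < h & h = e / c by exists (e / c) => //; rewrite divr_gt0.
(* Then the energy bound [2 / n] is at most [h^2]; the choice [h = e / (j + 1)] allows for [j]
   steps. *)
exists (Num.truncn (2 / (h * h))).+1 => n nN.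
have n0 : (0 < n)%N by exact: leq_ltn_trans nN.
have b k : bmfun (fun t => uavg n (at_ k t)).
  by apply: bmfun_at; [exact: measurable_uavg|exact: uavg01].
have bd : bmfun (fun t => `|uavg n (at_ 1 t) - uavg n (at_ 0 t)|).
  by apply/bmfun_norm/bmfunB.
have bs : bmfun (fun t => (uavg n (at_ 1 t) - uavg n (at_ 0 t)) ^+ 2).
  by apply: bmfunM; exact: bmfunB.
have n1 : 2 / n%:R <= h * h.
  rewrite ler_pdivrMr ?ltr0n// mulrC -ler_pdivrMr ?mulr_gt0//.
  by apply: le_trans (ltW (truncnS_gt _)) _; rewrite ler_nat.
have E1 : expect P (fun t => `|uavg n (at_ 1 t) - uavg n (at_ 0 t)|) <= h.
  (* The pointwise bound [|y| <= h / 2 + y^2 / (2 h)] passes from the mean square to the mean. *)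
  apply: (@le_trans _ _ (h / 2 + (2 * h)^-1 * (2 / n%:R))).
    apply: (@le_trans _ _ (h / 2 + (2 * h)^-1 *
       expect P (fun t => (uavg n (at_ 1 t) - uavg n (at_ 0 t)) ^+ 2))).
      rewrite -expectZ// -{1}[h / 2](expect_cst P) -expectD//; last 2 first.
      - exact: bmfun_cst.
      - by apply: bmfunM => //; exact: bmfun_cst.
      apply: le_expect => //.
        apply: bmfunD; first exact: bmfun_cst.
        by apply: bmfunM => //; exact: bmfun_cst.
      move=> t; set y := _ - _.
      have -> : h / 2 + (2 * h)^-1 * y ^+ 2 = (h ^+ 2 + `|y| ^+ 2) / (2 * h).
        by rewrite real_normK ?num_real//; field; rewrite gt_eqF.
      rewrite ler_pdivlMr ?mulr_gt0//.
      have := sqr_ge0 (`|y| - h); lra.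
    by rewrite lerD2l ler_wpM2l ?uavg_energy// invr_ge0 ltW// mulr_gt0.
  rewrite -lerBrDl mulrC ler_pdivrMr ?mulr_gt0//; apply: (le_trans n1).
  by rewrite le_eqVlt; apply/orP; left; apply/eqP; field.
apply: (le_trans (expect_osc n j)); apply: (@le_trans _ _ (j%:R * h)).
  by rewrite ler_wpM2l.
rewrite hE mulrCA ger_pMr// ler_pdivrMr// mul1r /c ler_nat.
exact: leqnSn.
Qed.

End averages.

(** * Pairs of vertices and transition probabilities of several steps *)

Section pair_classes.
Variables (M : Type).

Definition pair_cls (I : Type) (N : rnet M I) (x y : vert N) : netclass M 'I_2 :=
  cls (reroot (tnth [tuple x; y])).

Definition swap : netclass M 'I_2 -> netclass M 'I_2 := pull (@rev_ord 2).

Lemma swap_pair (I : Type) (N : rnet M I) (x y : vert N) :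
  swap (pair_cls x y) = pair_cls y x.
Proof.
rewrite /swap pullE; congr (cls (reroot _)); apply/funext => -[[|[|//]] i] /=.
  by rewrite !(tnth_nth x).
by rewrite !(tnth_nth x).
Qed.

Lemma cls_addr_pair (I : Type) (N : rnet M I) (x y : vert N) :
  cls (addr (N := reroot (fun _ : 'I_1 => x)) y) = pair_cls x y.
Proof.
congr (cls (reroot _)); apply/funext => i /=.
case: unliftP => [j ->|->] /=; rewrite (tnth_nth x) /=.
  by rewrite [j]ord1.
by [].
Qed.

Lemma pair_cls_surj (g : netclass M 'I_2) :
  exists (N : rnet M 'I_2) (x y : vert N), g = pair_cls x y.
Proof.
exists (rep g), (root (rep g) ord0), (root (rep g) ord_max).
rewrite -{1}(cls_rep g) /pair_cls; move: (rep g) => -[N o c l] /=.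
congr cls; rewrite /reroot /=; set o' := tnth _.
suff -> : o = o' by [].
apply/funext => -[[|[|//]] i]; rewrite /o' (tnth_nth (o ord0)) /=;
  congr o; exact: val_inj.
Qed.

Lemma swapK : involutive swap.
Proof.
by move=> g; have [N [x [y ->]]] := pair_cls_surj g; rewrite !swap_pair.
Qed.

Definition pull_pair k (i j : 'I_k) : netclass M 'I_k -> netclass M 'I_2 :=
  pull (fun l : 'I_2 => if l == ord0 then i else j).

Lemma pull_pairE k (i j : 'I_k) (N : rnet M 'I_k) :
  pull_pair i j (cls N) = pair_cls (root N i) (root N j).
Proof.
rewrite /pull_pair pullE; congr (cls (reroot _)); apply/funext => -[[|[|//]] l] /=.
  by rewrite (tnth_nth (root N i)).
by rewrite (tnth_nth (root N i)).
Qed.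

End pair_classes.

Section transition.
Variables (R : realType) (M : completeMetricType R).
Local Open Scope ereal_scope.

Let i0 : 'I_3 := ord0.
Let i1 : 'I_3 := lift ord0 ord0.
Let i2 : 'I_3 := ord_max.

Lemma vsum_pair (I : Type) (F : netclass M 'I_2 -> \bar R) (N : rnet M I) (x : vert N) :
  vsum F (cls (reroot (fun _ : 'I_1 => x))) = \esum_(y in [set: vert N]) F (pair_cls x y).
Proof. by rewrite vsumE; apply: eq_esum => y _; rewrite cls_addr_pair. Qed.

Lemma vsum_triple (I : Type) (F : netclass M 'I_2 -> netclass M 'I_2 -> netclass M 'I_2 -> \bar R)
    (N : rnet M I) (x y : vert N) :
  vsum (fun h => F (pull_pair i0 i1 h) (pull_pair i0 i2 h) (pull_pair i1 i2 h)) (pair_cls x y) =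
  \esum_(z in [set: vert N]) F (pair_cls x y) (pair_cls x z) (pair_cls y z).
Proof.
rewrite vsumE; apply: eq_esum => z _; rewrite !pull_pairE.
have -> : i1 = lift ord_max ord_max by apply: val_inj.
have -> : i0 = lift ord_max ord0 by apply: val_inj.
by rewrite /= !liftK unlift_none /= !(tnth_nth x).
Qed.

Lemma stepc_pair (I : Type) (N : rnet M I) (x y : vert N) :
  stepc (pair_cls x y) = step_prob x y :> R.
Proof.
by rewrite -cls_addr_pair stepcE.
Qed.

(* [trans j (G, x, y)] is the probability that the walk from [x] is at [y] after [j] steps. *)
Fixpoint trans j : netclass M 'I_2 -> \bar R :=
  if j is j'.+1 then
    vsum (fun h => trans j' (pull_pair i0 i2 h) * (stepc (swap (pull_pair i1 i2 h)))%:E)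
  else fun h => if distc ord0 ord_max h == 0%N then 1%:E else 0.

Lemma trans_ge0 j h : 0 <= trans j h.
Proof.
elim: j h => [|j IH] h /=; first by case: ifP.
by apply: vsum_ge0 => h3; rewrite mule_ge0// lee_fin stepc_ge0.
Qed.

Lemma measurable_trans j : measurable_fun setT (trans j : Gspace M 2 -> \bar R).
Proof.
elim: j => [|j IH] /=.
  exact: (measurable_locally_determined (fun n : nat => if n == 0%N then 1%:E else 0 : \bar R)
    (@distc_determined R M 2 ord0 ord_max)).
apply: measurable_vsum => [|h]; last by rewrite mule_ge0 ?trans_ge0// lee_fin stepc_ge0.
apply: emeasurable_funM; first exact: (measurableT_comp IH (measurable_pull _)).
apply/measurable_EFinP.
apply: (measurableT_comp (@measurable_stepc R M 0)).
exact: (measurableT_comp (measurable_pull _) (measurable_pull _)).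
Qed.

Lemma trans_pairS j (I : Type) (N : rnet M I) (x y : vert N) :
  trans j.+1 (pair_cls x y) =
  \esum_(z in [set: vert N]) (trans j (pair_cls x z) * (step_prob z y)%:E).
Proof.
rewrite /= (vsum_triple (fun _ b c => trans j b * (stepc (swap c))%:E)).
by apply: eq_esum => z _; rewrite swap_pair stepc_pair.
Qed.

Lemma dist0 (N : network M) (x y : vert N) : connected_net N ->
  (dist x y == 0%N) = (x == y).
Proof.
move=> cN; have [w min] := distP x y cN; apply/eqP/eqP => [d0|->].
  by move: w; rewrite d0.
by apply/eqP; rewrite -leqn0; exact: (distP y y cN).2 0%N erefl.
Qed.

Lemma trans_pair0 (I : Type) (N : rnet M I) (x y : vert N) :
  trans 0 (pair_cls x y) = if x == y then 1%:E else 0.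
Proof.
rewrite /= distcE /= !(tnth_nth x) /= dist0//; exact: net_connected.
Qed.

(** Moving the last step from the transition probability into the test function ([G1] below) reduces
    [j + 1] steps to [j]. The lemma lets a sum over vertices be read as an expectation along the
    walk. *)
Lemma trans_walk_op j (I : Type) (N : rnet M I) (x : vert N)
    (G : netclass M 'I_2 -> \bar R) : (forall h, 0 <= G h) ->
  \esum_(y in [set: vert N]) (trans j (pair_cls x y) * G (pair_cls x y)) =
  walk_op (n := j) (fun h => G (pull_pair ord0 ord_max h)) (cls (reroot (fun _ : 'I_1 => x))).
Proof.
elim: j G => [|j IH] G G0.
  rewrite [RHS]/= pull_pairE.
  rewrite (eq_esum (b := fun y => if y \in [set x] then G (pair_cls x y) else 0)).
    by rewrite -esum_mkcond esum_set1.
  move=> y _; rewrite trans_pair0; case: eqP => [<-|nxy].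
    by rewrite mem_set// mul1e.
  by rewrite memNset ?mul0e// => /= yx; apply: nxy.
pose G1 := vsum (fun h => (stepc (pull_pair i1 i2 h))%:E * G (pull_pair i0 i2 h)).
have G1E (J : Type) (L : rnet M J) (a b : vert L) : G1 (pair_cls a b) =
    \esum_(y in [set: vert L]) ((step_prob b y)%:E * G (pair_cls a y)).
  rewrite /G1 (vsum_triple (fun _ b c => (stepc c)%:E * G b)).
  by apply: eq_esum => z _; rewrite stepc_pair.
have G10 h : 0 <= G1 h.
  by apply: vsum_ge0 => h3; rewrite mule_ge0// lee_fin stepc_ge0.
transitivity (walk_op (n := j) (fun h => G1 (pull_pair ord0 ord_max h))
    (cls (reroot (fun _ : 'I_1 => x)))); last first.
  rewrite /=; congr (walk_op _ _); apply/funext => h.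
  rewrite -(cls_rep h) step_opE pull_pairE G1E; apply: eq_esum => z _.
  rewrite pull_pairE root_addr_max (_ : ord0 = lift ord_max ord0) ?root_addr_lift//.
  exact: val_inj.
rewrite -IH//.
have stepG0 (y z : vert N) : 0 <= (step_prob y z : R)%:E * G (pair_cls x z).
  by rewrite mule_ge0// lee_fin step_prob_ge0.
transitivity (\esum_(y in [set: vert N]) \esum_(z in [set: vert N])
   (trans j (pair_cls x z) * ((step_prob z y)%:E * G (pair_cls x y)))).
  apply: eq_esum => y _; rewrite trans_pairS muleC -ge0_esumZl//; last first.
    by move=> z; rewrite mule_ge0 ?trans_ge0// lee_fin step_prob_ge0.
  by apply: eq_esum => z _; rewrite muleC muleA.
rewrite esum_swap; last by move=> y z; rewrite mule_ge0 ?trans_ge0.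
apply: eq_esum => z _; rewrite G1E -ge0_esumZl// trans_ge0//.
Qed.

Lemma trans_gt0 j (I : Type) (N : rnet M I) (x y : vert N) :
  walk j x y -> 0 < trans j (pair_cls x y).
Proof.
elim: j y => [|j IH] y.
  by move=> xy; rewrite trans_pair0 xy eqxx lte_fin.
have snoc n (a b : vert N) : walk n.+1 a b ->
    exists z, walk n a z /\ exists d, src d = z /\ tgt d = b.
  elim: n a => [|n IHn] a /= [d da wd].
    by exists a; split=> //; exists d.
  by have [z [wz dz]] := IHn _ wd; exists z; split=> //; exists d.
move=> /snoc[z [wz [d [dz dy]]]].
rewrite trans_pairS; apply: (@lt_le_trans _ _ (trans j (pair_cls x z) * (step_prob z y)%:E)).
  rewrite mule_gt0 ?IH// lte_fin divr_gt0// ltr0n.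
    rewrite cardfs_gt0; apply/fset0Pn; exists d; rewrite in_fset_set ?inE//.
    by apply: sub_finite_set (net_locfin N z) => e [].
  rewrite cardfs_gt0; apply/fset0Pn; exists d; rewrite in_fset_set ?inE//.
  exact: net_locfin.
apply: esum_ge; exists [set z]; first by split.
by rewrite fsbig_set1.
Qed.

Lemma trans_le1 j h : trans j h <= 1%:E.
Proof.
have [N [x [y ->]]] := pair_cls_surj h.
apply: (@le_trans _ _ (\esum_(y in [set: vert N]) (trans j (pair_cls x y) * 1))).
  apply: esum_ge; exists [set y]; first by split.
  by rewrite fsbig_set1 mule1.
rewrite (trans_walk_op _ _ (G := fun=> 1))//.
elim: j => [//|j IH] /=; apply: le_trans IH.
have le n (F G : netclass M 'I_n.+1 -> \bar R) g : (forall h, F h <= G h) ->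
    walk_op F g <= walk_op G g.
  elim: n F G => [//|n IHn] F G FG /=; apply: IHn => g'; exact: le_step_op.
by apply: le => g; apply: step_op_le_cst.
Qed.

End transition.

(** * Mass transport weighted by limits of time averages *)

Section mass_transport.
Variables (R : realType) (M : completeMetricType R).
Variables (mu : probability (Gstar M) R) (P : probability (Trajectory M) R).
Hypothesis mu_uni : unimodular mu.
Hypothesis muP : walk_law mu P.
Hypothesis deg_fin : (mean_degree mu < +oo)%E.
Hypothesis deg_pos : {ae mu, forall g, (0 < deg (rt g))%N}.
Local Open Scope ereal_scope.

Let a : R := fine (mean_degree mu).

Lemma mean_degreeE : mean_degree mu = a%:E.
Proof.
rewrite /a fineK// ge0_fin_numE//; apply: integral_ge0 => g _.
by rewrite lee_fin.
Qed.

Lemma measurable_deg (S : Type) d (T : measurableType d) (h : nat -> T) :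
  measurable_fun setT (fun g : Gstar M => h (deg (rt g))).
Proof. exact: (measurable_locally_determined h (@degc_determined R M 1 ord0)). Qed.

Lemma mean_degree_gt0 : (0 < a)%R.
Proof.
rewrite lt_neqAle eq_sym mean_degree_ge0 andbT; apply/negP => /eqP a0.
have := mean_degreeE; rewrite a0 /mean_degree => int0.
have : {ae mu, forall g, (1%:E : \bar R) <= (deg (rt g))%:R%:E}.
  by apply: filterS deg_pos => g; rewrite lee_fin ler1n.
have mdeg : measurable_fun setT (fun g : Gstar M => (deg (rt g))%:R%:E : \bar R).
  exact: (measurable_deg unit (fun n => n%:R%:E)).
move=> h; have : \int[mu]_g (1%:E : \bar R) <= \int[mu]_g (deg (rt g))%:R%:E.
  apply: ae_ge0_le_integral => //.
  by apply: filterS h => g h _.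
rewrite int0 integral_cst// mul1e [X in X <= _ -> _](probability_setT mu).
by rewrite lee_fin ler10.
Qed.

(** The inverse of the density [bias]; it turns integrals against [mu] into expectations at the
    starting point of the walk. *)
Definition kappa (g : Gstar M) : R := (a / (deg (rt g))%:R)%R.

Lemma kappa_ge0 g : (0 <= kappa g)%R.
Proof. by rewrite divr_ge0 ?mean_degree_ge0. Qed.

Lemma measurable_kappa : measurable_fun setT kappa.
Proof. exact: (measurable_deg unit (fun n => a / n%:R : R)%R). Qed.

Lemma integral_kappa (H : Gstar M -> \bar R) : measurable_fun setT H ->
  (forall g, 0 <= H g) ->
  \int[P]_t ((kappa (at_ 0 t))%:E * H (at_ 0 t)) = \int[mu]_g H g.
Proof.
move=> mH H0; have mk : measurable_fun setT (fun g => (kappa g)%:E).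
  by apply/measurable_EFinP; exact: measurable_kappa.
have mb : measurable_fun setT (fun g => (bias mu g)%:E).
  by apply/measurable_EFinP; exact: measurable_bias.
have kH0 g : 0 <= (kappa g)%:E * H g by rewrite mule_ge0// lee_fin kappa_ge0.
transitivity (\int[P]_t (fun g => (kappa g)%:E * H g) (segment 0 t)).
  by apply: eq_integral => t _ /=; rewrite (at0_firstc 0) firstc1.
have mkH : measurable_fun setT (fun g => (kappa g)%:E * H g) by exact: emeasurable_funM.
rewrite [LHS](walk_expectation muP (n := 0) mkH kH0).
apply: ge0_ae_eq_integral => //.
- by apply: emeasurable_funM => //; exact: emeasurable_funM.
- by move=> g _; apply: mule_ge0; [rewrite lee_fin bias_ge0|exact: kH0].
apply: filterS deg_pos => g dg _ /=.
rewrite muleA -EFinM (_ : _ * _ = 1)%R ?mul1e// /bias /kappa -/a.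
rewrite mulrA mulfVK; last by rewrite gt_eqF// mean_degree_gt0.
by rewrite divff// pnatr_eq0 -lt0n.
Qed.

Lemma mass_transport (h : Gstar2 M -> \bar R) : measurable_fun setT h ->
  (forall g, 0 <= h g) ->
  \int[mu]_g vsum (h : netclass M 'I_2 -> _) g = \int[mu]_g vsum (h \o @swap M) g.
Proof.
move=> mh h0; have := mu_uni mh h0.
have E (F : Gstar2 M -> \bar R) g : vsum (F : netclass M 'I_2 -> _) g =
    \esum_(x in [set: vert (rep g)]) F (cls2 (rt g) x).
  by rewrite -{1}(rep_root_eq g) vsum_pair.
under eq_integral do rewrite -E.
move=> ->; apply: eq_integral => g _; rewrite E; apply: eq_esum => x _.
by rewrite /cls2 -/(pair_cls _ _) /= -/(pair_cls _ _) swap_pair.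
Qed.

Lemma measurable_swap : measurable_fun setT (@swap M : Gstar2 M -> Gstar2 M).
Proof. exact: measurable_pull. Qed.

Lemma vsum_firstc (u : Gstar M -> R) (h : netclass M 'I_2 -> \bar R) g :
  (forall g, 0 <= u g)%R -> (forall g, 0 <= h g) ->
  vsum (fun h2 => (u (firstc h2))%:E * h h2) g = (u g)%:E * vsum h g.
Proof.
move=> u0 h0; rewrite -(cls_rep g) !vsumE -ge0_esumZl ?lee_fin//.
by apply: eq_esum => x _; rewrite firstc_addr firstc1.
Qed.

Lemma vsum_trans_le (j : nat) (g : Gstar M) : vsum (trans j) g <= 1%:E :> \bar R.
Proof.
rewrite -(rep_root_eq g) vsum_pair.
rewrite (eq_esum (b := fun y => trans j (pair_cls (rt g) y) * 1)); last first.
  by move=> y _; rewrite mule1.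
rewrite (trans_walk_op _ _ (G := fun=> 1))//.
move: (cls _) => g'; elim: j => [//|j IH] /=; apply: le_trans IH.
have le n (F G : netclass M 'I_n.+1 -> \bar R) g1 : (forall h, F h <= G h) ->
    walk_op F g1 <= walk_op G g1.
  elim: n F G => [//|n IHn] F G FG /=; apply: IHn => g2; exact: le_step_op.
by apply: le => g1; apply: step_op_le_cst.
Qed.

Section core.
Variable f : Gstar M -> R.
Hypothesis mf : measurable_fun setT f.
Hypothesis f01 : forall g, (0 <= f g <= 1)%R.
Variable psi : Trajectory M -> R.
Hypothesis mpsi : measurable_fun setT psi.
Hypothesis psi01 : forall t, (0 <= psi t <= 1)%R.
Hypothesis psi_lim : {ae P, forall t,
  bavg (@shift R M) (f \o at_ 0) n t @[n --> \oo] --> psi t}.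

Let A n t : R := bavg (@shift R M) (f \o at_ 0) n t.

Let A01 n t : (0 <= A n t <= 1)%R.
Proof. by apply: bavg01 => t'; exact: f01. Qed.

Let mA n : measurable_fun setT (A n).
Proof.
apply: measurable_bavg; first exact: measurable_shift.
exact: (measurableT_comp mf (measurable_at 0)).
Qed.

(** After [integral_kappa] and [expectation_uavg], the left side is the expectation of a time
    average times the integrable [kappa * H], and dominated convergence applies. *)
Lemma weighted_cvg (H : Gstar M -> \bar R) : measurable_fun setT H ->
  (forall g, 0 <= H g) -> \int[mu]_g H g < +oo ->
  \int[mu]_g ((uavg f n g)%:E * H g) @[n --> \oo] -->
  \int[P]_t ((psi t)%:E * ((kappa (at_ 0 t))%:E * H (at_ 0 t))).
Proof.
move=> mH H0 Hfin; pose K t := (kappa (at_ 0 t))%:E * H (at_ 0 t).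
have mkH : measurable_fun setT (fun g => (kappa g)%:E * H g).
  by apply: emeasurable_funM => //; apply/measurable_EFinP; exact: measurable_kappa.
have mK : measurable_fun setT K by exact: (measurableT_comp mkH (measurable_at 0)).
have K0 t : 0 <= K t by rewrite mule_ge0// lee_fin kappa_ge0.
have iK : P.-integrable setT K.
  apply/integrableP; split=> //.
  by under eq_integral do rewrite gee0_abs//; rewrite integral_kappa.
have [||||| _ _] := @dominated_convergence _ _ _ P setT measurableT
  (fun n t => (A n t)%:E * K t) (fun t => (psi t)%:E * K t) K.
- by move=> n; apply: emeasurable_funM => //; apply/measurable_EFinP.
- by apply: emeasurable_funM => //; apply/measurable_EFinP.
- have := integrable_ae measurableT iK.
  apply: filterS2 psi_lim => t ct /(_ I) Kt _.
  by apply: cvgeZr => //; apply: cvg_EFin => //; exact: nearW.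
- by [].
- apply: aeW => t n _; have /andP[A0 A1] := A01 n t.
  have AK0 : 0 <= (A n t)%:E * K t by rewrite mule_ge0.
  rewrite gee0_abs// -[leRHS]mul1e.
  by apply: (lee_wpmul2r (K0 t)); rewrite lee_fin.
apply: cvg_trans; apply: near_eq_cvg; apply: nearW => n /=.
rewrite /A (expectation_uavg muP mf f01 n mkH); last first.
  by move=> g; rewrite mule_ge0// lee_fin kappa_ge0.
rewrite -integral_kappa//.
- by apply: eq_integral => t _; rewrite muleCA.
- by apply: emeasurable_funM => //; apply/measurable_EFinP; exact: measurable_uavg.
- by move=> g; rewrite mule_ge0// lee_fin; have /andP[] := uavg01 f01 n g.
Qed.

(** Weighted by [uavg f n], mass transport is violated only through the oscillation of this weight
    between the two ends of the transported mass. The bound on [h] compares that mass with [j] steps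
    of the walk, along which the oscillation tends to 0 by [expect_osc_cvg]; [weighted_cvg]
    identifies the limits. *)
Lemma transport_core (h : Gstar2 M -> \bar R) (C : R) (j : nat) :
  measurable_fun setT h -> (forall g, 0 <= h g) -> (0 <= C)%R ->
  (forall h2, h h2 <= C%:E * ((degc ord0 (h2 : netclass M 'I_2))%:R%:E * trans j h2)) ->
  \int[P]_t ((psi t)%:E * ((kappa (at_ 0 t))%:E * vsum (h : netclass M 'I_2 -> _) (at_ 0 t))) =
  \int[P]_t ((psi t)%:E * ((kappa (at_ 0 t))%:E * vsum (h \o @swap M) (at_ 0 t))).
Proof.
move=> mh h0 C0 hC.
have mhs : measurable_fun setT (h \o @swap M : Gstar2 M -> \bar R) by exact: (measurableT_comp mh measurable_swap).
have mdeg : measurable_fun setT (fun g : Gstar M => (deg (rt g))%:R%:E : \bar R).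
  exact: (measurable_deg unit (fun n => n%:R%:E)).
have deg_pull (h2 : netclass M 'I_2) : degc ord0 h2 = deg (rt (firstc h2)).
  rewrite -{1}(cls_rep h2) degcE; have := degcE ord0 (reroot (root (rep h2) \o (fun _ : 'I_1 => ord0))).
  by move=> /= <-.
have Hfin : \int[mu]_g vsum (h : netclass M 'I_2 -> _) g < +oo.
  apply: (@le_lt_trans _ _ (\int[mu]_g (C%:E * (deg (rt g))%:R%:E))).
    apply: ge0_le_integral => //.
    - by move=> g _; exact: vsum_ge0.
    - exact: measurable_vsum.
    - exact: measurable_funeM.
    move=> g _; apply: (@le_trans _ _ (vsum (fun h2 =>
        ((C * (deg (rt (firstc h2)))%:R)%R)%:E * trans j h2) g)).
      apply: le_esum => x _; apply: (le_trans (hC _)).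
      by rewrite muleA -EFinM deg_pull.
    rewrite (vsum_firstc (u := fun g => C * (deg (rt g))%:R)%R)//; last 2 first.
    - by move=> g'; rewrite mulr_ge0.
    - by move=> h2; exact: trans_ge0.
    rewrite EFinM -[leRHS]mule1; apply: lee_wpmul2l; last exact: vsum_trans_le.
    by rewrite mule_ge0.
  rewrite ge0_integralZl_EFin// -/(mean_degree mu) mean_degreeE -EFinM.
  exact: ltry.
have Hsfin : \int[mu]_g vsum (h \o @swap M) g < +oo by rewrite -mass_transport.
have mv : measurable_fun setT (vsum (h : netclass M 'I_2 -> _) : Gstar M -> _).
  exact: measurable_vsum.
have mvs : measurable_fun setT (vsum (h \o @swap M) : Gstar M -> _).
  by apply: measurable_vsum => // g; exact: h0.
have := weighted_cvg mv (fun g => vsum_ge0 g h0) Hfin.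
have := weighted_cvg mvs (fun g => vsum_ge0 g (fun h2 => h0 (swap h2))) Hsfin.
set b := \int[P]_t _; set c := \int[P]_t _ => cb cc.
pose u n := uavg f n.
have u0 n g : (0 <= u n g)%R by have /andP[] := uavg01 f01 n g.
have u1 n g : (u n g <= 1)%R by have /andP[] := uavg01 f01 n g.
have mu_ n : measurable_fun setT (u n) by exact: measurable_uavg.
have mfirst : measurable_fun setT (@firstc R M 1 : Gstar2 M -> Gstar M) by exact: measurable_pull.
have mlast : measurable_fun setT (@lastc R M 1 : Gstar2 M -> Gstar M) by exact: measurable_pull.
have first_swap h2 : firstc (swap h2) = lastc h2 :> netclass M 'I_1.
  rewrite /firstc /swap /lastc pull_comp; congr pull; apply/funext => i /=.
  exact: val_inj.
have last_swap h2 : lastc (swap h2) = firstc h2 :> netclass M 'I_1.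
  by rewrite -first_swap swapK.
have mF n : measurable_fun setT (fun h2 : Gstar2 M => (u n (firstc h2))%:E).
  by apply/measurable_EFinP; exact: (measurableT_comp (mu_ n) mfirst).
have mL n : measurable_fun setT (fun h2 : Gstar2 M => (u n (lastc h2))%:E).
  by apply/measurable_EFinP; exact: (measurableT_comp (mu_ n) mlast).
have mD n : measurable_fun setT (fun h2 : Gstar2 M => `|(u n (lastc h2) - u n (firstc h2))%R|%:E).
  apply/measurable_EFinP; apply: measurableT_comp => //.
  by apply: measurable_funB; apply/measurable_EFinP; [exact: mL|exact: mF].
(* The error made when the weight is moved from one end of the transported mass to the other. *)
pose delta n := \int[mu]_g vsum (fun h2 =>
   `|(u n (lastc h2) - u n (firstc h2))%R|%:E * (h \o @swap M) h2) g.
have aE n : \int[mu]_g ((u n g)%:E * vsum (h : netclass M 'I_2 -> _) g) =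
    \int[mu]_g vsum (fun h2 => (u n (lastc h2))%:E * (h \o @swap M) h2) g.
  under eq_integral do rewrite -vsum_firstc//.
  rewrite mass_transport; last 2 first.
  - exact: emeasurable_funM.
  - by move=> g; apply: mule_ge0; [rewrite lee_fin|exact: h0].
  by apply: eq_integral => g _; congr (vsum _ g); apply/funext => h2 /=; rewrite last_swap swapK.
have bE n : \int[mu]_g ((u n g)%:E * vsum (h \o @swap M) g) =
    \int[mu]_g vsum (fun h2 => (u n (firstc h2))%:E * (h \o @swap M) h2) g.
  by apply: eq_integral => g _; rewrite vsum_firstc// => h2; exact: h0.
have hs0 h2 : 0 <= (h \o @swap M) h2 by exact: h0.
have mle (F G : Gstar2 M -> R) : (forall h2, 0 <= G h2)%R ->
    measurable_fun setT (fun h2 => (F h2)%:E) -> measurable_fun setT (fun h2 => (G h2)%:E) ->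
    (forall h2, 0 <= F h2)%R -> forall n, (forall h2, F h2 <= G h2 + `|(u n (lastc h2) - u n (firstc h2))%R|)%R ->
    \int[mu]_g vsum (fun h2 : netclass M 'I_2 => (F h2)%:E * (h \o @swap M) h2) g <=
    \int[mu]_g vsum (fun h2 : netclass M 'I_2 => (G h2)%:E * (h \o @swap M) h2) g + delta n.
  move=> G0 mFF mGG F0 n FG.
  have nn (X : R) h2 : (0 <= X)%R -> 0 <= X%:E * (h \o @swap M) h2.
    by move=> X0; rewrite mule_ge0.
  rewrite -ge0_integralD//; last 4 first.
  - by move=> g _; apply: vsum_ge0 => h2; exact: nn.
  - by apply: measurable_vsum => [|h2]; [exact: emeasurable_funM|exact: nn].
  - by move=> g _; apply: vsum_ge0 => h2; exact: nn.
  - by apply: measurable_vsum => [|h2]; [exact: emeasurable_funM|exact: nn].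
  apply: ge0_le_integral => //.
  - by move=> g _; apply: vsum_ge0 => h2; exact: nn.
  - by apply: measurable_vsum => [|h2]; [exact: emeasurable_funM|exact: nn].
  - apply: emeasurable_funD.
      by apply: measurable_vsum => [|h2]; [exact: emeasurable_funM|exact: nn].
    by apply: measurable_vsum => [|h2]; [exact: emeasurable_funM|exact: nn].
  move=> g _; rewrite /vsum -esumD; last 2 first.
  - by move=> *; exact: nn.
  - by move=> *; exact: nn.
  apply: le_esum => x _; rewrite -ge0_muleDl ?lee_fin//.
  by apply: lee_wpmul2r => //; rewrite -EFinD lee_fin.
have le1 n : \int[mu]_g ((u n g)%:E * vsum (h : netclass M 'I_2 -> _) g) <=
    \int[mu]_g ((u n g)%:E * vsum (h \o @swap M) g) + delta n.
  rewrite aE bE; apply: (mle (fun h2 => u n (lastc h2)) (fun h2 => u n (firstc h2))) => // h2.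
  by have := ler_norm (u n (lastc h2) - u n (firstc h2))%R; lra.
have le2 n : \int[mu]_g ((u n g)%:E * vsum (h \o @swap M) g) <=
    \int[mu]_g ((u n g)%:E * vsum (h : netclass M 'I_2 -> _) g) + delta n.
  rewrite aE bE; apply: (mle (fun h2 => u n (firstc h2)) (fun h2 => u n (lastc h2))) => // h2.
  by have := ler_norm (u n (firstc h2) - u n (lastc h2))%R; rewrite distrC; lra.
(* With the two vertices exchanged, the bound on [h] applies; its factor [deg] becomes [bias] up to
   [a], which leaves an expectation along the walk. *)
have dlim n : delta n <= (C * a * expect P (fun t => `|u n (at_ j t) - u n (at_ 0 t)|))%:E.
  rewrite /delta mass_transport; last 2 first.
  - exact: emeasurable_funM.
  - by move=> g; apply: mule_ge0; [rewrite lee_fin|exact: h0].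
  pose G (h2 : netclass M 'I_2) : \bar R := `|(u n (lastc h2) - u n (firstc h2))%R|%:E.
  have G0 h2 : 0 <= G h2 by rewrite lee_fin.
  have mG : measurable_fun setT (G : Gstar2 M -> \bar R) by exact: mD.
  pose Gj (h : netclass M 'I_j.+1) := G (pull_pair ord0 ord_max h).
  have mGj : measurable_fun setT (Gj : Gspace M j.+1 -> \bar R).
    exact: (measurableT_comp mG (measurable_pull _)).
  have mtG : measurable_fun setT (fun h2 : Gstar2 M => trans j h2 * G h2 : \bar R).
    by apply: emeasurable_funM => //; exact: measurable_trans.
  have tG0 h2 : 0 <= trans j h2 * G h2 by rewrite mule_ge0// trans_ge0.
  have vE (g : Gstar M) : vsum (fun h2 => trans j h2 * G h2) g = walk_op Gj g.
    by rewrite -(rep_root_eq g) vsum_pair trans_walk_op.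
  apply: (@le_trans _ _ (\int[mu]_g ((C * a)%:E * ((bias mu g)%:E * walk_op Gj g)))).
    apply: ge0_le_integral => //.
    - move=> g _; apply: vsum_ge0 => h2 /=; apply: mule_ge0; first by rewrite lee_fin.
      exact: h0.
    - apply: measurable_vsum => [|h2].
        apply: (measurableT_comp (f := fun h2 : Gstar2 M =>
          `|(u n (lastc h2) - u n (firstc h2))%R|%:E * (h \o @swap M) h2)) => //.
          exact: emeasurable_funM.
        exact: measurable_swap.
      by apply: mule_ge0; [rewrite lee_fin|exact: h0].
    - apply: measurable_funeM; apply: emeasurable_funM.
        by apply/measurable_EFinP; exact: measurable_bias.
      by apply: (measurable_walk_op mGj) => h'; exact: G0.
    move=> g _; apply: (@le_trans _ _ (vsum (fun h2 =>
        ((C * (deg (rt (firstc h2)))%:R)%R)%:E * (trans j h2 * G h2)) g)).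
      apply: le_esum => x _; rewrite /= swapK muleC first_swap last_swap distrC.
      move: (cls (addr x)) => h2; rewrite muleA; apply: lee_wpmul2r => //.
      by apply: (le_trans (hC _)); rewrite muleA -EFinM deg_pull.
    rewrite (vsum_firstc (u := fun g => C * (deg (rt g))%:R)%R)//; last first.
      by move=> g'; rewrite mulr_ge0.
    rewrite vE muleA -EFinM; apply: lee_wpmul2r; first by apply: walk_op_ge0 => h'; exact: G0.
    have a0 := mean_degree_gt0.
    rewrite lee_fin /bias -/a; move: (_%:R) => d.
    rewrite (_ : C * a * (d / a) = C * d)%R //; move: a a0 => z z0.
    by field; rewrite gt_eqF.
  rewrite ge0_integralZl_EFin//; last 3 first.
  - by move=> g _; apply: mule_ge0; [rewrite lee_fin bias_ge0|apply: walk_op_ge0 => h'; exact: G0].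
  - apply: emeasurable_funM; last by apply: (measurable_walk_op mGj) => h'; exact: G0.
    by apply/measurable_EFinP; exact: measurable_bias.
  - by rewrite mulr_ge0// mean_degree_ge0.
  rewrite -(walk_expectation muP mGj); last by move=> h'; exact: G0.
  rewrite [leRHS]EFinM; apply: lee_wpmul2l.
    by rewrite lee_fin mulr_ge0// mean_degree_ge0.
  rewrite -expectE; last first.
    apply/bmfun_norm/bmfunB; apply: bmfun_at => //; [|by move=> g; apply/andP..].
    by move=> g; apply/andP.
  rewrite le_eqVlt; apply/orP; left; apply/eqP; apply: eq_integral => t _.
  rewrite at_lastc (at0_firstc j) /Gj /G /pull_pair /lastc /firstc !pull_comp.
  by congr (`|u n (pull _ _) - u n (pull _ _)|%:E); apply/funext.
have d0 n : 0 <= delta n.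
  apply: integral_ge0 => g _; apply: vsum_ge0 => h2.
  by apply: mule_ge0; [rewrite lee_fin|exact: h0].
have dcvg : delta n @[n --> \oo] --> 0.
  apply: (@squeeze_cvge _ _ _ _ (fun=> 0) _
    (fun n => (C * a * expect P (fun t => `|u n (at_ j t) - u n (at_ 0 t)|)%R)%:E)).
  - by apply: nearW => n; rewrite d0 dlim.
  - exact: cvg_cst.
  - apply: cvg_EFin; first exact: nearW.
    rewrite -[X in _ --> X](mulr0 (C * a)%R); apply: cvgM; first exact: cvg_cst.
    apply/cvgrPdist_le => e e0.
    have [N hN] := expect_osc_cvg mu_uni muP mf f01 j e0.
    exists N => // n /= Nn; rewrite sub0r normrN ger0_norm ?hN//.
    exact: expect_ge0.
apply/eqP; rewrite eq_le; apply/andP; split.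
- have cbd : (\int[mu]_g ((u n g)%:E * vsum (h \o @swap M) g) + delta n) @[n --> \oo] --> b.
    by rewrite -[b]adde0; apply: cvgeD => //; exact: fin_num_adde_defl.
  by apply: (lee_cvg_to cc cbd); apply: nearW => n /=; exact: le1.
- have ccd : (\int[mu]_g ((u n g)%:E * vsum (h : netclass M 'I_2 -> _) g) + delta n) @[n --> \oo] --> c.
    by rewrite -[c]adde0; apply: cvgeD => //; exact: fin_num_adde_defl.
  by apply: (lee_cvg_to cb ccd); apply: nearW => n /=; exact: le2.
Qed.

End core.
End mass_transport.

Section density.
Variables (R : realType) (M : completeMetricType R).
Variables (mu : probability (Gstar M) R) (P : probability (Trajectory M) R).
Hypothesis mu_uni : unimodular mu.
Hypothesis muP : walk_law mu P.
Hypothesis deg_fin : (mean_degree mu < +oo)%E.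
Hypothesis deg_pos : {ae mu, forall g, (0 < deg (rt g))%N}.
Local Open Scope ereal_scope.

Lemma dist_sym (N : network M) (x y : vert N) : connected_net N -> dist x y = dist y x.
Proof.
move=> cN; have wrev n : forall a b : vert N, walk n a b -> walk n b a.
  elim: n => [a b ->//|n IH] a b /= [d <- wd].
  have := walk_cat (IH _ _ wd) (_ : walk 1 (tgt d) (src d)).
  rewrite addn1; apply; exists (rev d) => //=.
  by rewrite /tgt revK.
have [w1 m1] := distP x y cN; have [w2 m2] := distP y x cN.
by apply/eqP; rewrite eqn_leq m1 ?m2//; exact: wrev.
Qed.

Lemma distc_pair (I : Type) (N : rnet M I) (x y : vert N) :
  distc ord0 ord_max (pair_cls x y) = dist x y.
Proof. by rewrite distcE /= !(tnth_nth x). Qed.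

Lemma degc_pair (I : Type) (N : rnet M I) (x y : vert N) :
  degc ord0 (pair_cls x y) = deg x.
Proof. by rewrite degcE /= !(tnth_nth x). Qed.

Lemma measurable_comp_swap (F : Gstar2 M -> \bar R) : measurable_fun setT F ->
  measurable_fun setT (F \o @swap M : Gstar2 M -> \bar R).
Proof. by move=> mF; exact: (measurableT_comp mF (@measurable_swap R M)). Qed.

Section transport.
Variable f : Gstar M -> R.
Hypothesis mf : measurable_fun setT f.
Hypothesis f01 : forall g, (0 <= f g <= 1)%R.
Variable psi : Trajectory M -> R.
Hypothesis mpsi : measurable_fun setT psi.
Hypothesis psi01 : forall t, (0 <= psi t <= 1)%R.
Hypothesis psi_lim : {ae P, forall t,
  bavg (@shift R M) (f \o at_ 0) n t @[n --> \oo] --> psi t}.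

(** The integral of [H] against [mu] reweighted by the conditional mean of [psi] given the starting
    network; [kappa] undoes the degree bias. *)
Definition weight (H : Gstar M -> \bar R) : \bar R :=
  \int[P]_t ((psi t)%:E * ((kappa mu (at_ 0 t))%:E * H (at_ 0 t))).

Let psi0 t : 0 <= (psi t)%:E. Proof. by rewrite lee_fin; have /andP[] := psi01 t. Qed.
Let k0 g : 0 <= (kappa mu g)%:E. Proof. by rewrite lee_fin kappa_ge0. Qed.

Lemma measurable_weight (H : Gstar M -> \bar R) : measurable_fun setT H ->
  measurable_fun setT (fun t => (psi t)%:E * ((kappa mu (at_ 0 t))%:E * H (at_ 0 t))).
Proof.
move=> mH; apply: emeasurable_funM; first exact/measurable_EFinP.
apply: emeasurable_funM; last exact: (measurableT_comp mH (measurable_at 0)).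
by apply/measurable_EFinP; exact: (measurableT_comp (measurable_kappa mu) (measurable_at 0)).
Qed.

Lemma weightZ (c : R) (H : Gstar M -> \bar R) : (0 <= c)%R ->
  measurable_fun setT H -> (forall g, 0 <= H g) ->
  weight (fun g => c%:E * H g) = c%:E * weight H.
Proof.
move=> c0 mH H0; rewrite /weight -ge0_integralZl_EFin//; last 2 first.
- by move=> t _; rewrite !mule_ge0.
- exact: measurable_weight.
by apply: eq_integral => t _; rewrite (muleCA _ c%:E) (muleCA _ c%:E).
Qed.

Lemma weight_series (H : (Gstar M -> \bar R)^nat) :
  (forall n, measurable_fun setT (H n)) -> (forall n g, 0 <= H n g) ->
  weight (fun g => \sum_(n <oo) H n g) = \sum_(n <oo) weight (H n).
Proof.
move=> mH H0; rewrite /weight -integral_nneseries//; last 2 first.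
- by move=> n; exact: measurable_weight.
- by move=> n t _; rewrite !mule_ge0.
apply: eq_integral => t _; rewrite -nneseriesZl// -nneseriesZl// => n _.
exact: mule_ge0.
Qed.

Let good (h : Gstar2 M -> \bar R) :=
  weight (vsum (h : netclass M 'I_2 -> _)) = weight (vsum (h \o @swap M)).

Lemma vsum_series k (h : (netclass M 'I_k.+1 -> \bar R)^nat) :
  (forall n g, 0 <= h n g) ->
  vsum (fun g => \sum_(n <oo) h n g) = fun g => \sum_(n <oo) vsum (h n) g.
Proof. by move=> h0; apply/funext => g; rewrite /vsum esum_nneseries. Qed.

Let good_series (h : (Gstar2 M -> \bar R)^nat) :
  (forall n, measurable_fun setT (h n)) -> (forall n g, 0 <= h n g) ->
  (forall n, good (h n)) -> good (fun g => \sum_(n <oo) h n g).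
Proof.
move=> mh h0 gh; rewrite /good.
rewrite (vsum_series (h := h))// weight_series; last 2 first.
- by move=> n; exact: measurable_vsum.
- by move=> n g; exact: vsum_ge0.
rewrite (_ : _ \o _ = fun g => \sum_(n <oo) (h n \o @swap M) g)//.
rewrite (vsum_series (h := fun n => h n \o @swap M)); last by move=> n g; exact: h0.
rewrite weight_series; last 2 first.
- move=> n; apply: (measurable_vsum (F := h n \o @swap M)) => [|g]; last exact: h0.
  exact: measurable_comp_swap.
- by move=> n g; apply: vsum_ge0 => h2; exact: h0.
by apply: eq_eseriesr => n _; exact: gh.
Qed.

Let good_split (A : set (Gstar2 M)) (nu : Gstar2 M -> nat) : measurable A ->
  (forall r, measurable (nu @^-1` [set r])) ->
  (forall r, good (fun g => (\1_(A `&` nu @^-1` [set r]) g)%:E)) ->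
  good (fun g => (\1_A g)%:E).
Proof.
move=> mA mnu gr.
have mAr r : measurable (A `&` nu @^-1` [set r]) by exact: measurableI.
rewrite (_ : (fun g => _) = fun g => \sum_(r <oo) (\1_(A `&` nu @^-1` [set r]) g)%:E).
  apply: good_series => // r.
  by apply/measurable_EFinP; exact: measurable_indic.
apply/funext => g; rewrite -indic_bigcup_series//.
  congr (\1_ _ g)%:E; apply/seteqP; split=> [h Ah|h [r _ []//]].
  by exists (nu h).
by apply/trivIsetP => i j _ _ ij; apply/seteqP; split=> // h [[_ /= e1] [_ /= e2]];
  rewrite -e1 -e2 eqxx in ij.
Qed.

(** By series it is enough to treat indicators of pairs at a fixed distance on which [deg * trans]
    is bounded below; there [transport_core] applies. These pieces cover everything, as [trans] is
    positive when the number of steps is the distance. *)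
Lemma transport (h : Gstar2 M -> \bar R) : measurable_fun setT h ->
  (forall g, 0 <= h g) ->
  weight (vsum (h : netclass M 'I_2 -> _)) = weight (vsum (h \o @swap M)).
Proof.
move: h; apply: nonneg_ind; last 2 first.
- move=> c h c0 mh h0 gh.
  have vZ (F : netclass M 'I_2 -> \bar R) : (forall g, 0 <= F g) ->
      vsum (fun g => c%:E * F g) = fun g => c%:E * vsum F g.
    by move=> F0; apply/funext => g; rewrite /vsum esumZl.
  rewrite (vZ h h0).
  have -> : (fun g => c%:E * h g) \o @swap M = fun g => c%:E * (h \o @swap M) g by [].
  rewrite (vZ (h \o @swap M)); last by move=> g; exact: h0.
  rewrite !weightZ ?gh//.
  + apply: measurable_vsum => [|g]; last exact: h0.
    exact: measurable_comp_swap.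
  + by move=> g; apply: vsum_ge0 => h2; exact: h0.
  + exact: measurable_vsum.
  + by move=> g; exact: vsum_ge0.
- by move=> h mh h0 gh; exact: good_series.
move=> A mA; pose dc : Gstar2 M -> nat := @distc R M 2 ord0 ord_max.
have mdc r : measurable (dc @^-1` [set r]).
  exact: (@locally_determined_measurable R M nat 2 _ [set r] (@distc_determined R M 2 ord0 ord_max)).
apply: (@good_split A dc mA mdc) => -[|j].
  (* A pair at distance 0 is fixed by [swap]. *)
  rewrite /good; congr weight; congr vsum; apply/funext => h /=; rewrite !indicE.
  have dsw : dc (swap h) = dc h.
    have [N [x [y ->]]] := pair_cls_surj h.
    by rewrite swap_pair /dc !distc_pair dist_sym//; exact: net_connected.
  suff E : (h \in A `&` dc @^-1` [set 0%N]) = (swap h \in A `&` dc @^-1` [set 0%N]) by rewrite E.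
  have [d0|d0] := eqVneq (dc h) 0%N.
    suff -> : swap h = h by [].
    have [N [x [y hE]]] := pair_cls_surj h.
    have : (dist x y == 0)%N by rewrite -distc_pair -hE; apply/eqP.
    rewrite dist0; last exact: net_connected.
    by move=> /eqP xy; rewrite hE swap_pair xy.
  rewrite !memNset// => -[_ /= e]; first by rewrite dsw in e; rewrite e eqxx in d0.
  by rewrite e eqxx in d0.
pose K (h : Gstar2 M) : R := ((degc ord0 (h : netclass M 'I_2))%:R * fine (trans j.+1 h : \bar R))%R.
have trans_fin h : (trans j.+1 h : \bar R) = (fine (trans j.+1 h : \bar R))%:E.
  rewrite fineK// ge0_fin_numE; last exact: trans_ge0.
  by apply: le_lt_trans (trans_le1 _ _) _; exact: ltry.
have mK : measurable_fun setT K.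
  apply: measurable_funM.
    exact: (measurable_locally_determined (fun n : nat => n%:R : R) (@degc_determined R M 2 ord0)).
  apply: measurableT_comp; last exact: measurable_trans.
  exact: (@fine_measurable R setT measurableT).
(* Where [K h > 0] and [nu h = r], one has [1 <= (r + 1) * K h], the bound with [C = r + 1] wanted
   by [transport_core]. *)
pose nu h := Num.truncn (K h)^-1%R.
set B := A `&` _; have mB : measurable B by exact: measurableI.
have K0 h : B h -> (0 < K h)%R.
  move=> [_ /= dh]; have [N [x [y hE]]] := pair_cls_surj h.
  have w : walk j.+1 x y.
    have dxy : dist x y = j.+1 by rewrite -distc_pair -hE.
    by have [] := distP x y (net_connected N); rewrite dxy.
  apply: mulr_gt0.
    rewrite hE degc_pair ltr0n; case: w => d dx _.
    rewrite cardfs_gt0; apply/fset0Pn; exists d; rewrite in_fset_set ?inE//.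
    exact: net_locfin.
  by rewrite -lte_fin -trans_fin hE; exact: trans_gt0.
have mnu r : measurable (nu @^-1` [set r]).
  have KK h : (0 <= K h)%R by rewrite mulr_ge0// -lee_fin -trans_fin trans_ge0.
  have mKr (c : R) : measurable [set h : Gstar2 M | (1 < c * K h)%R].
    rewrite (_ : [set h | _] = (fun h => c * K h)%R @^-1` `](1%R : R), +oo[%classic); last first.
      by apply/seteqP; split=> h /=; rewrite in_itv/= andbT.
    rewrite -[X in measurable X]setTI; apply: measurable_funM => //.
  have mK0 : measurable [set h : Gstar2 M | K h = 0%R].
    rewrite (_ : [set h | _] = K @^-1` [set 0%R])// -[X in measurable X]setTI.
    exact: mK.
  have -> : nu @^-1` [set r] = ([set h | K h = 0%R] `&` [set h | r = 0%N]) `|`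
     (~` [set h | K h = 0%R] `&` ([set h | 1 < r.+1%:R * K h]%R `\` [set h | 1 < r%:R * K h]%R)).
    apply/seteqP; split=> h /=.
      have [K0h|/eqP Kn0] := eqVneq (K h) 0%R.
        by rewrite /nu K0h invr0 truncn0 => <-; left.
      move=> nr; right; split=> //.
      have Kp : (0 < K h)%R by rewrite lt0r KK andbT; apply/eqP.
      have iv0 : (0 <= (K h)^-1)%R by rewrite invr_ge0.
      have := truncn_itv iv0; rewrite -/(nu h) nr => /andP[r1 r2]; split.
        by rewrite -ltr_pdivrMr// mul1r.
      by apply/negP; rewrite -leNgt -ler_pdivlMr// mul1r.
    move=> [[K0h ->]|[/eqP Kn0 [r1 /negP]]]; first by rewrite /nu K0h invr0 truncn0.
    rewrite -leNgt => r2.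
    have Kp : (0 < K h)%R by rewrite lt0r KK andbT.
    have iv0 : (0 <= (K h)^-1)%R by rewrite invr_ge0.
    apply: truncn_def; rewrite -[((K h)^-1)%R]mul1r ler_pdivlMr// r2 /=.
    by rewrite ltr_pdivrMr.
  apply: measurableU; apply: measurableI => //.
  - have [r0|r0] := pselect (r = 0%N).
      by rewrite (_ : mkset _ = setT)//; apply/seteqP; split.
    by rewrite (_ : mkset _ = set0)//; apply/seteqP; split.
  - exact: measurableC.
  - exact: measurableD.
apply: (@good_split B nu mB mnu) => r.
have mi : measurable_fun setT (fun g : Gstar2 M => (\1_(B `&` nu @^-1` [set r]) g)%:E : \bar R).
  by apply/measurable_EFinP; apply: measurable_indic; exact: measurableI.
rewrite /good /weight; apply: (transport_core mu_uni muP deg_fin deg_pos mf f01 mpsi psi_lim mi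
  (C := r.+1%:R%R) (j := j.+1)) => //.
move=> h; rewrite trans_fin -!EFinM lee_fin -/(K h) indicE.
have [/set_mem[Bh /= nh]|] := boolP (h \in _); last first.
  by move=> _; rewrite mulr_ge0// mulr_ge0// -lee_fin -trans_fin trans_ge0.
have := K0 h Bh => Kh; rewrite -ler_pdivrMr// mul1r ltW//.
by rewrite -nh; exact: truncnS_gt.
Qed.

End transport.
End density.

Lemma exists_probability d (T : measurableType d) (R : realType) (m : set T -> \bar R) :
  m set0 = 0%E -> (forall A, (0 <= m A)%E) -> semi_sigma_additive m ->
  m setT = 1%E -> exists p : probability T R, forall A, p A = m A.
Proof.
move=> m0 mge0 ms mT.
pose mix := isMeasure.Build _ _ _ m m0 mge0 ms.
pose mm : {measure set T -> \bar R} := HB.pack m mix.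
pose pm := Measure_isProbability.Build _ _ _ mm mT.
pose pp : probability T R := HB.pack (Measure.sort mm) mix pm.
by exists pp.
Qed.

(** * Extremality makes the limits of time averages constant *)

Section extremality.
Variables (R : realType) (M : completeMetricType R).
Variables (mu : probability (Gstar M) R) (P : probability (Trajectory M) R).
Hypothesis mu_uni : unimodular mu.
Hypothesis muP : walk_law mu P.
Hypothesis deg_fin : (mean_degree mu < +oo)%E.
Hypothesis deg_pos : {ae mu, forall g, (0 < deg (rt g))%N}.

Let a : R := fine (mean_degree mu).
Let a0 : 0 < a. Proof. exact: mean_degree_gt0. Qed.

Local Notation weight := (weight mu P).
Local Notation one := (fun _ : Gstar M => 1%:E : \bar R).

Section normalized.
Local Open Scope ereal_scope.
Variable psi : Trajectory M -> R.
Hypothesis mpsi : measurable_fun setT psi.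
Hypothesis psi01 : forall t, (0 <= psi t <= 1)%R.

Lemma weight_ge0 H : (forall g, 0 <= H g) -> 0 <= weight psi H.
Proof.
move=> H0; apply: integral_ge0 => t _; rewrite !mule_ge0// lee_fin ?kappa_ge0//.
by have /andP[] := psi01 t.
Qed.

Lemma weight_probability (t : R) : (0 < t)%R -> weight psi one = t%:E ->
  exists p : probability (Gstar M) R,
    forall F : Gstar M -> \bar R, measurable_fun setT F -> (forall g, 0 <= F g) ->
      t%:E * \int[p]_g F g = weight psi F.
Proof.
move=> t0 wt; pose m (A : set (Gstar M)) := (t^-1)%:E * weight psi (fun g => (\1_A g)%:E).
have w0 (A : set (Gstar M)) : 0 <= weight psi (fun g => (\1_A g)%:E).
  by apply: weight_ge0 => g; rewrite lee_fin.
have mi (A : set (Gstar M)) : measurable A -> measurable_fun setT (fun g => (\1_A g)%:E : \bar R).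
  by move=> mA; apply/measurable_EFinP; exact: measurable_indic.
have tv : (0 <= t^-1)%R by rewrite invr_ge0 ltW.
have [||||p pE] := @exists_probability _ (Gstar M) R m.
- rewrite /m (_ : weight psi _ = 0) ?mule0//.
  rewrite /weight integral0_eq// => x _.
  by rewrite indic0 !mule0.
- by move=> A; rewrite mule_ge0.
- move=> F mF tF mU.
  have -> : m (\bigcup_n F n) = \sum_(n <oo) m (F n).
    rewrite /m nneseriesZl// -weight_series//; last by move=> n; exact: mi.
    congr (_ * weight _ _); apply/funext => g.
    by rewrite -indic_bigcup_series.
  by apply: is_cvg_nneseries => n _ _; rewrite mule_ge0.
- rewrite /m (_ : weight psi _ = t%:E); first by rewrite -EFinM mulVf// gt_eqF.
  by rewrite -wt; congr weight; apply/funext => g; rewrite indicT.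
exists p; apply: nonneg_ind.
- move=> A mA; have -> : \int[p]_g (\1_A g)%:E = p A by rewrite integral_indic// setIT.
  rewrite pE /m muleA -EFinM divff ?mul1e//.
  by rewrite gt_eqF.
- move=> c F c0 mF F0 IH; rewrite ge0_integralZl_EFin// muleCA IH weightZ//.
- move=> F mF F0 IH; rewrite integral_nneseries// weight_series//.
  rewrite -nneseriesZl; last by move=> i _; exact: integral_ge0.
  by apply: eq_eseriesr => i _; exact: IH.
Qed.

End normalized.

Lemma weight_compl (psi : Trajectory M -> R) (H : Gstar M -> \bar R) :
  measurable_fun setT psi -> (forall t, 0 <= psi t <= 1) ->
  measurable_fun setT H -> (forall g, 0 <= H g)%E ->
  (weight psi H + weight (fun t => (1 - psi t)%R) H = \int[mu]_g H g)%E.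
Proof.
move=> mpsi psi01 mH H0.
have c01 t : 0 <= 1 - psi t <= 1 by have /andP[p0 p1] := psi01 t; apply/andP; split; lra.
have mc : measurable_fun setT (fun t => 1 - psi t) by exact: measurable_funB.
rewrite -(integral_kappa muP deg_fin deg_pos mH H0) /weight -ge0_integralD//.
- apply: eq_integral => t _; rewrite -ge0_muleDl -?EFinD ?subrKC ?mul1e// lee_fin.
    by have /andP[] := psi01 t.
  by have /andP[] := c01 t.
- by move=> t _; rewrite !mule_ge0// lee_fin ?kappa_ge0//; have /andP[] := psi01 t.
- exact: measurable_weight.
- by move=> t _; rewrite !mule_ge0// lee_fin ?kappa_ge0//; have /andP[] := c01 t.
- exact: measurable_weight.
Qed.

(** This is [transport] for the normalised measure. *)
Lemma weight_unimodular (f : Gstar M -> R) (psi : Trajectory M -> R) (t : R)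
    (p : probability (Gstar M) R) :
  measurable_fun setT f -> (forall g, 0 <= f g <= 1) ->
  measurable_fun setT psi -> (forall t, 0 <= psi t <= 1) ->
  {ae P, forall t, bavg (@shift R M) (f \o at_ 0) n t @[n --> \oo] --> psi t} ->
  0 < t ->
  (forall F : Gstar M -> \bar R, measurable_fun setT F -> (forall g, 0 <= F g)%E ->
      (t%:E * \int[p]_g F g = weight psi F)%E) ->
  unimodular p.
Proof.
move=> mf f01 mpsi psi01 lim t0 pE h mh h0.
have E (F : Gstar2 M -> \bar R) (g : Gstar M) : vsum (F : netclass M 'I_2 -> _) g =
    \esum_(x in [set: vert (rep g)]) F (cls2 (rt g) x).
  by rewrite -{1}(rep_root_eq g) vsum_pair.
have E1 : (\int[p]_g (\esum_(x in [set: vert (rep g)]) h (cls2 (rt g) x)) =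
    \int[p]_g vsum (h : netclass M 'I_2 -> \bar R) g)%E.
  by apply: eq_integral => g _; rewrite E.
have E2 : (\int[p]_g (\esum_(x in [set: vert (rep g)]) h (cls2 x (rt g))) =
    \int[p]_g vsum (h \o @swap M) g)%E.
  apply: eq_integral => g _; rewrite E; apply: eq_esum => x _.
  by rewrite /cls2 -/(pair_cls _ _) /= -/(pair_cls _ _) swap_pair.
rewrite E1 E2.
have mv : measurable_fun setT (vsum (h : netclass M 'I_2 -> _) : Gstar M -> _).
  exact: measurable_vsum.
have mvs : measurable_fun setT (vsum (h \o @swap M) : Gstar M -> _).
  by apply: (measurable_vsum (F := h \o @swap M)) => [|g]; [exact: measurable_comp_swap|exact: h0].
have w1 := pE _ mv (fun g => vsum_ge0 g h0).
have w2 := pE _ mvs (fun g => vsum_ge0 g (fun h2 => h0 (swap h2))).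
have := transport mu_uni muP deg_fin deg_pos mf f01 mpsi psi01 lim mh h0.
rewrite -w1 -w2 => /(congr1 (fun x => (t^-1)%:E * x)%E).
by rewrite !muleA -EFinM mulVf ?gt_eqF// !mul1e.
Qed.

(** The limits belonging to [f] and [1 - f] give two unimodular probabilities whose mixture with
    weights [t] and [1 - t] is [mu]. Extremality forces the first to be [mu]. *)
Lemma extremal_weight (f : Gstar M -> R) (psi : Trajectory M -> R) (t : R) :
  extremal mu ->
  measurable_fun setT f -> (forall g, 0 <= f g <= 1) ->
  measurable_fun setT psi -> (forall t, 0 <= psi t <= 1) ->
  {ae P, forall t, bavg (@shift R M) (f \o at_ 0) n t @[n --> \oo] --> psi t} ->
  0 < t < 1 -> weight psi one = t%:E ->
  forall F : Gstar M -> \bar R, measurable_fun setT F -> (forall g, 0 <= F g)%E ->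
    (weight psi F = t%:E * \int[mu]_g F g)%E.
Proof.
move=> [_ ext] mf f01 mpsi psi01 lim /andP[t0 t1] wt.
have mc : measurable_fun setT (fun t => 1 - psi t) by exact: measurable_funB.
have c01 s : 0 <= 1 - psi s <= 1 by have /andP[p0 p1] := psi01 s; apply/andP; split; lra.
have mf2 : measurable_fun setT (fun g => 1 - f g) by exact: measurable_funB.
have f201 g : 0 <= 1 - f g <= 1 by have /andP[p0 p1] := f01 g; apply/andP; split; lra.
have lim2 : {ae P, forall t,
    bavg (@shift R M) ((fun g => 1 - f g) \o at_ 0) n t @[n --> \oo] --> (1 - psi t)%R}.
  apply: filterS lim => s cs.
  have : (1 - bavg (@shift R M) (f \o at_ 0) n s) @[n --> \oo] --> 1 - psi s.
    by apply: cvgB => //; exact: cvg_cst.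
  apply: cvg_trans; apply: near_eq_cvg; exists 1%N => // n /= n0.
  rewrite /bavg /bsum /= sumrB sumr_const card_ord mulrBl divff//.
  by rewrite pnatr_eq0 -lt0n.
have wc : weight (fun t => 1 - psi t) one = (1 - t)%:E.
  have := weight_compl mpsi psi01 (measurable_cst _) (fun=> lee01) (H := one).
  rewrite wt integral_cst// mul1e [X in _ = X](probability_setT mu).
  case: (weight _ _) => [r| |]//=; rewrite -EFinD => -[<-].
  by congr (_%:E); ring.
have [p1 p1E] := weight_probability mpsi psi01 t0 wt.
have s0 : 0 < 1 - t by rewrite subr_gt0.
have [p2 p2E] := weight_probability mc c01 s0 wc.
have u1 := weight_unimodular mf f01 mpsi psi01 lim t0 p1E.
have u2 := weight_unimodular mf2 f201 mc c01 lim2 s0 p2E.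
have mix F : measurable_fun setT F -> (forall g, 0 <= F g)%E ->
    (\int[mu]_g F g = t%:E * \int[p1]_g F g + (1 - t)%:E * \int[p2]_g F g)%E.
  by move=> mF F0; rewrite p1E// p2E// weight_compl.
have mixA A : measurable A -> (mu A = t%:E * p1 A + (1 - t)%:E * p2 A)%E.
  move=> mA; have := mix (fun g => (\1_A g)%:E).
  have I (q : probability (Gstar M) R) : (\int[q]_g (\1_A g)%:E = q A)%E.
    by rewrite integral_indic// setIT.
  rewrite !I; apply; last by move=> g; rewrite lee_fin.
  by apply/measurable_EFinP; exact: measurable_indic.
suff p1mu A : measurable A -> p1 A = mu A.
  move=> F mF F0; rewrite -p1E//; congr (_ * _)%E.
  by apply: eq_measure_integral => A mA _; exact: p1mu.
move=> mA; apply: contrapT => d1.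
apply: ext; exists p1, p2, t; split => //; [by split=> //; exists A| |by apply/andP].
split=> //; exists A => //.
move=> e2; apply: d1; have := mixA A mA; rewrite e2.
have : mu A \is a fin_num by exact: fin_num_measure.
have : p1 A \is a fin_num by exact: fin_num_measure.
case: (p1 A) => // x _; case: (mu A) => // y _.
rewrite -!EFinM -EFinD => -[] e; congr (_%:E).
apply: (@mulfI _ t); first by rewrite gt_eqF.
by lra.
Qed.

Lemma trajectory_deg_pos : {ae P, forall t, (0 < deg (rt (at_ 0 t)))%N}.
Proof.
pose Z : set (Gstar M) := [set g | deg (rt g) = 0%N].
have mZ : measurable Z.
  exact: (@locally_determined_measurable R M nat 1 _ [set 0%N] (@degc_determined R M 1 ord0)).
exists (@at_ R M 0 @^-1` Z); split.
- by rewrite -[X in measurable X]setTI; exact: (measurable_at 0).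
- rewrite (_ : @at_ R M 0 @^-1` Z = @segment R M 0 @^-1` Z); last first.
    by apply/funext => t; rewrite /preimage/mkset (at0_firstc 0) firstc1.
  rewrite (prob_segment P mZ).
  rewrite (walk_expectation muP (n := 0) (F := fun g => (\1_Z g)%:E)); last 2 first.
  + by apply/measurable_EFinP; exact: measurable_indic.
  + by move=> g; rewrite lee_fin.
  rewrite integral0_eq// => g _ /=; rewrite indicE.
  have [/set_mem|] := boolP (g \in Z); last by rewrite mule0.
  by rewrite /Z /= /bias => ->; rewrite mul0r mul0e.
- by move=> t /= /negP; rewrite -leqNgt leqn0 => /eqP.
Qed.

Lemma extremal_expect (f : Gstar M -> R) (psi : Trajectory M -> R) (t : R) (G : Gstar M -> R) :
  extremal mu ->
  measurable_fun setT f -> (forall g, 0 <= f g <= 1) ->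
  measurable_fun setT psi -> (forall t, 0 <= psi t <= 1) ->
  {ae P, forall t, bavg (@shift R M) (f \o at_ 0) n t @[n --> \oo] --> psi t} ->
  0 < t < 1 -> weight psi one = t%:E ->
  measurable_fun setT G -> (forall g, 0 <= G g <= 1) ->
  expect P (fun s => psi s * G (at_ 0 s)) = t * expect P (fun s => G (at_ 0 s)).
Proof.
move=> ext mf f01 mpsi psi01 lim t01 wt mG G01.
have G0 g : 0 <= G g by have /andP[] := G01 g.
have p0 s : 0 <= psi s by have /andP[] := psi01 s.
(* Tested with [D * G], the factor [kappa] in [weight] cancels and the integral over [mu] becomes an
   expectation under [P]. *)
pose D (g : Gstar M) : R := (deg (rt g))%:R / a.
have mD : measurable_fun setT D by exact: (measurable_deg unit (fun n => n%:R / a : R)).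
have D0 g : 0 <= D g by rewrite divr_ge0// ltW.
have mDG : measurable_fun setT (fun g => (D g * G g)%:E).
  by apply/measurable_EFinP; exact: measurable_funM.
have DG0 g : (0 <= (D g * G g)%:E)%E by rewrite lee_fin mulr_ge0.
have := extremal_weight ext mf f01 mpsi psi01 lim t01 wt mDG DG0.
have bG : bmfun (fun s => G (at_ 0 s)) by exact: bmfun_at.
have bpG : bmfun (fun s => psi s * G (at_ 0 s)).
  by apply: bmfunM => //; exact: bmfun_unit.
have -> : weight psi (fun g => (D g * G g)%:E) = (expect P (fun s => psi s * G (at_ 0 s)))%:E.
  rewrite -expectE//; apply: ge0_ae_eq_integral => //.
  - exact: (measurable_weight mu mpsi mDG).
  - by apply/measurable_EFinP; case: bpG.
  - move=> s _; apply: mule_ge0; first by rewrite lee_fin.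
    by apply: mule_ge0; [rewrite lee_fin kappa_ge0|exact: DG0].
  - by move=> s _; rewrite lee_fin mulr_ge0.
  apply: filterS trajectory_deg_pos => s ds _ /=.
  rewrite -!EFinM; congr (_%:E); congr (_ * _); rewrite mulrA.
  rewrite /kappa /D -/a mulrA mulfVK ?divff ?mul1r ?gt_eqF ?ltr0n//.
have -> : (\int[mu]_g (D g * G g)%:E = (expect P (fun s => G (at_ 0 s)))%:E)%E.
  rewrite -expectE//.
  transitivity (\int[mu]_g ((bias mu g)%:E * walk_op (n := 0) (fun g => (G g)%:E) g))%E.
    by apply: eq_integral => g _ /=; rewrite EFinM.
  rewrite -(walk_expectation muP (n := 0)); last 2 first.
  - exact/measurable_EFinP.
  - by move=> g; rewrite lee_fin.
  by apply: eq_integral => s _ /=; rewrite (at0_firstc 0) firstc1.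
by rewrite -EFinM => -[].
Qed.

Lemma expect_affine (g : Trajectory M -> R) (c d : R) : bmfun g ->
  expect P (fun s => (c + g s) / d) = (c + expect P g) / d.
Proof.
move=> bg; rewrite (_ : (fun s => _) = fun s => d^-1 * (c + g s)); last first.
  by apply/funext => s; rewrite mulrC.
rewrite expectZ; last by apply: bmfunD => //; exact: bmfun_cst.
rewrite expectD//; last exact: bmfun_cst.
by rewrite expect_cst mulrC.
Qed.

Lemma shift_inv k (f : Trajectory M -> \bar R) : measurable_fun setT f ->
  (forall t, 0 <= f t)%E -> (\int[P]_t f (iter k (@shift R M) t) = \int[P]_t f t)%E.
Proof.
move=> mf f0; apply: integral_iter => //; first exact: measurable_shift.
exact: (expectation_shift mu_uni muP).
Qed.

(** By [extremal_expect] the limit is uncorrelated with [f] at time 0, by stationarity at every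
    time, and so with the time averages. In the limit it is uncorrelated with itself, and its
    variance vanishes. *)
Lemma ergodic_average (f : Gstar M -> R) : extremal mu ->
  measurable_fun setT f -> (forall g, 0 <= f g <= 1) ->
  {ae P, forall t, (\sum_(k < n) f (at_ k t)) / n%:R @[n --> \oo] -->
    expect P (fun s => f (at_ 0 s))}.
Proof.
move=> ext mf f01.
have mfa : measurable_fun setT (f \o @at_ R M 0) by exact: (measurableT_comp mf (measurable_at 0)).
have fa01 t : 0 <= (f \o @at_ R M 0) t <= 1 by exact: f01.
have [lim0 int0] := birkhoff (@measurable_shift R M) (expectation_shift mu_uni muP) mfa fa01.
pose phi := bsup (@shift R M) (f \o @at_ R M 0).
have mphi : measurable_fun setT phi by apply: measurable_bsup => //; exact: measurable_shift.
have phi01 t : 0 <= phi t <= 1 by exact: bsup01.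
(* Rescaling to values between 1/3 and 2/3 keeps the total weight [t] strictly between 0 and 1, as
   the convex combination demands. *)
pose f1 g := (1 + f g) / 3; pose psi t := (1 + phi t) / 3.
have mf1 : measurable_fun setT f1 by apply: measurable_funM => //; exact: measurable_funD.
have mpsi : measurable_fun setT psi by apply: measurable_funM => //; exact: measurable_funD.
have f101 g : 0 <= f1 g <= 1.
  by have /andP[? ?] := f01 g; rewrite /f1; apply/andP; split; lra.
have psi3 s : 3^-1 <= psi s <= 2 / 3.
  by have /andP[? ?] := phi01 s; rewrite /psi; apply/andP; split; lra.
have psi01 s : 0 <= psi s <= 1.
  by have /andP[? ?] := psi3 s; apply/andP; split; lra.
have lim : {ae P, forall t,
    bavg (@shift R M) (f1 \o at_ 0) n t @[n --> \oo] --> psi t}.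
  apply: filterS lim0 => t ct.
  have : (1 + bavg (@shift R M) (f \o at_ 0) n t) * 3^-1 @[n --> \oo] --> psi t.
    by apply: cvgM; [apply: cvgD => //; exact: cvg_cst|exact: cvg_cst].
  apply: cvg_trans; apply: near_eq_cvg; exists 1%N => // n /= n0.
  rewrite /bavg /bsum /f1 /= -mulr_suml big_split/= sumr_const card_ord.
  have : n%:R != 0 :> R by rewrite pnatr_eq0 -lt0n.
  by move: (\sum_(i < n) _) (n%:R) => S c c0; field.
have E1 : expect P psi = expect P (fun s => f1 (at_ 0 s)).
  have bphi : bmfun phi by exact: bmfun_unit.
  have bfa : bmfun (fun s => f (at_ 0 s)) by exact: bmfun_at.
  rewrite /psi /f1 (expect_affine _ _ bphi) (expect_affine _ _ bfa).
  congr ((1 + _) / 3); apply: EFin_inj; rewrite -!expectE//; exact: int0.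
have [t wt] : exists t : R, weight psi one = t%:E.
  have : weight psi one \is a fin_num.
    rewrite ge0_fin_numE; last by apply: weight_ge0.
    have := weight_compl mpsi psi01 (measurable_cst _) (fun=> lee01) (H := one).
    rewrite integral_cst// mul1e [X in _ = X -> _](probability_setT mu) => w1.
    apply: (@le_lt_trans _ _ 1%E); last exact: ltry.
    apply: (@le_trans _ _ (weight psi one + weight (fun t => 1 - psi t)%R one)%E).
      rewrite leeDl// weight_ge0// => s.
      by have /andP[? ?] := psi01 s; apply/andP; split; lra.
    by rewrite w1.
  by case: (weight _ _) => // t _; exists t.
have m1 : measurable_fun setT one by exact: measurable_cst.
have wcst (c : R) : 0 <= c -> weight (fun=> c) one = c%:E.
  move=> c0; rewrite /weight ge0_integralZl_EFin//.
  - rewrite [X in (_ * X)%E](integral_kappa muP deg_fin deg_pos m1 (fun=> lee01)).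
    by rewrite integral_cst// mul1e [X in (_ * X)%E](probability_setT mu) mule1.
  - by move=> s _; rewrite mule_ge0// lee_fin kappa_ge0.
  - apply: emeasurable_funM => //; apply/measurable_EFinP.
    exact: (measurableT_comp (measurable_kappa mu) (measurable_at 0)).
have wle (p q : Trajectory M -> R) : measurable_fun setT p -> measurable_fun setT q ->
    (forall s, 0 <= p s <= q s) -> (weight p one <= weight q one)%E.
  move=> mp mq pq; apply: ge0_le_integral => //.
  - move=> s _; rewrite !mule_ge0// lee_fin ?kappa_ge0//.
    by have /andP[] := pq s.
  - exact: (measurable_weight mu mp m1).
  - exact: (measurable_weight mu mq m1).
  move=> s _; apply: lee_wpmul2r; first by rewrite mule_ge0// lee_fin kappa_ge0.
  by rewrite lee_fin; have /andP[] := pq s.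
have t01 : 0 < t < 1.
  have h1 : 3^-1 <= t.
    rewrite -lee_fin -wt -(wcst 3^-1) ?invr_ge0//; apply: wle => //.
    by move=> s; have /andP[? ?] := psi3 s; rewrite invr_ge0 ler0n.
  have h2 : t <= 2 / 3.
    rewrite -lee_fin -wt -(wcst (2 / 3)) ?divr_ge0//; apply: wle => //.
    by move=> s; have /andP[? ?] := psi3 s; have /andP[? ?] := psi01 s; apply/andP.
  by apply/andP; split; lra.
have key G := @extremal_expect f1 psi t G ext mf1 f101 mpsi psi01 lim t01 wt.
have bpsi : bmfun psi by exact: bmfun_unit.
have bf1 k : bmfun (fun s => f1 (at_ k s)) by exact: bmfun_at.
have Et : expect P psi = t.
  have := key (fun=> 1) (measurable_cst _) (fun=> _).
  rewrite expect_cst mulr1 => <-; last by rewrite ler01 lexx.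
  by congr expect; apply/funext => s; rewrite mulr1.
have Epf : expect P (fun s => psi s * f1 (at_ 0 s)) = t * t.
  by rewrite key// -E1 Et.
have psi_shift k s : psi (iter k (@shift R M) s) = psi s.
  elim: k => [//|k IH]; rewrite iterS -IH /psi /phi bsup_tau//.
have Epk k : expect P (fun s => psi s * f1 (at_ k s)) = t * t.
  rewrite -Epf /expect /Rintegral; congr fine.
  rewrite -(shift_inv k (f := fun s => (psi s * f1 (at_ 0 s))%:E)).
  - by apply: eq_integral => s _; rewrite psi_shift at_iter_shift.
  - by apply/measurable_EFinP; case: (bmfunM bpsi (bf1 0%N)).
  - move=> s; rewrite lee_fin mulr_ge0//; first by have /andP[] := psi01 s.
    by have /andP[] := f101 (at_ 0 s).
(* The identities [Epk] are averaged over [k < n], and [n] tends to infinity. *)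
have Epp : expect P (fun s => psi s * psi s) = t * t.
  pose F n s := psi s * bavg (@shift R M) (f1 \o at_ 0) n s.
  have bF n : bmfun (F n).
    apply: bmfunM => //; apply: bmfun_unit.
      apply: measurable_bavg; first exact: measurable_shift.
      exact: (measurableT_comp mf1 (measurable_at 0)).
    by move=> s; apply: bavg01 => s'; exact: f101.
  have cF : expect P (F n) @[n --> \oo] --> expect P (fun s => psi s * psi s).
    apply: (@expect_cvg _ _ _ _ _ _ 1).
    - by move=> n; case: (bF n).
    - exact: bmfunM.
    - move=> n s; have /andP[q0 q1] := psi01 s.
      have /andP[b0 b1] : 0 <= bavg (@shift R M) (f1 \o at_ 0) n s <= 1.
        by apply: bavg01 => s'; exact: f101.
      rewrite /F ger0_norm; last exact: mulr_ge0.
      by rewrite -[leRHS]mulr1; exact: ler_pM.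
    - apply: filterS lim => s cs; apply: cvgM => //; exact: cvg_cst.
  have EF n : (0 < n)%N -> expect P (F n) = t * t.
    move=> n0.
    have -> : F n = fun s => n%:R^-1 * \sum_(k < n) psi s * f1 (at_ k s).
      by apply/funext => s; rewrite /F bavg_at -mulr_sumr mulrA [RHS]mulrC.
    rewrite expectZ; last by apply: bmfun_sum => k; exact: bmfunM.
    rewrite expect_sum; last by move=> k; exact: bmfunM.
    rewrite (eq_bigr (fun=> t * t)); last by move=> k _; exact: Epk.
    rewrite sumr_const card_ord -[X in _ * X]mulr_natl mulrA mulVf ?mul1r//.
    by rewrite pnatr_eq0 -lt0n.
  have : expect P (F n) @[n --> \oo] --> t * t.
    apply: cvg_near_cst; exists 1%N => // n /= n0; exact: EF.
  by move=> /(cvg_unique _ cF); exact.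
have bd : bmfun (fun s => (psi s - t) * (psi s - t)).
  by apply: bmfunM; apply: bmfunB => //; exact: bmfun_cst.
have Ed : expect P (fun s => (psi s - t) * (psi s - t)) = 0.
  rewrite (_ : (fun s => _) = fun s => psi s * psi s - (2 * t * psi s - t * t)); last first.
    by apply/funext => s; ring.
  have b1 : bmfun (fun s => 2 * t * psi s) by apply: bmfunM => //; exact: bmfun_cst.
  have b2 : @bmfun _ _ R (fun _ : Trajectory M => t * t) by exact: bmfun_cst.
  have b3 : bmfun (fun s => psi s * psi s) by exact: bmfunM.
  rewrite (expectB P b3 (bmfunB b1 b2)) (expectB P b1 b2) (expectZ P _ bpsi).
  by rewrite Epp Et expect_cst; ring.
have := expect_ae0 bd (fun s => _) Ed.
move=> /(_ (fun s => sqr_ge0 (psi s - t))).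
apply: filterS2 lim0 => s cs ds.
have ps : psi s = t.
  by move/eqP: ds; rewrite mulf_eq0 orbb subr_eq0 => /eqP.
have -> : expect P (fun s0 => f (at_ 0 s0)) = phi s.
  have Ef1 : expect P (fun s => f1 (at_ 0 s)) = (1 + expect P (fun s => f (at_ 0 s))) / 3.
    have bfa : bmfun (fun s => f (at_ 0 s)) by exact: bmfun_at.
    exact: expect_affine.
  move: ps; rewrite -Et E1 Ef1 /psi; lra.
apply: cvg_trans cs; apply: near_eq_cvg; apply: nearW => n.
by rewrite bavg_at.
Qed.

End extremality.

(** * The compensated distance on a tree *)

Section tree.
Variables (M : Type) (N : network M).
Implicit Types (x y o : vert N) (d e : dart N) (s : seq (dart N)).

Fixpoint dwalk s x y : Prop :=
  if s is d :: s' then src d = x /\ dwalk s' (tgt d) y else x = y.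

Definition nonbacktracking s := sorted (fun d e => e != Defs.rev d) s.

Lemma dwalk_walk n x y : walk n x y <-> exists s, size s = n /\ dwalk s x y.
Proof.
elim: n x => [|n IH] x /=.
  split=> [->|[s [/size0nil -> //]]]; by exists [::].
split=> [[d dx /IH[s [sn ws]]]|[s []]].
  by exists (d :: s) => /=; rewrite sn.
by case: s => // d s [sn] [dx ws]; exists d => //; apply/IH; exists s.
Qed.

Lemma dwalk_cat s1 s2 x y :
  dwalk (s1 ++ s2) x y <-> exists z, dwalk s1 x z /\ dwalk s2 z y.
Proof.
elim: s1 x => [|d s1 IH] x /=.
  by split=> [w|[z [-> w]]//]; exists x.
split=> [[dx /IH[z [w1 w2]]]|[z [[dx w1] w2]]].
  by exists z.
by split=> //; apply/IH; exists z.
Qed.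

Lemma tgt_rev d : tgt (Defs.rev d) = src d.
Proof. by rewrite /tgt revK. Qed.

Definition rwalk s := seq.rev (map (@Defs.rev M N) s).

Lemma dwalk_rwalk s x y : dwalk s x y -> dwalk (rwalk s) y x.
Proof.
elim: s x => [|d s IH] x /=; first by move=> ->.
move=> [dx /IH w]; rewrite /rwalk /= rev_cons -cats1; apply/dwalk_cat.
by exists (tgt d); split=> //=; rewrite tgt_rev.
Qed.

Lemma nonbacktracking_rwalk s : nonbacktracking s -> nonbacktracking (rwalk s).
Proof.
move=> nb; rewrite /nonbacktracking /rwalk rev_sorted sorted_map.
apply: sub_sorted nb => d e /=; apply: contraNN => /eqP /(can_inj (@revK _ N)) ->.
by rewrite revK.
Qed.

(** A dart followed by its reverse is cancelled, which only shortens the walk. *)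
Lemma exists_reduced s x y : dwalk s x y -> exists s', [/\ dwalk s' x y,
  nonbacktracking s' & (size s' <= size s)%N].
Proof.
elim: s x => [|d s IH] x /=; first by move=> w; exists [::].
move=> [dx /IH[s' [w nb le]]]; case: s' => [|e s'] in w nb le *.
  by exists [:: d].
have [er|er] := eqVneq e (Defs.rev d).
  exists s'; split; last by rewrite (leq_trans (leqnSn _))// (leq_trans le).
    by case: w => _; rewrite er tgt_rev dx.
  exact: path_sorted nb.
by exists (d :: e :: s'); split=> //=; rewrite er.
Qed.

Hypothesis acyclic : forall c : seq (dart N), ~ is_cycle c.

Lemma dwalk_cycle s x : s != [::] -> dwalk s x x -> path.cycle (fun d e => tgt d == src e) s.
Proof.
have aux d s' y e : dwalk s' (tgt d) y -> src e = y -> path (fun d e => tgt d == src e) d (rcons s' e).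
  elim: s' d => [|f s' IH] d /= => [-> ->|[fx w] ey]; first by rewrite eqxx.
  by rewrite fx eqxx IH.
by case: s => // d s _ /= [dx w]; apply: aux w dx.
Qed.

(** Induction on the length: a repeated source, or a dart together with its reverse, encloses a
    shorter reduced loop; a loop with neither is a cycle. *)
Lemma no_reduced_loop s x : s != [::] -> nonbacktracking s -> ~ dwalk s x x.
Proof.
have [n] := ubnP (size s); elim: n s x => // n IH s x sn s0 nb w.
have nb_infix s1 s2 s3 : s = s1 ++ s2 ++ s3 -> nonbacktracking s2.
  move=> es; move: nb; rewrite /nonbacktracking es => /cat_sorted2[_].
  by move=> /cat_sorted2[].
have uniq_src : uniq [seq src d | d <- s].
  case: (boolP (uniq _)) => // /(uniqPn x)[i [j [ij]]]; rewrite size_map => js.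
  have is_ := ltn_trans ij js.
  have [d0 sd] : exists d0 : dart N, true by case: s s0 {nb_infix nb w js is_ sn} => // d; exists d.
  rewrite !(nth_map d0)// => eij; exfalso.
  have es : s = take i s ++ take (j - i) (drop i s) ++ drop j s.
    rewrite -{1}(cat_take_drop i s) -{1}(cat_take_drop (j - i) (drop i s)) drop_drop.
    by rewrite subnK// ltnW.
  have sz : size (take (j - i) (drop i s)) = (j - i)%N.
    by rewrite size_takel// size_drop leq_sub2r// ltnW.
  move: w; rewrite {1}es => /dwalk_cat[y [_ /dwalk_cat[z [w2 w3]]]].
  have ez : z = src (nth d0 s j).
    by move: w3; rewrite (drop_nth d0)//= => -[].
  have ey : y = src (nth d0 s i).
    move: w2; rewrite (drop_nth d0)//.
    by rewrite -(ltn_predK (_ : 0 < j - i)%N) ?subn_gt0//= => -[].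
  move: w2; rewrite ez -eij -ey; apply: IH.
  - by rewrite sz; lia.
  - by rewrite -size_eq0 sz subn_eq0 -ltnNge.
  - exact: nb_infix es.
apply: (@acyclic s); split=> //; first exact: dwalk_cycle w.
(* The part between [d] and its reverse is a loop at [tgt d]; when it is empty, [d] is immediately
   followed by its reverse. *)
have no_rev s1 s2 s3 d e : e = Defs.rev d -> s <> s1 ++ (d :: s2) ++ (e :: s3).
  move=> ee es; have w' := w; move: w'; rewrite es.
  move=> /dwalk_cat[y [_ /dwalk_cat[z [[_ w2] [ez _]]]]].
  have zt : tgt d = z by rewrite -ez ee.
  rewrite -{}zt in w2; have [s20|s20] := eqVneq s2 [::].
    move: nb; rewrite es /nonbacktracking => /cat_sorted2[_]; rewrite s20 /= ee.
    by rewrite eqxx.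
  apply: (IH s2 (tgt d)) => //.
    by move: sn; rewrite es !size_cat/=; lia.
  by apply: (nb_infix (s1 ++ [:: d]) s2 (e :: s3)); rewrite es -catA.
move=> d ds; apply/negP => rs.
have rds : index (Defs.rev d) s != index d s.
  apply/eqP => /(congr1 (nth d s)); rewrite !nth_index//.
  exact: rev_neq.
have split2 (e f : dart N) : f \in s -> (index e s < index f s)%N ->
    exists s1 s2 s3, s = s1 ++ (e :: s2) ++ f :: s3.
  move=> fs lt; have es : e \in s by rewrite -index_mem (leq_trans lt)// ltnW// index_mem.
  exists (take (index e s) s), (take (index f s - (index e s).+1) (drop (index e s).+1 s)).
  exists (drop (index f s).+1 s).
  have -> : f :: drop (index f s).+1 s = drop (index f s) s.
    by rewrite [RHS](drop_nth f) ?index_mem// nth_index.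
  rewrite -{1}(cat_take_drop (index e s) s)/=.
  rewrite (drop_nth e) ?index_mem// nth_index//; congr (_ ++ _ :: _).
  by rewrite -{1}(cat_take_drop (index f s - (index e s).+1) (drop _ _)) drop_drop subnK.
have [lt|lt|eq] := ltngtP (index (Defs.rev d) s) (index d s).
- have [s1 [s2 [s3]]] := split2 _ _ ds lt; apply: no_rev; by rewrite revK.
- have [s1 [s2 [s3]]] := split2 _ _ rs lt; exact: no_rev.
- by rewrite eq eqxx in rds.
Qed.

(** Past the common beginning, the reverse of one walk followed by the other is a reduced loop. *)
Lemma reduced_unique s1 s2 x y : nonbacktracking s1 -> nonbacktracking s2 ->
  dwalk s1 x y -> dwalk s2 x y -> s1 = s2.
Proof.
elim: s1 s2 x => [|d s1 IH] [|e s2] x nb1 nb2 //=.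
- by move=> -> w; have := @no_reduced_loop (e :: s2) y isT nb2 w.
- by move=> w exy; have := @no_reduced_loop (d :: s1) x isT nb1; rewrite /= {2}exy.
move=> [dx w1] [ex w2].
have [ede|de] := eqVneq e d.
  rewrite ede in nb2 ex w2 *; congr (_ :: _).
  by apply: IH w1 w2; [exact: path_sorted nb1|exact: path_sorted nb2].
exfalso; apply: (@no_reduced_loop (rwalk (d :: s1) ++ e :: s2) y) => //.
- by rewrite -size_eq0 size_cat addnS.
- rewrite /nonbacktracking /rwalk /= rev_cons cat_rcons.
  rewrite sorted_cat_cons /= -rev_cons revK de/= andbC.
  by move: nb2 => /= ->; exact: nonbacktracking_rwalk nb1.
- apply/dwalk_cat; exists x; split; last by [].
  by apply: dwalk_rwalk.
Qed.

Lemma reduced_size s x y : connected_net N -> nonbacktracking s -> dwalk s x y ->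
  size s = dist x y.
Proof.
move=> cN nb w; have [/dwalk_walk[s1 [sz w1]] min] := distP x y cN.
have [s2 [w2 nb2 le]] := exists_reduced w1.
have e := reduced_unique nb nb2 w w2; apply/eqP; rewrite eqn_leq.
rewrite e -{1}sz le -e /=.
by apply: min; apply/dwalk_walk; exists s.
Qed.

(** [p] is the reverse of the last dart of the reduced walk from [o] to [x]; any other dart out of
    [x] extends that walk to a reduced one. *)
Lemma tree_step o x : connected_net N -> x <> o -> exists p, [/\ src p = x,
  (dist o (tgt p)).+1 = dist o x &
  forall d, src d = x -> d != p -> dist o (tgt d) = (dist o x).+1].
Proof.
move=> cN xo; have [/dwalk_walk[s0 [_ w0]] _] := distP o x cN.
have [s [w nb _]] := exists_reduced w0.
case/lastP: s => [|s e] in w nb *; first by case: xo.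
have eD := reduced_size cN nb w.
have w' := w; move: w'; rewrite -cats1 => /dwalk_cat[z [ws /= [ez tx]]].
exists (Defs.rev e); split.
- exact: tx.
- rewrite tgt_rev ez -eD size_rcons; congr _.+1; apply/esym/reduced_size => //.
  by move: nb; rewrite /nonbacktracking -cats1 => /cat_sorted2[].
move=> d dx de; rewrite -eD -(size_rcons _ d); apply/esym/reduced_size => //.
  rewrite /nonbacktracking -cats1 cat_rcons sorted_cat_cons.
  by move: nb; rewrite /nonbacktracking => ->; rewrite /= de.
by rewrite -cats1; apply/dwalk_cat; exists x.
Qed.

Lemma tree_step0 o d : connected_net N -> src d = o -> dist o (tgt d) = 1%N.
Proof.
move=> cN dx; apply/esym; apply: (@reduced_size [:: d]) => //=.
Qed.
End tree.

Section tree_invariance.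
Variables (M : Type).

Definition tree_net (N : network M) := is_tree N /\ infinite_set [set: vert N].

Lemma net_iso_cycle (N N' : network M) f g (c : seq (dart N)) :
  @net_iso M eq N N' f g -> is_cycle c -> is_cycle (map g c).
Proof.
move=> fg [c0 cyc uc rc]; have [bf bg _ _] := fg; split.
- by case: c c0 {cyc uc rc}.
- case: c cyc {c0 uc rc} => // d c /=; rewrite -map_rcons path_map.
  apply: sub_path => a b /eqP ab /=.
  by rewrite (net_iso_tgt fg) (net_iso_src fg) ab.
- rewrite -map_comp (eq_map (g := f \o src)); last by move=> d /=; rewrite (net_iso_src fg).
  by rewrite map_comp map_inj_uniq//; exact: bij_inj.
move=> _ /mapP[d dc ->]; rewrite (net_iso_rev fg) mem_map; first exact: rc.
exact: bij_inj.
Qed.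

Lemma net_iso_tree (N N' : network M) f g :
  @net_iso M eq N N' f g -> tree_net N' -> tree_net N.
Proof.
move=> fg [[cN aN] iN]; have [bf _ _ _] := fg; split; [split|].
- by move=> x y; have [n] := cN (f x) (f y) => /(net_iso_walk fg); exists n.
- by move=> c /(net_iso_cycle fg)/aN.
move=> fin; apply: iN; have [f' fK f'K] := bf.
rewrite (_ : setT = f @` setT); first exact: finite_image.
by apply/seteqP; split=> // y _; exists (f' y).
Qed.

Lemma tree_net_cls (I : Type) (N : rnet M I) : tree_net (rep (cls N)) <-> tree_net N.
Proof.
have [f [g [fg _]]] := cls_iso (rep_cls N).
have [f' [g' [fg' _]]] := cls_iso (esym (rep_cls N)).
by split; [exact: net_iso_tree fg'|exact: net_iso_tree fg].
Qed.

Lemma infinite_deg_gt0 (N : network M) (x : vert N) : connected_net N ->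
  locally_finite N -> infinite_set [set: vert N] -> (0 < deg x)%N.
Proof.
move=> cN lf iN; have [y yx] : exists y, y <> x.
  apply: contrapT => h; apply: iN; apply: sub_finite_set (finite_set1 x) => y _ /=.
  by apply: contrapT => yx; apply: h; exists y.
have [[|n] /=] := cN x y => [xy|[d dx _]]; first by case: yx.
by rewrite cardfs_gt0; apply/fset0Pn; exists d; rewrite in_fset_set ?inE.
Qed.

End tree_invariance.

(** * Centred increments of the distance and their exponential martingales *)

Section increments.
Variables (R : realType) (M : completeMetricType R).
Implicit Types n : nat.

(* The distance to the root increases by 1 along every dart, except along the *)
(* one pointing towards the root, which exists away from the root.            *)
Definition drift n (h : netclass M 'I_n.+1) : R :=
  1 - 2 * (distc ord0 ord_max h != 0%N)%:R / (degc ord_max h)%:R.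

Definition init n : netclass M 'I_n.+1 -> netclass M 'I_n := pull (lift ord_max).

Definition incr n (h : netclass M 'I_n.+2) : R :=
  (distc ord0 ord_max h)%:R - (distc ord0 ord_max (init h))%:R - drift (init h).

(** The absolute values make the product nonnegative on every network, so that it can be integrated
    without further conditions; on a tree with [|lam| <= 1/4] the factors met by the walk are
    positive already. *)
Fixpoint mart (lam : R) n : netclass M 'I_n.+1 -> R :=
  if n is n'.+1 then fun h => mart lam (init h) * `|1 + lam * incr h| else fun=> 1.

Lemma init_addr n (N : rnet M 'I_n) x : init (cls (addr (N := N) x)) = cls N.
Proof.
rewrite /init pullE; transitivity (cls (reroot (root N))).
  by congr (cls (reroot _)); apply/funext => i; rewrite /= liftK.
by rewrite /reroot; case: N x.
Qed.

Lemma init_segment n (t : Trajectory M) : init (segment n.+1 t) = segment n t.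
Proof.
rewrite {1}/init (segment_pull (u := fun i => i)) -?segmentE//.
by move=> i; rewrite lift_max.
Qed.

Lemma measurable_init n : measurable_fun setT (@init n : Gspace M n.+1 -> Gspace M n).
Proof. exact: measurable_pull. Qed.

Lemma measurable_drift n : measurable_fun setT (@drift n : Gspace M n.+1 -> R).
Proof.
apply: measurable_funB => //; apply: measurable_funM; first apply: measurable_funM => //.
  apply: (measurable_locally_determined (fun j : nat => (j != 0%N)%:R : R)).
  exact: distc_determined.
apply: (measurable_locally_determined (fun j : nat => (j%:R)^-1 : R)%R).
exact: degc_determined.
Qed.

Lemma measurable_distc n (i j : 'I_n) :
  measurable_fun setT (fun h : Gspace M n => (distc i j h)%:R : R).
Proof.
apply: (measurable_locally_determined (fun j : nat => j%:R : R)).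
exact: distc_determined.
Qed.

Lemma measurable_incr n : measurable_fun setT (@incr n : Gspace M n.+2 -> R).
Proof.
apply: measurable_funB; first apply: measurable_funB.
- exact: measurable_distc.
- apply: (measurableT_comp (@measurable_distc n.+1 ord0 ord_max) (@measurable_init n.+1)).
- exact: (measurableT_comp (@measurable_drift n) (@measurable_init n.+1)).
Qed.

Lemma mart_ge0 lam n h : 0 <= @mart lam n h.
Proof. by elim: n h => [//|n IH] h /=; rewrite mulr_ge0. Qed.

Lemma measurable_mart lam n : measurable_fun setT (@mart lam n : Gspace M n.+1 -> R).
Proof.
elim: n => [|n IH] /=; first exact: measurable_cst.
apply: measurable_funM; first exact: (measurableT_comp IH (@measurable_init n.+1)).
apply: measurableT_comp => //; apply: measurable_funD => //.
by apply: measurable_funM => //; exact: measurable_incr.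
Qed.

(** The last factor averages to 1 over the [D] darts at [x]: away from [o] one increment is
    [-2 + 2 / D] and the other [D - 1] are [2 / D], with sum 0; at [o] all are 0. *)
Lemma step_op_mart lam n (N : rnet M 'I_n.+1) : `|lam| <= 4^-1 -> tree_net N ->
  step_op (fun h => (@mart lam n.+1 h)%:E) (cls N) = (mart lam (cls N))%:E.
Proof.
move=> lam4 [[cN aN] iN]; have lf := net_locfin N.
set o := root N ord0; set x := root N ord_max.
have dx : (0 < deg x)%N by exact: infinite_deg_gt0.
pose b := drift (cls N).
have bE : b = 1 - 2 * (x != o)%:R / (deg x)%:R.
  by rewrite /b /drift distcE degcE dist0// eq_sym.
pose G y := `|1 + lam * ((dist o y)%:R - (dist o x)%:R - b)|.
rewrite step_opE.
transitivity (\esum_(y in [set: vert N])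
    (((mart lam (cls N)) / (deg x)%:R)%:E * ((cnt x y)%:R%:E * (G y)%:E)))%E.
  apply: eq_esum => y _; rewrite /= init_addr -!EFinM; congr (_%:E).
  rewrite /incr init_addr !distcE root_addr_max -/o -/x -/b.
  have -> : root (addr (N := N) y) ord0 = o.
    by rewrite /o -(root_addr_lift y ord0); congr (root _ _); exact: val_inj.
  rewrite /step_prob -/(cnt x y) -/(G y); ring.
rewrite esumZl; last 2 first.
- by rewrite divr_ge0 ?mart_ge0.
- by move=> y; rewrite -EFinM lee_fin mulr_ge0 ?normr_ge0.
have G0 y : (0 <= (G y)%:E)%E by rewrite lee_fin normr_ge0.
rewrite (esum_darts x (F := fun y => (G y)%:E))//.
suff -> : (\esum_(d in [set d : dart N | src d = x]) (G (tgt d))%:E = (deg x)%:R%:E)%E.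
  by rewrite -EFinM mulfVK// pnatr_eq0 -lt0n.
rewrite esum_fset//.
rewrite fsbig_finite//= sumEFin; congr (_%:E).
have Gin c : 0 <= 1 + lam * c -> forall y, (dist o y)%:R - (dist o x)%:R - b = c -> G y = 1 + lam * c.
  by move=> c0 y yc; rewrite /G yc ger0_norm.
have [xo|/eqP xo] := eqVneq x o.
  have b1 : b = 1 by rewrite bE xo eqxx/= mulr0 mul0r subr0.
  have o0 : dist o x = 0%N by apply/eqP; rewrite dist0// xo.
  rewrite (eq_big_seq (fun=> 1)); last first.
    move=> d; rewrite in_fset_set// => /set_mem/= sd.
    rewrite (Gin 0) ?mulr0 ?addr0 ?ler01//.
    by rewrite (tree_step0 aN)// ?sd// o0 b1 subr0 subrr.
  by rewrite big_const_seq count_predT iter_addr_0.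
have [p [sp dp others]] := tree_step aN cN xo.
have pS : p \in fset_set [set d | src d = x] by rewrite in_fset_set//; apply/mem_set.
set D : R := (deg x)%:R; have D1 : 1 <= D by rewrite ler1n.
have bE' : b = 1 - 2 / D by rewrite bE; move/eqP: xo => ->; rewrite mulr1.
have Di : 0 < D^-1 <= 1 by rewrite invr_gt0 (lt_le_trans ltr01)//= invf_le1 ?(lt_le_trans ltr01).
have lamP : - 4^-1 <= lam <= 4^-1 by rewrite -ler_norml.
rewrite (big_fsetD1 p)//= (Gin (-2 + 2 / D)); last 2 first.
- move: Di lamP; move: (D^-1) => q; nra.
- by rewrite bE' -dp -natr1; ring.
rewrite (eq_big_seq (fun=> 1 + lam * (2 / D))); last first.
  move=> d; rewrite in_fsetD1 in_fset_set// => /andP[dnp /set_mem/= sd].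
  rewrite (Gin (2 / D))//.
    move: Di lamP; move: (D^-1) => q; nra.
  by rewrite others// bE' -natr1; ring.
rewrite big_const_seq count_predT iter_addr_0 -[X in _ + X = _]mulr_natl.
have -> : (size (fset_set [set d | src d = x] `\ p)%fset)%:R = D - 1.
  by rewrite /D /deg [in RHS](cardfsD1 p) pS natrD /= addrAC subrr add0r.
have D0 : D != 0 by rewrite gt_eqF// (lt_le_trans ltr01).
by field.
Qed.

End increments.

Lemma walk_rcons (M : Type) (N : network M) n (x : vert N) d :
  walk n x (src d) -> walk n.+1 x (tgt d).
Proof.
by elim: n x => [|n IH] x /= => [->|[e ex w]]; [exists d|exists e => //; exact: IH].
Qed.

Lemma dist_adjacent (M : Type) (N : network M) (o : vert N) d :
  connected_net N -> (dist o (tgt d) <= (dist o (src d)).+1)%N.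
Proof.
move=> cN; have [w _] := distP o (src d) cN.
by apply: (distP o (tgt d) cN).2; exact: walk_rcons.
Qed.

Section law.
Variables (R : realType) (M : completeMetricType R).
Variables (mu : probability (Gstar M) R) (P : probability (Trajectory M) R).
Hypothesis muP : walk_law mu P.

Lemma ae_segment n (A : set (Gspace M n.+1)) : measurable A ->
  (\int[P]_t (\1_A (segment n t))%:E = 0)%E -> {ae P, forall t : Trajectory M, ~ A (segment n t)}.
Proof.
move=> mA A0; exists (@segment R M n @^-1` A); split.
- by rewrite -[X in measurable X]setTI; exact: measurable_segment.
- by rewrite (prob_segment P mA).
- by move=> t /= /contrapT.
Qed.

Lemma trajectory_tree : {ae mu, forall g, infinite_tree g} ->
  {ae P, forall t : Trajectory M, tree_net (rep t)}.
Proof.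
move=> [A [mA A0 sA]].
have : {ae P, forall t : Trajectory M, ~ A (segment 0 t)}.
  apply: ae_segment => //.
  rewrite (walk_expectation muP (n := 0) (F := fun g => (\1_A g)%:E)); last 2 first.
  - by apply/measurable_EFinP; exact: measurable_indic.
  - by move=> g; rewrite lee_fin.
  rewrite -[RHS](@integral0 _ _ _ mu setT); apply: ge0_ae_eq_integral => //.
  - apply: emeasurable_funM; apply/measurable_EFinP; first exact: measurable_bias.
    exact: measurable_indic.
  - by move=> g _; apply: mule_ge0; rewrite lee_fin ?bias_ge0.
  exists A; split=> // g /= gA; apply: contrapT => nA; apply: gA => _.
  by rewrite indicE memNset// mule0.
apply: filterS => t nA; apply: contrapT => nt; apply: nA; apply: sA => it; apply: nt.
by apply/(tree_net_cls (reroot (fun i : 'I_1 => root (rep t) i))).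
Qed.

Definition adjacent_path (t : Trajectory M) := forall n, exists2 d : dart (rep t),
  src d = root (rep t) n & tgt d = root (rep t) n.+1.

Lemma trajectory_adjacent : {ae P, forall t : Trajectory M, adjacent_path t}.
Proof.
apply: ae_foralln => n.
pose A : set (Gspace M n.+2) := [set h | cntc (penult n) ord_max h = 0%N].
have mA : measurable A.
  exact: (@locally_determined_measurable R M nat n.+2 _ [set 0%N] (@cntc_determined R M n.+2 (penult n) ord_max)).
have : {ae P, forall t : Trajectory M, ~ A (segment n.+1 t)}.
  apply: ae_segment => //.
  rewrite (expectation_step muP (F := fun g => (\1_A g)%:E)); last 2 first.
  - by apply/measurable_EFinP; exact: measurable_indic.
  - by move=> g; rewrite lee_fin.
  apply: integral0_eq => t _; rewrite -(cls_rep (segment n t)) step_opE.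
  apply: esum1 => x _; rewrite indicE.
  have [|] := boolP (_ \in A); last by rewrite mule0.
  move=> /set_mem; rewrite /A /= cntcE root_addr_max root_addr_lift => c0.
  by rewrite /step_prob -/(cnt _ _) c0 mul0r mul0e.
apply: filterS => t /eqP; rewrite /A cntcE -lt0n /cnt cardfs_gt0.
move=> /fset0Pn[d]; rewrite in_fset_set; last first.
  by apply: sub_finite_set (net_locfin (rep t) (root (rep t) (penult n))) => e [].
move=> /set_mem[sd td]; exists d; last exact: td.
have e : penult n = n :> nat by rewrite lift_max.
have : src d = root (rep t) (penult n) by exact: sd.
by rewrite e.
Qed.

Hypothesis mu_trees : {ae mu, forall g, infinite_tree g}.

Lemma expectation_mart lam n : `|lam| <= 4^-1 ->
  (\int[P]_t (mart lam (segment n t))%:E = 1%:E)%E.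
Proof.
move=> lam4; elim: n => [|n <-].
  by rewrite /= integral_cst// [X in (_ * X)%E](probability_setT P) mule1.
have mm k : measurable_fun setT (fun g : Gspace M k.+1 => (mart lam g)%:E).
  by apply/measurable_EFinP; exact: measurable_mart.
rewrite (expectation_step muP (F := fun g => (mart lam g)%:E))//; last first.
  by move=> h; rewrite lee_fin mart_ge0.
apply: ge0_ae_eq_integral => //.
- have ms : measurable_fun setT (step_op (fun g => (mart lam g)%:E) : Gspace M n.+1 -> \bar R).
    by apply: measurable_step_op => // h; rewrite lee_fin mart_ge0.
  exact: (measurableT_comp ms (@measurable_segment R M n)).
- exact: (measurableT_comp (mm n) (@measurable_segment R M n)).
- by move=> t _; apply: step_op_ge0 => h; rewrite lee_fin mart_ge0.
- by move=> t _; rewrite lee_fin mart_ge0.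
apply: filterS (trajectory_tree mu_trees) => t tt _.
exact: (step_op_mart (N := reroot (fun i : 'I_n.+1 => root (rep t) i))).
Qed.

(** Since [mart] has mean 1, the series of the [q^n * mart] with [q = exp(-d)] has finite
    expectation, so almost surely its sum is finite and bounds each term. *)
Lemma mart_growth lam (d : R) : `|lam| <= 4^-1 -> 0 < d ->
  {ae P, forall t : Trajectory M, exists c, forall n, mart lam (segment n t) <= expR (c + d * n%:R)}.
Proof.
move=> lam4 d0; set q := expR (- d).
have q0 : 0 < q by exact: expR_gt0.
have q1 : q < 1 by rewrite /q -expR0 ltr_expR oppr_lt0.
pose f n (t : Trajectory M) : \bar R := (q ^+ n * mart lam (segment n t))%:E.
have f0 n t : (0 <= f n t)%E by rewrite lee_fin mulr_ge0 ?mart_ge0// exprn_ge0// ltW.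
have mf n : measurable_fun setT (f n).
  apply/measurable_EFinP; apply: measurable_funM => //.
  exact: (measurableT_comp (@measurable_mart R M lam n) (@measurable_segment R M n)).
have fint : (\int[P]_t \sum_(n <oo) f n t <= ((1 - q)^-1)%:E)%E.
  rewrite integral_nneseries//.
  have fi n : (\int[P]_t f n t)%E = (q ^+ n)%:E.
    rewrite /f; under eq_integral do rewrite EFinM.
    rewrite ge0_integralZl_EFin ?expectation_mart ?mule1//.
    - by move=> t _; rewrite lee_fin mart_ge0.
    - apply/measurable_EFinP; exact: (measurableT_comp (@measurable_mart R M lam n) (@measurable_segment R M n)).
    - by rewrite exprn_ge0// ltW.
  rewrite (eq_eseriesr (fun i _ => fi i)); apply: lime_le; first by apply: is_cvg_nneseries => n _ _; rewrite lee_fin exprn_ge0// ltW.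
  apply: nearW => n; rewrite sumEFin lee_fin big_mkord.
  rewrite -[leRHS]div1r ler_pdivlMr ?subr_gt0// mulrC.
  have : (1 - q) * (\sum_(i < n) q ^+ i) = 1 - q ^+ n by rewrite -opprB mulNr -subrX1 opprB.
  by move=> ->; rewrite gerBl exprn_ge0// ltW.
have int : P.-integrable setT (fun t => \sum_(n <oo) f n t)%E.
  apply/integrableP; split; first exact: ge0_emeasurable_sum.
  under eq_integral do rewrite gee0_abs ?nneseries_ge0//.
  exact: le_lt_trans fint (ltry _).
apply: filterS (integrable_ae measurableT int) => t /(_ I) tfin.
set s := fine (\sum_(n <oo) f n t)%E.
have s0 : 0 <= s by apply: fine_ge0; exact: nneseries_ge0.
exists (ln (1 + s)) => n; rewrite expRD lnK ?posrE ?ltr_wpDr//.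
have le : q ^+ n * mart lam (segment n t) <= s.
  rewrite -lee_fin /s fineK//; apply: le_trans (nneseries_lim_ge n.+1 _) => //=.
  by rewrite big_nat_recr//= leeDr// sume_ge0.
have -> : expR (d * n%:R) = (q ^+ n)^-1.
  by rewrite /q expRN exprVn invrK -expRM_natr.
rewrite ler_pdivlMr ?exprn_gt0// mulrC; lra.
Qed.
End law.

Section real_exp.
Variable R : realType.

(** The exponential of [2 x^2 - x] is at least [1 + 2 x^2 - x], and its product with [1 + x] is at
    least [1 + x^2 (1 + 2 x)], which is at least 1. *)
Lemma expR_le1D (x : R) : `|x| <= 2^-1 -> expR (x - 2 * x ^+ 2) <= 1 + x.
Proof.
rewrite ler_norml => /andP[xl xu].
have h : expR (x - 2 * x ^+ 2) = (expR (2 * x ^+ 2 - x))^-1 by rewrite -expRN opprB.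
have e1 := expR_ge1Dx (2 * x ^+ 2 - x).
rewrite h -[leLHS]div1r ler_pdivrMr ?expR_gt0//.
apply: (@le_trans _ _ ((1 + x) * (1 + (2 * x ^+ 2 - x)))); first nra.
by apply: ler_wpM2l => //; lra.
Qed.

(** [expR_le1D] at [lam * x]: the 8 bounds [2 x^2] for [|x| <= 2]. *)
Lemma expR_le1DM (lam x : R) : `|lam| <= 4^-1 -> `|x| <= 2 ->
  expR (lam * x - 8 * lam ^+ 2) <= `|1 + lam * x|.
Proof.
move=> l4 x2; have lx : `|lam * x| <= 2^-1.
  by rewrite normrM; have := normr_ge0 lam; have := normr_ge0 x; nra.
apply: (le_trans _ (ler_norm _)); apply: le_trans (expR_le1D lx).
rewrite ler_expR lerD2l lerN2.
have : x ^+ 2 <= 4 by move: x2; rewrite ler_norml => /andP[? ?]; nra.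
rewrite exprMn; have := sqr_ge0 lam; nra.
Qed.

End real_exp.

Section compensated.
Variables (R : realType) (M : completeMetricType R).
Implicit Types t : Trajectory M.

Definition walk_dist t k : nat := dist (root (rep t) 0%N) (root (rep t) k).

Lemma distc_segment t k : distc ord0 ord_max (segment k t) = walk_dist t k.
Proof. by rewrite distcE. Qed.

Lemma degc_segment t k : degc ord_max (segment k t) = deg (root (rep t) k).
Proof. by rewrite degcE. Qed.

Lemma incr_segment t k : incr (segment k.+1 t) =
  (walk_dist t k.+1)%:R - (walk_dist t k)%:R - drift (segment k t) :> R.
Proof. by rewrite /incr init_segment !distc_segment. Qed.

(** On trees, the martingale part of the distance in its Doob decomposition. *)
Definition compensated t n : R := \sum_(k < n) incr (segment k.+1 t).

Lemma compensatedE t n : compensated t n =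
  (walk_dist t n)%:R - \sum_(k < n) drift (segment k t).
Proof.
rewrite /compensated; elim: n => [|n IH].
  rewrite !big_ord0 subr0 /walk_dist; have /eqP -> // : dist (root (rep t) 0%N) (root (rep t) 0%N) == 0%N.
  by rewrite dist0//; exact: net_connected.
by rewrite !big_ord_recr/= IH incr_segment; ring.
Qed.

Lemma adjacent_walk_dist t k : adjacent_path t ->
  (walk_dist t k.+1 <= (walk_dist t k).+1)%N /\ (walk_dist t k <= (walk_dist t k.+1).+1)%N.
Proof.
move=> /(_ k)[d sd td]; have cN := net_connected (rep t).
split; rewrite /walk_dist -sd -td; first exact: dist_adjacent.
rewrite -[X in dist _ (src X)](revK d); have := dist_adjacent (root (rep t) 0%N) (Defs.rev d) cN.
by rewrite tgt_rev revK.
Qed.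

Lemma drift_bound k t : tree_net (rep t) -> -1 <= (drift (segment k t) : R) <= 1.
Proof.
move=> [[cN _] iN]; rewrite /drift degc_segment.
have /(_ (net_locfin _)) := infinite_deg_gt0 (root (rep t) k) cN; move=> /(_ iN) d0.
have : 0 <= ((distc ord0 ord_max (segment k t) != 0%N)%:R / (deg (root (rep t) k))%:R : R) <= 1.
  apply/andP; split; first by rewrite divr_ge0.
  rewrite ler_pdivrMr ?ltr0n// mul1r ler_nat.
  by apply: leq_trans d0; case: (_ != _).
by rewrite -mulrA; move: (_ / _) => q; lra.
Qed.

Lemma incr_bound k t : tree_net (rep t) -> adjacent_path t ->
  `|incr (segment k.+1 t)| <= 2 :> R.
Proof.
move=> tt ta; rewrite incr_segment; have := drift_bound k tt.
have [] := adjacent_walk_dist k ta.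
rewrite -!(ler_nat R) -!natr1 ler_norml; lra.
Qed.

Lemma expR_mart lam n t : `|lam| <= 4^-1 -> tree_net (rep t) -> adjacent_path t ->
  expR (lam * compensated t n - 8 * lam ^+ 2 * n%:R) <= mart lam (segment n t).
Proof.
move=> l4 tt ta; elim: n => [|n IH].
  by rewrite /compensated big_ord0 !mulr0 subrr expR0.
rewrite [leRHS]/= init_segment /compensated big_ord_recr/= -/(compensated t n).
rewrite (_ : _ - _ = (lam * compensated t n - 8 * lam ^+ 2 * n%:R) +
  (lam * incr (segment n.+1 t) - 8 * lam ^+ 2)); last by rewrite -natr1; ring.
rewrite expRD; apply: ler_pM; rewrite ?expR_ge0//.
by apply: expR_le1DM => //; exact: incr_bound.
Qed.

End compensated.

Section law.
Variables (R : realType) (M : completeMetricType R).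
Variables (mu : probability (Gstar M) R) (P : probability (Trajectory M) R).
Hypothesis muP : walk_law mu P.
Hypothesis mu_trees : {ae mu, forall g, infinite_tree g}.

(** The lower bound [expR_mart] meets [mart_growth] at rate [lam^2]; hence 9 = 8 + 1. *)
Lemma compensated_bound lam : `|lam| <= 4^-1 -> 0 < lam ^+ 2 ->
  {ae P, forall t : Trajectory M, exists c, forall n, lam * compensated t n <= c + 9 * lam ^+ 2 * n%:R}.
Proof.
move=> l4 l0; have h := mart_growth muP mu_trees l4 l0.
apply: filterS3 h (trajectory_tree muP mu_trees) (trajectory_adjacent muP) => t [c cP] tt ta.
exists c => n; have := le_trans (expR_mart n l4 tt ta) (cP n).
by rewrite ler_expR; lra.
Qed.

(** Dividing [compensated_bound] by [lam], for [lam = l] and [lam = -l], bounds the sum by [9 l n]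
    plus a constant on both sides; countably many [l] suffice. *)
Lemma compensated_cvg : {ae P, forall t : Trajectory M, (compensated t n / n%:R) @[n --> \oo] --> (0 : R)}.
Proof.
have l4 m : `|m.+4%:R^-1| <= 4^-1 :> R.
  by rewrite ger0_norm// lef_pV2 ?posrE ?ltr0n// ler_nat.
have lp m : 0 < m.+4%:R^-1 ^+ 2 :> R by rewrite exprn_gt0// invr_gt0 ltr0n.
have up : {ae P, forall t : Trajectory M, forall m, exists c, forall n,
    m.+4%:R^-1 * compensated t n <= c + 9 * m.+4%:R^-1 ^+ 2 * n%:R :> R}.
  by apply: ae_foralln => m; exact: compensated_bound.
have lo : {ae P, forall t : Trajectory M, forall m, exists c, forall n,
    - m.+4%:R^-1 * compensated t n <= c + 9 * (- m.+4%:R^-1) ^+ 2 * n%:R :> R}.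
  by apply: ae_foralln => m; apply: compensated_bound; rewrite ?normrN// sqrrN.
apply: filterS2 up lo => t up lo; apply/cvgrPdist_le => e e0.
(* The slope [9 l], and one more [l] that absorbs the constants for large [n], must not exceed
   [e]. *)
pose m := Num.truncn (10 / e); set l : R := m.+4%:R^-1.
have l0 : 0 < l by rewrite invr_gt0 ltr0n.
have le : 10 * l <= e.
  rewrite /l ler_pdivrMr ?ltr0n// mulrC -ler_pdivrMr//.
  rewrite (le_trans (ltW (truncnS_gt (10 / e))))// ler_nat /m !ltnS; exact: leq_trans (leqnSn _) (leq_trans (leqnSn _) (leqnSn _)).
have [c1 up1] := up m; have [c2 lo2] := lo m.
have [K cK] : exists K : nat, (0 < K)%N /\ `|c1| + `|c2| <= l ^+ 2 * K%:R.
  exists (Num.truncn ((`|c1| + `|c2|) / l ^+ 2)).+1; split=> //.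
  rewrite mulrC -ler_pdivrMr ?exprn_gt0// ltW// truncnS_gt//.
exists K => // n /= Kn; have [K0 cc] := cK.
have n0 : 0 < n%:R :> R by rewrite ltr0n; lia.
rewrite sub0r normrN normrM normfV (ger0_norm (ltW n0)) ler_pdivrMr//.
have Kn' : K%:R <= n%:R :> R by rewrite ler_nat.
have c1n : c1 <= l ^+ 2 * n%:R.
  apply: le_trans (ler_norm _) _; apply: le_trans (_ : _ <= `|c1| + `|c2|) _; first by rewrite lerDl.
  by apply: le_trans cc _; rewrite ler_wpM2l// exprn_ge0// ltW.
have c2n : c2 <= l ^+ 2 * n%:R.
  apply: le_trans (ler_norm _) _; apply: le_trans (_ : _ <= `|c1| + `|c2|) _; first by rewrite lerDr.
  by apply: le_trans cc _; rewrite ler_wpM2l// exprn_ge0// ltW.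
have := up1 n; have := lo2 n; rewrite -/l sqrrN => lo' up'.
have le' : 10 * l * n%:R <= e * n%:R by rewrite ler_wpM2r// ltW.
have up2 : l * compensated t n <= l * (10 * l * n%:R).
  by apply: le_trans up' _; move: c1n; rewrite expr2; nra.
have lo3 : l * - compensated t n <= l * (10 * l * n%:R).
  rewrite mulrN -mulNr; apply: le_trans lo' _; move: c2n; rewrite expr2; nra.
rewrite ler_norml; move: up2 lo3; rewrite !ler_pM2l// => ? ?; apply/andP; split; lra.
Qed.

End law.

(** * The speed *)

Section linear_growth.
Variable R : realType.
Implicit Types (X : nat -> R) (c : R) (D : nat -> nat).

Lemma linear_bound X c : X n / n%:R @[n --> \oo] --> c ->
  forall e, 0 < e -> exists C, forall n, `|X n - c * n%:R| <= e * n%:R + C.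
Proof.
move=> /cvgrPdist_le Xc e e0; have [K _ XK] := Xc e e0.
exists (\sum_(k < K.+1) `|X k - c * k%:R|) => n.
have [nK|Kn] := ltnP n K.+1.
  rewrite (bigD1 (Ordinal nK))//= addrCA lerDl addr_ge0 ?sumr_ge0//.
  by rewrite mulr_ge0// ltW.
apply: (@le_trans _ _ (e * n%:R)); last by rewrite lerDl sumr_ge0.
have n0 : 0 < n%:R :> R by rewrite ltr0n (leq_trans _ Kn).
have := XK n (ltnW Kn); rewrite /= -{1}(mulfK (lt0r_neq0 n0) c) -mulrBl normrM normfV.
by rewrite (ger0_norm (ltW n0)) ler_pdivrMr// distrC.
Qed.

Lemma linear_cvg X c :
  (forall e, 0 < e -> exists C, forall n, `|X n - c * n%:R| <= e * n%:R + C) ->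
  X n / n%:R @[n --> \oo] --> c.
Proof.
move=> h; apply/cvgrPdist_le => e e0; have [C XC] := h (e / 2) (divr_gt0 e0 (ltr0n R 2)).
exists (Num.truncn (C / (e / 2))).+1 => // n /= Cn.
have n0 : 0 < n%:R :> R by rewrite ltr0n; exact: leq_trans Cn.
have {}Cn : C <= e / 2 * n%:R.
  rewrite mulrC -ler_pdivrMr ?divr_gt0//; apply: le_trans (ltW (truncnS_gt _)) _.
  by rewrite ler_nat.
rewrite -(mulfK (lt0r_neq0 n0) c) -mulrBl normrM normfV (ger0_norm (ltW n0)).
by rewrite ler_pdivrMr// distrC (le_trans (XC n))//; lra.
Qed.

Definition zeros D n : nat := \sum_(k < n) (D k == 0%N).

(** [zeros] counts strictly earlier times: the visit at time [m] itself is missing from [zeros D m],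
    which explains the successor. *)
Lemma last_zero D n : D 0%N = 0%N ->
  exists m, [/\ (m <= n)%N, D m = 0%N & (zeros D n <= (zeros D m).+1)%N].
Proof.
move=> D0; elim: n => [|n [m [mn Dm Zm]]]; first by exists 0%N.
have [Dn|Dn] := eqVneq (D n) 0%N.
  by exists n; split=> //; rewrite {1}/zeros big_ord_recr/= Dn eqxx addn1.
exists m; split=> //; first exact: leqW.
by rewrite {1}/zeros big_ord_recr/= (negbTE Dn) addn0.
Qed.

(* After its last visit to 0, [D] has the increments of [X]. *)
Lemma reflected_cvg D X (v c : R) : 0 <= v <= 1 -> 0 <= c -> D 0%N = 0%N ->
  (forall n, (D n)%:R = X n + 2 * v * (zeros D n)%:R) ->
  X n / n%:R @[n --> \oo] --> c -> (D n)%:R / n%:R @[n --> \oo] --> c.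
Proof.
move=> /andP[v0 v1] c0 D0 DX /linear_bound Xc; apply: linear_cvg => e e0.
have [C XC] := Xc (e / 2) (divr_gt0 e0 (ltr0n R 2)).
(* One [C] for each of the times [m] and [n], and at most 2 for the visit at time [m], as
   [v <= 1]. *)
exists (2 * C + 2) => n; have [m [mn Dm Zm]] := last_zero n D0.
have mn' : m%:R <= n%:R :> R by rewrite ler_nat.
have m0 : 0 <= m%:R :> R by [].
have Z0 : 0 <= (zeros D n)%:R :> R by [].
have := DX m; rewrite Dm => Xm; have := XC n; have := XC m; rewrite !ler_norml.
have : 2 * v * (zeros D n)%:R <= 2 * v * (zeros D m)%:R + 2.
  apply: (@le_trans _ _ (2 * v * ((zeros D m)%:R + 1))).
    by rewrite ler_wpM2l ?mulr_ge0// natr1 ler_nat.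
  by rewrite mulrDr lerD2l mulr1; lra.
have : 0 <= 2 * v * (zeros D n)%:R by rewrite !mulr_ge0.
have : c * m%:R <= c * n%:R by exact: ler_wpM2l.
have : 0 <= c * m%:R by exact: mulr_ge0.
have : e / 2 * m%:R <= e / 2 * n%:R by rewrite ler_wpM2l// divr_ge0// ltW.
have : 0 <= e / 2 * m%:R by rewrite mulr_ge0// divr_ge0// ltW.
have := DX n; move: (2 * v * (zeros D n)%:R) (2 * v * (zeros D m)%:R) Xm => q1 q2 Xm.
move=> -> h1 h2 h3 h4 h5 h6 /andP[h7 h8] /andP[h9 h10]; apply/andP; split; lra.
Qed.

End linear_growth.

Section shifts.
Variables (R : realType) (M : completeMetricType R).
Implicit Types t : Trajectory M.

Lemma iter_shift i t : iter i (@shift R M) t = cls (reroot (fun k => root (rep t) (i + k))).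
Proof.
elim: i => [|i IH]; first by rewrite -[LHS]cls_rep; case: (rep t).
rewrite iterS IH /shift pullE; congr (cls (reroot _)).
apply/funext => k; congr (root (rep t) _); exact/esym/addSnnS.
Qed.

Lemma walk_dist_iter i t k : walk_dist (iter i (@shift R M) t) k =
  dist (root (rep t) i) (root (rep t) (i + k)).
Proof.
rewrite iter_shift /walk_dist; set N := reroot _.
have [f [g [fg fr]]] := cls_iso (rep_cls N).
rewrite -(net_iso_dist fg) !fr; congr (dist (root (rep t) _) _); exact: addn0.
Qed.

Variables (mu : probability (Gstar M) R) (P : probability (Trajectory M) R).
Hypothesis mu_uni : unimodular mu.
Hypothesis muP : walk_law mu P.

Lemma ae_shift (Q : Trajectory M -> Prop) : {ae P, forall t : Trajectory M, Q t} ->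
  {ae P, forall t : Trajectory M, Q (shift t)}.
Proof.
move=> [A [mA A0 sA]]; exists (@shift R M @^-1` A); split.
- by rewrite -[X in measurable X]setTI; exact: measurable_shift.
- by rewrite (shift_invariant mu_uni muP).
- by move=> t nQ; apply: sA.
Qed.

Lemma ae_iter_shift (Q : Trajectory M -> Prop) i : {ae P, forall t : Trajectory M, Q t} ->
  {ae P, forall t : Trajectory M, Q (iter i (@shift R M) t)}.
Proof.
elim: i Q => [//|i IH] Q h.
by have := IH (Q \o @shift R M) (ae_shift h).
Qed.

End shifts.

(** * Escape to a given distance with positive probability *)

Section escape.
Variables (R : realType) (M : completeMetricType R).

(** Balls are finite, so some vertex is at distance at least [n]; from there [tree_step] descends
    towards [o] one unit at a time. *)
Lemma exists_dist (N : network M) (o : vert N) n : locally_finite N -> tree_net N ->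
  exists y, dist o y = n.
Proof.
move=> lf [[cN aN] iN].
have [y yn] : exists y, (n <= dist o y)%N.
  apply: contrapT => h; apply: iN.
  apply: sub_finite_set (finite_nball (fun _ : 'I_1 => o) n lf) => y _.
  have [w _] := distP o y cN; exists ord0, (dist o y); split=> //.
  by rewrite leqNgt; apply/negP => yn; apply: h; exists y; exact: ltnW.
have [k] : exists k, k = (dist o y - n)%N by exists (dist o y - n)%N.
elim: k y yn => [|k IH] y yn ky; first by exists y; lia.
have yo : y <> o.
  move=> yo; have : dist o y == 0%N by rewrite yo dist0.
  by move=> /eqP d0; rewrite d0 in ky.
have [p [_ dp _]] := tree_step aN cN yo.
by apply: (IH (tgt p)); lia.
Qed.

Variables (mu : probability (Gstar M) R) (P : probability (Trajectory M) R).
Hypothesis muP : walk_law mu P.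
Hypothesis deg_fin : (mean_degree mu < +oo)%E.
Hypothesis mu_trees : {ae mu, forall g, infinite_tree g}.

Lemma trees_deg_gt0 : {ae mu, forall g : Gstar M, (0 < deg (rt g))%N}.
Proof.
apply: filterS mu_trees => g [[cN _] iN]; apply: infinite_deg_gt0 => //.
exact: net_locfin.
Qed.

(** Otherwise, as [bias] is positive, from almost every root the walk would never be at distance [n]
    after [n] steps; but a vertex at distance [n] exists and [trans n] is positive there. *)
Lemma escape_not_null n : ~ {ae P, forall t : Trajectory M, walk_dist t n <> n}.
Proof.
pose A : set (Gspace M n.+1) := [set h | distc ord0 ord_max h = n].
have mA : measurable A.
  exact: (@locally_determined_measurable R M nat n.+1 _ [set n] (@distc_determined R M n.+1 ord0 ord_max)).
have m1 : measurable_fun setT (fun h : Gspace M n.+1 => (\1_A h)%:E : \bar R).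
  by apply/measurable_EFinP; exact: measurable_indic.
move=> h; have : P (@segment R M n @^-1` A) = 0%E.
  apply: measure_negligible.
    by rewrite -[X in measurable X]setTI; exact: measurable_segment.
  by apply: negligibleS h => t /=; rewrite /A /= distc_segment => ->; exact.
rewrite (prob_segment P mA) (walk_expectation muP m1); last by move=> g; rewrite lee_fin.
move=> int0; have mF : measurable_fun setT (fun g : Gstar M =>
    ((bias mu g)%:E * walk_op (fun h => (\1_A h)%:E) g)%E).
  apply: emeasurable_funM; last by apply: measurable_walk_op => // g; rewrite lee_fin.
  by apply/measurable_EFinP; exact: measurable_bias.
have F0 g : (0 <= (bias mu g)%:E * walk_op (fun h => (\1_A h)%:E) g)%E.
  apply: mule_ge0; first by rewrite lee_fin bias_ge0.
  by apply: walk_op_ge0 => h'; rewrite lee_fin.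
have ae0 := (ae_eq_integral_abs mu measurableT mF).1.
have {}ae0 : ae_eq mu setT (fun g : Gstar M =>
    ((bias mu g)%:E * walk_op (fun h => (\1_A h)%:E) g)%E) (cst 0%E).
  apply: ae0; rewrite -[RHS]int0; apply: eq_integral => g _; exact: gee0_abs.
suff : {ae mu, forall g : Gstar M, False}.
  move=> [B [mB B0 sB]]; have : mu setT = 0%E.
    by apply/eqP; rewrite -measure_le0 -B0 le_measure ?inE//; move=> g _; exact: sB.
  by rewrite probability_setT => /eqP; rewrite eqe oner_eq0.
apply: filterS2 mu_trees ae0 => g ig /(_ I) /eqP.
have ia : (0 < fine (mean_degree mu)) by exact: (mean_degree_gt0 deg_fin trees_deg_gt0).
rewrite mule_eq0 eqe /bias mulf_eq0 invr_eq0 (gt_eqF ia) orbF pnatr_eq0.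
have [[cN _] iN] := ig.
rewrite gtn_eqF ?infinite_deg_gt0//=; last exact: net_locfin.
have [y yn] := exists_dist (rt g) n (net_locfin (rep g)) ig.
pose G (h : netclass M 'I_2) : \bar R := (distc ord0 ord_max h == n)%:R%:E.
rewrite (_ : (fun h => (\1_A h)%:E) = fun h => G (pull_pair ord0 ord_max h)); last first.
  apply/funext => h'; rewrite /G indicE -(cls_rep h') pull_pairE distcE /=.
  rewrite !(tnth_nth (root (rep h') ord0)) /=; congr ((nat_of_bool _)%:R%:E).
  by apply/idP/eqP => [/set_mem|e]; [rewrite /A /= distcE|apply/mem_set; rewrite /A /= distcE].
have G0 h' : (0 <= G h')%E by rewrite lee_fin.
rewrite -(rep_root_eq g) -(trans_walk_op n (N := rep g))//.
rewrite gt_eqF//; apply: (@lt_le_trans _ _ (trans n (pair_cls (rt g) y) * G (pair_cls (rt g) y))%E).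
  rewrite mule_gt0//.
    by apply: trans_gt0; rewrite -yn; exact: (distP (rt g) y cN).1.
  by rewrite lte_fin distcE /= !(tnth_nth (rt g)) /= yn eqxx ltr01.
by apply: esum_ge; exists [set y]; [split|rewrite fsbig_set1].
Qed.

End escape.

(** * Identification of the speed *)

Section speed.
Variables (R : realType) (M : completeMetricType R).
Implicit Types t : Trajectory M.

Definition inv_deg (g : Gstar M) : R := (deg (rt g))%:R^-1.

Lemma inv_deg_bound g : 0 <= inv_deg g <= 1.
Proof.
rewrite /inv_deg invr_ge0 ler0n /=; have [->|d0] := posnP (deg (rt g)).
  by rewrite invr0.
by rewrite invf_le1 ?ltr0n// ler1n.
Qed.

Lemma inv_deg_at t k : inv_deg (at_ k t) = (deg (root (rep t) k))%:R^-1.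
Proof. by rewrite /inv_deg /at_ /pull -[deg _]/(degc ord0 _) degcE. Qed.

(** The distance without the reflection at [w_0]: its drift is [1 - 2 / deg] at every position, so
    [ergodic_average] applies to it. *)
Definition potential t n : R := compensated t n + \sum_(k < n) (1 - 2 * inv_deg (at_ k t)).

Lemma walk_dist0 t : walk_dist t 0%N = 0%N.
Proof. by apply/eqP; rewrite /walk_dist dist0//; exact: net_connected. Qed.

(** [drift] differs from [1 - 2 / deg] only at [w_0], by [2 / deg w_0] for each visit. *)
Lemma walk_distE t n : (walk_dist t n)%:R =
  potential t n + 2 * inv_deg (at_ 0 t) * (zeros (walk_dist t) n)%:R.
Proof.
have e : \sum_(k < n) drift (segment k t) = \sum_(k < n) (1 - 2 * inv_deg (at_ k t)) +
    2 * inv_deg (at_ 0 t) * (zeros (walk_dist t) n)%:R.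
  rewrite /zeros natr_sum mulr_sumr -big_split/=; apply: eq_bigr => k _.
  rewrite /drift distc_segment degc_segment !inv_deg_at.
  have [w0|w0] := eqVneq (walk_dist t k) 0%N; last by rewrite /=; ring.
  suff -> : root (rep t) k = root (rep t) 0%N by rewrite /=; ring.
  by apply/esym/eqP; rewrite -dist0; [exact/eqP|exact: net_connected].
by rewrite /potential compensatedE e; ring.
Qed.

Variables (mu : probability (Gstar M) R) (P : probability (Trajectory M) R).
Hypothesis mu_uni : unimodular mu.
Hypothesis muP : walk_law mu P.
Hypothesis deg_fin : (mean_degree mu < +oo)%E.
Hypothesis mu_trees : {ae mu, forall g, infinite_tree g}.
Hypothesis mu_ext : extremal mu.

Let a : R := fine (mean_degree mu).
Let deg_pos := trees_deg_gt0 mu_trees.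
Let a0 : 0 < a. Proof. exact: mean_degree_gt0 deg_fin deg_pos. Qed.

Lemma measurable_inv_deg : measurable_fun setT inv_deg.
Proof.
exact: (measurable_locally_determined (fun n : nat => n%:R^-1 : R) (@degc_determined R M 1 ord0)).
Qed.

(** The degree bias cancels [1 / deg] and leaves the total mass of [mu] divided by [a]. *)
Lemma expect_inv_deg : expect P (fun t => inv_deg (at_ 0 t)) = a^-1.
Proof.
have mi := measurable_inv_deg; apply: EFin_inj; rewrite -expectE; last first.
  apply: bmfun_unit; first exact: (measurableT_comp mi (measurable_at 0)).
  by move=> t; exact: inv_deg_bound.
transitivity (\int[P]_t (inv_deg (lastc (segment 0 t)))%:E)%E.
  by apply: eq_integral => t _; rewrite (at_lastc 0).
rewrite (walk_expectation muP (n := 0) (F := fun g => (inv_deg (lastc g))%:E)); last 2 first.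
- by apply/measurable_EFinP; exact: (measurableT_comp mi (measurable_pull _)).
- by move=> g; rewrite lee_fin; have /andP[] := inv_deg_bound (lastc g).
transitivity (\int[mu]_g (cst (a^-1)%:E g))%E; last first.
  by rewrite integral_cst// [X in (_ * X)%E](probability_setT mu) mule1.
apply: ge0_ae_eq_integral => //.
- apply: emeasurable_funM; apply/measurable_EFinP; first exact: measurable_bias.
  exact: (measurableT_comp mi (measurable_pull _)).
- move=> g _; apply: mule_ge0; rewrite lee_fin ?bias_ge0//.
  by have /andP[] := inv_deg_bound (lastc g).
- by move=> g _; rewrite lee_fin invr_ge0 ltW.
apply: filterS deg_pos => g dg _; rewrite /= lastc1 /bias -/a -EFinM; congr (_%:E).
by rewrite /inv_deg mulrAC divff ?mul1r// pnatr_eq0 -lt0n.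
Qed.

Lemma potential_cvg :
  {ae P, forall t : Trajectory M, potential t n / n%:R @[n --> \oo] --> (1 - 2 / a : R)}.
Proof.
have h := ergodic_average mu_uni muP deg_fin deg_pos mu_ext measurable_inv_deg inv_deg_bound.
apply: filterS2 (compensated_cvg muP mu_trees) h => t ct; rewrite expect_inv_deg => avg.
rewrite -[X in _ --> X]add0r.
have lim : compensated t n / n%:R + (1 - 2 * ((\sum_(k < n) inv_deg (at_ k t)) / n%:R)) @[n --> \oo]
    --> 0 + (1 - 2 / a).
  apply: cvgD => //; apply: cvgB; first exact: cvg_cst.
  by apply: cvgM => //; exact: cvg_cst.
apply: cvg_trans lim; apply: near_eq_cvg; near=> n.
have n0 : n%:R != 0 :> R by rewrite pnatr_eq0 -lt0n; near: n; exists 1%N.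
apply/esym; rewrite /potential mulrDl; congr (_ + _).
rewrite big_split/= sumr_const card_ord sumrN -mulr_sumr mulrBl divff//.
by rewrite mulrA.
Unshelve. all: by end_near. Qed.

(** Reaching distance [K] in [K] steps forces [w_i] to be at distance [i] for [i <= K]. So
    [w_0, ..., w_K] are distinct, and each time before [n + K] is counted for at most one of
    them. *)
Lemma zeros_disjoint t K n : tree_net (rep t) -> adjacent_path t -> walk_dist t K = K ->
  (\sum_(i < K.+1) zeros (walk_dist (iter i (@shift R M) t)) n <= n + K)%N.
Proof.
move=> tt ta tK; have cN := net_connected (rep t).
have up i j : (walk_dist t (i + j) <= walk_dist t i + j)%N.
  elim: j => [|j IH]; first by rewrite !addn0.
  rewrite !addnS; apply: leq_trans (adjacent_walk_dist _ ta).1 _.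
  by rewrite ltnS.
have wi i : (i <= K)%N -> walk_dist t i = i.
  move=> iK; have := up 0%N i; have := up i (K - i)%N.
  by rewrite walk_dist0 subnKC// tK add0n; lia.
have zle i : (i <= K)%N -> (zeros (walk_dist (iter i (@shift R M) t)) n <=
    \sum_(m < n + K) (root (rep t) m == root (rep t) i))%N.
  move=> iK; rewrite /zeros.
  under eq_bigr do rewrite walk_dist_iter dist0//.
  rewrite -(big_mkord xpredT (fun k => (root (rep t) i == root (rep t) (i + k)) : nat)).
  rewrite -(big_mkord xpredT (fun k => (root (rep t) k == root (rep t) i) : nat)).
  have nK : (i + n <= n + K)%N by lia.
  rewrite [leqRHS](@big_cat_nat _ _ _ i 0 (n + K))//=; last by apply: leq_trans nK; exact: leq_addr.
  rewrite [X in (_ <= _ + X)%N](@big_cat_nat _ _ _ (i + n) i (n + K))//=; last exact: leq_addr.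
  have -> : (\sum_(i <= k < i + n) (root (rep t) k == root (rep t) i) =
      \sum_(0 <= k < n) (root (rep t) i == root (rep t) (i + k)))%N.
    rewrite -{1}(add0n i) big_addn addKn; apply: eq_bigr => k _.
    by rewrite eq_sym addnC.
  apply: leq_trans (leq_addl _ _); exact: leq_addr.
apply: (@leq_trans (\sum_(i < K.+1) \sum_(m < n + K) (root (rep t) m == root (rep t) i))).
  by apply: leq_sum => i _; apply: zle; rewrite -ltnS.
rewrite exchange_big /=; apply: (@leq_trans (\sum_(m < n + K) 1)).
  apply: leq_sum => m _.
  have [[i mi]|no] := pselect (exists i : 'I_K.+1, root (rep t) m = root (rep t) i).
    rewrite (bigD1 i)//= mi eqxx big1 ?addn0// => j ji.
    case: eqP => [ij|//]; case/eqP: ji; apply: val_inj => /=.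
    have iK : (i <= K)%N by rewrite -ltnS.
    have jK : (j <= K)%N by rewrite -ltnS.
    by have := wi i iK; have := wi j jK; rewrite /walk_dist -ij => -> ->.
  rewrite big1// => i _; case: eqP => // mi; case: no; by exists i.
by rewrite sum1_card card_ord.
Qed.

(** If [c < 0], the potential started at any [w_i] decreases linearly, and the distance stays
    nonnegative only through a positive frequency of visits to [w_i]. When [w_0, ..., w_K] are
    distinct, [zeros_disjoint] leaves too few visits for all of them; by [escape_not_null] this case
    cannot be neglected. *)
Lemma speed_ge0 : 0 <= 1 - 2 / a.
Proof.
rewrite leNgt; apply/negP; move ec : (1 - 2 / a) => c c0.
(* With an error of [e] allowed, the potential still decreases at rate [e], because [c + e = -e]. A
   visit compensates at most 2, so [K] is taken with [(K + 1) * e > 2 + e]. *)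
pose e := - c / 2; have e0 : 0 < e by rewrite /e; lra.
pose K := (Num.truncn (2 / e)).+1.
have Ke : 2 + e < K.+1%:R * e.
  by rewrite -[K.+1%:R]natr1 mulrDl mul1r ltrD2r -ltr_pdivrMr// truncnS_gt.
have shifts : {ae P, forall t : Trajectory M, forall i,
    potential (iter i (@shift R M) t) n / n%:R @[n --> \oo] --> c}.
  apply: ae_foralln => i; rewrite -ec.
  exact: (ae_iter_shift mu_uni muP (Q := fun t => potential t n / n%:R @[n --> \oo] --> (1 - 2 / a : R)) i potential_cvg).
apply: (@escape_not_null R M mu P muP deg_fin mu_trees K).
apply: filterS3 shifts (trajectory_tree muP mu_trees) (trajectory_adjacent muP) => t lim tt ta tK.
have /choice[C CP] i : exists C, forall n,
    `|potential (iter i (@shift R M) t) n - c * n%:R| <= e * n%:R + C.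
  exact: linear_bound (lim i) e e0.
have bound i n : e * n%:R <= C i + 2 * (zeros (walk_dist (iter i (@shift R M) t)) n)%:R.
  have := CP i n; rewrite ler_norml => /andP[_].
  have := walk_distE (iter i (@shift R M) t) n.
  have : 0 <= (walk_dist (iter i (@shift R M) t) n)%:R :> R by [].
  have /andP[v0 v1] := inv_deg_bound (at_ 0 (iter i (@shift R M) t)).
  have : 0 <= (zeros (walk_dist (iter i (@shift R M) t)) n)%:R :> R by [].
  move: (zeros _ _)%:R (walk_dist _ _)%:R (potential _ _) (inv_deg _) v0 v1 => z d p v v0 v1 z0 d0 dE.
  have : v * z <= z by rewrite ler_piMl.
  have -> : c = - 2 * e by rewrite /e; field.
  by lra.
pose B := \sum_(i < K.+1) C i + 2 * K%:R.
(* Summing [bound] over [i] gives [(K + 1) * e * n <= B + 2 * n]; by the choice of [K] this bounds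
   [e * n] uniformly in [n], which is absurd. *)
have big n : e * n%:R <= B.
  have : K.+1%:R * (e * n%:R) <= \sum_(i < K.+1) C i + 2 * (n + K)%:R.
    rewrite mulr_natl -[X in _ *+ X]card_ord -sumr_const.
    apply: (@le_trans _ _ (\sum_(i < K.+1)
        (C i + 2 * (zeros (walk_dist (iter i (@shift R M) t)) n)%:R))).
      by apply: ler_sum => i _; exact: bound.
    rewrite big_split/= lerD2l -mulr_sumr ler_wpM2l// -natr_sum ler_nat.
    exact: zeros_disjoint.
  have : (2 + e) * n%:R <= K.+1%:R * e * n%:R by rewrite ler_wpM2r// ltW.
  by rewrite /B natrD mulrA; lra.
have := big (Num.truncn (B / e)).+1.
by rewrite mulrC -ler_pdivlMr// leNgt truncnS_gt.
Qed.

Lemma walk_speed : {ae P, forall t : Trajectory M, has_speed t (1 - 2 / a)}.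
Proof.
apply: filterS potential_cvg => t ct; have v01 := inv_deg_bound (at_ 0 t).
exact: (reflected_cvg v01 speed_ge0 (walk_dist0 t) (walk_distE t) ct).
Qed.

End speed.

Theorem proposition4p9 (R : realType) (M : completeMetricType R)
    (Msep : separable_space M) (mu : probability (Gstar M) R)
    (mu_unimodular : unimodular mu)
    (mu_trees : {ae mu, forall g, infinite_tree g})
    (mu_extremal : extremal mu)
    (mu_deg : (mean_degree mu < +oo)%E)
    (muhat : probability (Trajectory M) R) (muhat_law : walk_law mu muhat) :
  {ae muhat, forall t, has_speed t (1 - 2 / fine (mean_degree mu))}.
Proof. exact: walk_speed. Qed.
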